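(* Suppose that $\psi$ is a function of bounded variation on $\mathbb{R}$. Then the function $(x,y)\mapsto\psi(\max\{x,y\})$ on $\mathbb{R}^2$ is a Schur multiplier of weak type $(1/2,1/2)$.
   Context: Singular numbers: $s_n(T)=\inf\{\|T-R\|:\operatorname{rank}R\le n\}$, $n\ge0$. For $0<p<\infty$, $\boldsymbol{S}_p$ is the class of bounded operators with $\sum_{n\ge0}s_n(T)^p<\infty$, and $\boldsymbol{S}_{p,\infty}$ is the class of bounded operators for which there is a constant $C$ with $s_n(T)\le C(1+n)^{-1/p}$ for all $n\ge0$. For $0<p\le2$, a function $\omega$ on $\mathbb{R}^2$ is a Schur multiplier of weak type $(p,p)$ if the integral operator on $L^2(\mathbb{R})$ with kernel function $\omega k$ belongs to $\boldsymbol{S}_{p,\infty}$ whenever the integral operator on $L^2(\mathbb{R})$ with kernel function $k$ belongs to $\boldsymbol{S}_p$. *)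

(* Defs.v *)
From HB Require Import structures.
From mathcomp Require Import all_boot all_order all_algebra.
From mathcomp Require Import all_classical all_reals all_analysis.
From mathcomp Require Import complex.
Set Implicit Arguments.
Unset Strict Implicit.
Unset Printing Implicit Defensive.
Import Order.TTheory GRing.Theory Num.Theory.
Import numFieldNormedType.Exports.
Local Open Scope classical_set_scope.
Local Open Scope ring_scope.

Local Notation normc := ComplexField.Normc.normc.

Definition cmeasurable d (T : measurableType d) (R : realType)
    (f : T -> R[i]) : Prop :=
  measurable_fun [set: T] (fun x => complex.Re (f x)) /\
  measurable_fun [set: T] (fun x => complex.Im (f x)).

Section L2.
Context {R : realType}.

Local Notation mu := (@lebesgue_measure R).
Implicit Types f g : R -> R[i].
Implicit Types T S : (R -> R[i]) -> (R -> R[i]).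

Definition cintegrable f : Prop :=
  mu.-integrable [set: R] (fun x => (complex.Re (f x))%:E) /\
  mu.-integrable [set: R] (fun x => (complex.Im (f x))%:E).

Definition cintegral f : R[i] :=
  Complex (\int[mu]_x complex.Re (f x)) (\int[mu]_x complex.Im (f x)).

Definition eq_ae f g : Prop := {ae mu, forall x, f x = g x}.

Definition L2norm f : \bar R := 'N[mu]_2%:E[(fun x => (normc (f x))%:E)]%E.

Definition inL2 f : Prop := cmeasurable f /\ (L2norm f < +oo)%E.

(* The elements of the Hilbert space L^2(R) are represented by functions, and
   equality in L^2(R) is [eq_ae]. *)

Definition opnorm T : \bar R :=
  ereal_sup [set L2norm (T f) | f in [set f | inL2 f /\ (L2norm f <= 1)%E]].

(* Linearity and finiteness of the norm make T compatible with [eq_ae], so T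
   does act on the classes. *)
Definition bounded_operator T : Prop :=
  [/\ forall f, inL2 f -> inL2 (T f),
      forall (a : R[i]) f g, inL2 f -> inL2 g ->
        eq_ae (T (fun x => a * f x + g x)) (fun x => a * T f x + T g x)
    & (opnorm T < +oo)%E].

(* The range of T lies in the span of n elements of L^2(R). *)
Definition rank_le (n : nat) T : Prop :=
  exists e : 'I_n -> (R -> R[i]),
    (forall i, inL2 (e i)) /\
    forall f, inL2 f -> exists c : 'I_n -> R[i],
      eq_ae (T f) (fun x => \sum_(i < n) c i * e i x).

Definition singular_number (n : nat) T : \bar R :=
  ereal_inf [set opnorm (fun f x => T f x - S f x)
            | S in [set S | bounded_operator S /\ rank_le n S]].

Definition schatten (p : R) T : Prop :=
  bounded_operator T /\
  (\sum_(0 <= n <oo) poweR (singular_number n T) p < +oo)%E.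

Definition weak_schatten (p : R) T : Prop :=
  bounded_operator T /\
  exists C : R, forall n : nat,
    (singular_number n T <= (C * (1 + n%:R) `^ (- p^-1))%:E)%E.

(* Kernels are functions on the plane; [integral_operator k f x] is meaningful
   only for those x at which y |-> k (x, y) * f y is integrable. *)
Definition integral_operator (k : R * R -> R[i]) : (R -> R[i]) -> (R -> R[i]) :=
  fun f x => cintegral (fun y => k (x, y) * f y).

Definition kernel_function (k : R * R -> R[i]) : Prop :=
  cmeasurable k /\
  forall f, inL2 f -> {ae mu, forall x, cintegrable (fun y => k (x, y) * f y)}.

(* Intended for 0 < p <= 2. *)
Definition weak_schur_multiplier (p : R) (w : R * R -> R[i]) : Prop :=
  forall k : R * R -> R[i],
    kernel_function k -> schatten p (integral_operator k) ->
    kernel_function (fun z => w z * k z) /\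
    weak_schatten p (integral_operator (fun z => w z * k z)).

Definition bounded_variation_line (psi : R -> R[i]) : Prop :=
  exists M : R, forall s : seq R, sorted <%R s ->
    \sum_(i < (size s).-1) normc (psi s`_i.+1 - psi s`_i) <= M.

End L2.

(* Main.v *)
Require Import Defs.
From HB Require Import structures.
From mathcomp Require Import all_boot all_order all_algebra.
From mathcomp Require Import all_classical all_reals all_analysis.
From mathcomp Require Import measurable_realfun.
From mathcomp Require Import complex ring lra zify.
Set Implicit Arguments.
Unset Strict Implicit.
Unset Printing Implicit Defensive.
Import Order.TTheory GRing.Theory Num.Theory.
Import numFieldNormedType.Exports.
Local Open Scope classical_set_scope.
Local Open Scope ring_scope.
Local Open Scope complex_scope.

Local Notation normc := ComplexField.Normc.normc.
Local Notation Re := complex.Re.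
Local Notation Im := complex.Im.
Local Notation "z ^*" := (conjc z) : ring_scope.

(** Let [T] be the integral operator with kernel [k].

    Rank one.  Let [f] and [g] be unit vectors.  Choose a nondecreasing [v] with
    values in the unit interval which controls at once the variation of [psi]
    and the masses of [f] and [g], and cut the line into the sets where [v] lies
    in a dyadic interval of length [2 ^- l].  On a block off the diagonal the
    larger variable is known, so the kernel [psi (max x y) * f x * (g y)^*] is a
    product there; on a diagonal block [psi] differs from a constant by
    [O (2 ^- l)].  Going from level [l] to level [l + 1] therefore costs
    [4 * 2 ^ l] operators of rank one, each of norm [O (4 ^- l)]: a factor
    [2 ^- l] is the oscillation of [psi], and each of [f] and [g] contributes
    [2 ^- (l / 2)].  So the distorted operator is a sum of rank-one operators
    whose [n]-th norm is [O (n ^- 2)] ([err_refine], [wop_splits]).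

    Sums.  An operator of Schatten class one half is a sum of rank-one operators
    whose norms have summable square roots: take differences of approximations
    of rank [2 ^ m] ([atomic_decomposition]).  Although the weak class is not
    normed, it is stable under such sums.  Given [N], keep the levels up to
    [2 ^ l ~ N * t], where [t ^ 2] is the norm of the rank-one operator at hand:
    the total rank is [O (N)] and what is left has nuclear norm [O (1 / N)]
    ([truncation_splits]).  An operator of nuclear norm [nu] is within
    [nu / (N + 1)] of an operator of rank [2 * N] ([nuclear_rank]), so the
    singular number of index [26 * N] is [O (N ^- 2)].

    Limits.  The decomposition of [T] converges in operator norm only, and must
    be related to the kernel [psi (max x y) * k (x, y)].  If [psi] is a step
    function, multiplying the kernel by [psi (max x y)] amounts to combining
    compressions of [T] to half-lines, which is continuous in operator norm; a
    function of bounded variation is a uniform limit of step functions, and the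
    lemma of Fatou concludes ([transfer]). *)

(** * Complex numbers and their modulus *)

Section Scalars.
Context {R : realType}.
Implicit Types z w : R[i].

Lemma normc_ge0 z : 0 <= normc z.
Proof. by case: z => a b; exact: sqrtr_ge0. Qed.

Lemma conjcD z w : (z + w)^* = z^* + w^*. Proof. exact: rmorphD. Qed.

Lemma conjcN z : (- z)^* = - z^*. Proof. exact: rmorphN. Qed.

Lemma conjcM z w : (z * w)^* = z^* * w^*. Proof. exact: rmorphM. Qed.

Lemma normc_conj z : normc z^* = normc z.
Proof. by case: z => a b /=; rewrite sqrrN. Qed.

Lemma normc_real (x : R) : normc x%:C = `|x|.
Proof. by rewrite /= expr0n /= addr0 sqrtr_sqr. Qed.

Lemma sqr_normcE z : normc z ^+ 2 = Re z ^+ 2 + Im z ^+ 2.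
Proof. by case: z => a b /=; rewrite sqr_sqrtr // addr_ge0 ?sqr_ge0. Qed.

Lemma mulcJ z : z * z^* = (normc z ^+ 2)%:C.
Proof.
rewrite sqr_normcE; case: z => a b /=; apply/eqP.
by rewrite eq_complex /=; apply/andP; split; apply/eqP; ring.
Qed.

Lemma le_Re_normc z : `|Re z| <= normc z.
Proof.
rewrite -(ler_pXn2r (n := 2)) ?nnegrE ?normc_ge0 //.
by rewrite sqr_normcE -normrX ger0_norm ?sqr_ge0 // lerDl sqr_ge0.
Qed.

Lemma le_Im_normc z : `|Im z| <= normc z.
Proof.
rewrite -(ler_pXn2r (n := 2)) ?nnegrE ?normc_ge0 //.
by rewrite sqr_normcE -normrX ger0_norm ?sqr_ge0 // lerDr sqr_ge0.
Qed.

Lemma normc_eq0 z : (normc z == 0) = (z == 0).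
Proof.
apply/eqP/eqP => [/ComplexField.Normc.eq0_normc //|->].
exact: ComplexField.Normc.normc0.
Qed.

Lemma normc_sum (I : Type) (s : seq I) (F : I -> R[i]) :
  normc (\sum_(i <- s) F i) <= \sum_(i <- s) normc (F i).
Proof.
elim: s => [|i s IHs]; first by rewrite !big_nil ComplexField.Normc.normc0.
by rewrite !big_cons (le_trans (le_normcD _ _)) // lerD2l.
Qed.

End Scalars.

(** * Semi-inner products *)

Section SemiInner.
Context {R : realType} {V : lmodType R[i]} (ip : V -> V -> R[i]).
Local Notation "<< f , g >>" := (ip f g).

Record semi_inner : Prop := SemiInner {
  ip_linl : forall a f g h, << a *: f + g, h >> = a * << f, h >> + << g, h >>;
  ip_conj : forall f g, << g, f >> = << f, g >>^*;
  ip_ge0 : forall f, 0 <= << f, f >> }.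

Definition nrm (f : V) : R := Num.sqrt (Re << f, f >>).

Context (ipS : semi_inner).

Lemma ipDl f g h : << f + g, h >> = << f, h >> + << g, h >>.
Proof. by have := ip_linl ipS 1 f g h; rewrite scale1r mul1r. Qed.

Lemma ip0l h : << 0, h >> = 0.
Proof. by apply: (addrI << 0, h >>); rewrite -ipDl !addr0. Qed.

Lemma ipZl a f h : << a *: f, h >> = a * << f, h >>.
Proof. by have := ip_linl ipS a f 0 h; rewrite ip0l !addr0. Qed.

Lemma ipNl f h : << - f, h >> = - << f, h >>.
Proof. by rewrite -scaleN1r ipZl mulN1r. Qed.

Lemma ipBl f g h : << f - g, h >> = << f, h >> - << g, h >>.
Proof. by rewrite ipDl ipNl. Qed.

Lemma ip_suml (I : Type) (s : seq I) (F : I -> V) h :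
  << \sum_(i <- s) F i, h >> = \sum_(i <- s) << F i, h >>.
Proof.
elim: s => [|i s IHs]; first by rewrite !big_nil ip0l.
by rewrite !big_cons ipDl IHs.
Qed.

Lemma ipDr f g h : << h, f + g >> = << h, f >> + << h, g >>.
Proof. by rewrite ip_conj // ipDl conjcD -!(ip_conj ipS). Qed.

Lemma ip0r h : << h, 0 >> = 0.
Proof. by rewrite ip_conj // ip0l conjc0. Qed.

Lemma ipZr a f h : << h, a *: f >> = a^* * << h, f >>.
Proof. by rewrite ip_conj // ipZl conjcM -!(ip_conj ipS). Qed.

Lemma ipNr f h : << h, - f >> = - << h, f >>.
Proof. by rewrite ip_conj // ipNl conjcN -!(ip_conj ipS). Qed.

Lemma ip_sumr (I : Type) (s : seq I) (F : I -> V) h :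
  << h, \sum_(i <- s) F i >> = \sum_(i <- s) << h, F i >>.
Proof.
elim: s => [|i s IHs]; first by rewrite !big_nil ip0r.
by rewrite !big_cons ipDr IHs.
Qed.

Lemma normc_ipC f g : normc << f, g >> = normc << g, f >>.
Proof. by rewrite ip_conj // normc_conj. Qed.

Lemma nrm_ge0 f : 0 <= nrm f. Proof. exact: sqrtr_ge0. Qed.
Hint Resolve nrm_ge0 : core.

Lemma ipff f : << f, f >> = (nrm f ^+ 2)%:C.
Proof.
have := ip_ge0 ipS f; rewrite lecE => /andP[/eqP im0 re0].
rewrite /nrm sqr_sqrtr //; case: <<f, f>> im0 => a b /= ->.
by [].
Qed.

Lemma nrm_sqr f : nrm f ^+ 2 = Re << f, f >>. Proof. by rewrite ipff. Qed.

Lemma nrm0 : nrm 0 = 0.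
Proof. by rewrite /nrm ip0l sqrtr0. Qed.

Lemma nrmZ a f : nrm (a *: f) = normc a * nrm f.
Proof.
apply/eqP; rewrite -(eqrXn2 (n := 2)) ?mulr_ge0 ?normc_ge0 //; apply/eqP.
by rewrite exprMn nrm_sqr ipZl ipZr mulrA mulcJ ipff -rmorphM.
Qed.

Lemma nrmN f : nrm (- f) = nrm f.
Proof. by rewrite -scaleN1r nrmZ normcN ComplexField.Normc.normc1 mul1r. Qed.

Lemma nrm_distC f g : nrm (f - g) = nrm (g - f).
Proof. by rewrite -nrmN opprB. Qed.

Lemma nrmD_sqr f g :
  nrm (f + g) ^+ 2 = nrm f ^+ 2 + 2 * Re << f, g >> + nrm g ^+ 2.
Proof.
rewrite !nrm_sqr ipDl !ipDr !raddfD /= (ip_conj ipS f g).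
by case: <<f, g>> => a b /=; ring.
Qed.

(** The square of the norm of [f - t * z *: g], with [z] the inner product of [f]
    and [g], is a nonnegative quadratic function of the real number [t].  When
    [g] is null it is affine, which forces [z] to vanish. *)
Lemma cauchy_schwarz f g : normc << f, g >> <= nrm f * nrm g.
Proof.
set z := << f, g >>.
have key (t : R) :
    0 <= nrm f ^+ 2 - 2 * t * normc z ^+ 2
         + t ^+ 2 * normc z ^+ 2 * nrm g ^+ 2.
  have := sqr_ge0 (nrm (f + (- t%:C * z) *: g)).
  rewrite nrmD_sqr nrmZ ipZr -/z.
  have -> : (- t%:C * z)^* * z = - (t * normc z ^+ 2)%:C.
    by rewrite conjcM conjcN conjc_real mulrAC -mulrA mulcJ mulNr -rmorphM.
  rewrite raddfN /= ComplexField.Normc.normcM normcN normc_real.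
  rewrite exprMn exprMn real_normK ?num_real //; lra.
rewrite -(ler_pXn2r (n := 2)) ?nnegrE ?mulr_ge0 ?normc_ge0 //.
rewrite exprMn; set X := normc z ^+ 2 in key *.
set A := nrm f ^+ 2 in key *; set B := nrm g ^+ 2 in key *.
have A0 : 0 <= A by exact: sqr_ge0.
have X0 : 0 <= X by exact: sqr_ge0.
have : 0 <= B by exact: sqr_ge0.
rewrite le_eqVlt => /orP[/eqP B0|Bp].
  rewrite -B0 mulr0 leNgt; apply/negP => Xp.
  have := key ((A + 1) / (2 * X)); rewrite -B0 mulr0 addr0.
  have -> : 2 * ((A + 1) / (2 * X)) * X = A + 1.
    by field; rewrite gt_eqF.
  lra.
have := key B^-1.
have -> : A - 2 * B^-1 * X + B^-1 ^+ 2 * X * B = (A * B - X) / B.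
  by field; rewrite gt_eqF.
by rewrite pmulr_lge0 ?invr_gt0 // subr_ge0.
Qed.

Lemma nrmD f g : nrm (f + g) <= nrm f + nrm g.
Proof.
rewrite -(ler_pXn2r (n := 2)) ?nnegrE ?addr_ge0 // nrmD_sqr sqrrD.
rewrite lerD2r lerD2l mulr_natl ler_pMn2r //.
by rewrite (le_trans (ler_norm _)) // (le_trans (le_Re_normc _)) //
  cauchy_schwarz.
Qed.

Lemma nrmB f g h : nrm (f - h) <= nrm (f - g) + nrm (g - h).
Proof. by rewrite (le_trans _ (nrmD _ _)) // addrA subrK. Qed.

Lemma nrm_sum (I : Type) (s : seq I) (F : I -> V) :
  nrm (\sum_(i <- s) F i) <= \sum_(i <- s) nrm (F i).
Proof.
elim: s => [|i s IHs]; first by rewrite !big_nil nrm0.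
by rewrite !big_cons (le_trans (nrmD _ _)) // lerD2l.
Qed.

Lemma ip_null f g : nrm f = 0 -> << f, g >> = 0.
Proof.
move=> f0; apply/eqP; rewrite -normc_eq0 eq_le normc_ge0 andbT.
by have := cauchy_schwarz f g; rewrite f0 mul0r.
Qed.

(** * Explicit finite-rank operators and orthonormal lists *)

(** Finite-rank operators are carried as lists of pairs: the size of the list
    bounds the rank, and concatenation is addition. *)
Definition finop (l : seq (V * V)) (h : V) : V :=
  \sum_(p <- l) << h, p.2 >> *: p.1.

(** An upper bound of the nuclear norm of [finop l]. *)
Definition nuc (l : seq (V * V)) : R := \sum_(p <- l) nrm p.1 * nrm p.2.

Definition adj (l : seq (V * V)) (h : V) : V :=
  \sum_(p <- l) << p.1, h >>^* *: p.2.

Lemma finop_nil h : finop [::] h = 0. Proof. exact: big_nil. Qed.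

Lemma finop_cat l1 l2 h : finop (l1 ++ l2) h = finop l1 h + finop l2 h.
Proof. exact: big_cat. Qed.

Lemma nuc_cat l1 l2 : nuc (l1 ++ l2) = nuc l1 + nuc l2.
Proof. exact: big_cat. Qed.

Lemma nuc_ge0 l : 0 <= nuc l.
Proof. by apply: sumr_ge0 => p _; rewrite mulr_ge0. Qed.

Lemma finopZ l a h : finop l (a *: h) = a *: finop l h.
Proof.
by rewrite scaler_sumr; apply: eq_bigr => p _; rewrite ipZl scalerA.
Qed.

Lemma finopD l h k : finop l (h + k) = finop l h + finop l k.
Proof.
by rewrite -big_split; apply: eq_bigr => p _; rewrite ipDl scalerDl.
Qed.

Lemma finopB l h k : finop l (h - k) = finop l h - finop l k.
Proof. by rewrite finopD -[- k]scaleN1r finopZ scaleN1r. Qed.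

Lemma ip_finop l h k : << finop l h, k >> = << h, adj l k >>.
Proof.
rewrite ip_suml ip_sumr; apply: eq_bigr => p _.
by rewrite ipZl ipZr conjcK mulrC.
Qed.

Lemma nrm_finop l h : nrm (finop l h) <= nuc l * nrm h.
Proof.
rewrite mulr_suml (le_trans (nrm_sum _ _)) //; apply: ler_sum => p _.
rewrite nrmZ mulrC -mulrA ler_wpM2l // mulrC.
by rewrite (le_trans (cauchy_schwarz _ _)).
Qed.

Definition neg_pairs (l : seq (V * V)) := [seq (- p.1, p.2) | p <- l].

Lemma finop_neg l h : finop (neg_pairs l) h = - finop l h.
Proof.
rewrite /finop big_map -sumrN; apply: eq_bigr => p _.
by rewrite scalerN.
Qed.

Fixpoint orthonormal (s : seq V) : Prop :=
  if s is x :: s' then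
    [/\ nrm x = 1, forall y, y \in s' -> << y, x >> = 0 & orthonormal s']
  else True.

Definition proj (s : seq V) (h : V) : V := \sum_(u <- s) << h, u >> *: u.

Lemma proj_finop s h : proj s h = finop [seq (u, u) | u <- s] h.
Proof. by rewrite /finop big_map. Qed.

Lemma projZ s a h : proj s (a *: h) = a *: proj s h.
Proof. by rewrite !proj_finop finopZ. Qed.

Lemma projD s h k : proj s (h + k) = proj s h + proj s k.
Proof. by rewrite !proj_finop finopD. Qed.

Lemma projB s h k : proj s (h - k) = proj s h - proj s k.
Proof. by rewrite !proj_finop finopB. Qed.

Lemma proj_orth s h u : orthonormal s -> u \in s -> << h - proj s h, u >> = 0.
Proof.
elim: s => [//|x s IHs] /= [x1 xs os].
have zx : << proj s h, x >> = 0.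
  by rewrite ip_suml big_seq big1 // => y ys; rewrite ipZl (xs y ys) mulr0.
rewrite inE /proj big_cons opprD addrCA addrC => /predU1P[->|us].
  by rewrite ipDl ipBl zx subr0 ipNl ipZl ipff x1 expr1n mulr1 subrr.
rewrite ipDl IHs // add0r ipNl ipZl (ip_conj ipS u x) (xs u us).
by rewrite conjc0 mulr0 oppr0.
Qed.

Lemma pythagoras s h : orthonormal s ->
  nrm (h - proj s h) ^+ 2 = nrm h ^+ 2 - \sum_(u <- s) normc << h, u >> ^+ 2.
Proof.
elim: s => [|x s IHs] /=; first by rewrite /proj !big_nil !subr0.
move=> [x1 xs os].
have zx : << proj s h, x >> = 0.
  by rewrite ip_suml big_seq big1 // => y ys; rewrite ipZl (xs y ys) mulr0.
rewrite /proj !big_cons [_ *: x + _]addrC opprD addrA -/(proj s h).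
rewrite nrmD_sqr IHs // nrmN nrmZ x1 mulr1 ipNr ipZr ipBl zx subr0.
rewrite (mulrC _^*) mulcJ /=; lra.
Qed.

Lemma bessel s h : orthonormal s ->
  \sum_(u <- s) normc << h, u >> ^+ 2 <= nrm h ^+ 2.
Proof. by move=> /(pythagoras h) e; rewrite -subr_ge0 -e sqr_ge0. Qed.

Lemma nrm_compl s h : orthonormal s -> nrm (h - proj s h) <= nrm h.
Proof.
move=> os; rewrite -(ler_pXn2r (n := 2)) ?nnegrE // pythagoras //.
by rewrite gerBl sumr_ge0 // => u _; rewrite sqr_ge0.
Qed.

Lemma orthonormal_cons s h : orthonormal s -> 0 < nrm (h - proj s h) ->
  orthonormal ((nrm (h - proj s h))^-1%:C *: (h - proj s h) :: s).
Proof.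
move=> os r0 /=; split => // [|y ys].
  by rewrite nrmZ normc_real ger0_norm ?invr_ge0 // mulVf // gt_eqF.
rewrite ipZr (ip_conj ipS (h - proj s h) y) proj_orth //.
by rewrite conjc0 mulr0.
Qed.

(** Vectors whose residual is null are skipped, so the list may shrink. *)
Lemma gram_schmidt (e : seq V) : exists s : seq V,
  [/\ orthonormal s, (size s <= size e)%N &
      forall x, x \in e -> nrm (x - proj s x) = 0].
Proof.
elim: e => [|x e [s [os ss es]]]; first by exists [::].
have [x0|xp] := eqVneq (nrm (x - proj s x)) 0.
  exists s; split => //; first by rewrite (leq_trans ss) // leqnSn.
  by move=> y; rewrite inE => /predU1P[->//|]; exact: es.
have {}xp : 0 < nrm (x - proj s x) by rewrite lt_neqAle eq_sym xp nrm_ge0.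
have os' := orthonormal_cons os xp; move: os'.
set r := nrm _; set u := r^-1%:C *: _ => os'.
exists (u :: s); split => //= y; rewrite inE => /predU1P[->|ye].
  apply/eqP; rewrite -sqrf_eq0 pythagoras // big_cons opprD addrCA.
  rewrite -pythagoras // -/r addrC.
  have -> : normc << x, u >> = r.
    have -> : x = (x - proj s x) + proj s x by rewrite subrK.
    rewrite ipDl.
    have -> : << proj s x, u >> = 0.
      rewrite ip_suml big_seq big1 // => y' ys.
      by case: os' => _ /(_ _ ys) yu _; rewrite ipZl yu mulr0.
    have nu1 : nrm u = 1 by case: os'.
    have -> : x - proj s x = r%:C *: u.
      by rewrite /u scalerA -rmorphM /= divff ?gt_eqF // scale1r.
    rewrite addr0 ipZl ipff nu1 expr1n mulr1 normc_real ger0_norm //.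
    exact: nrm_ge0.
  by rewrite subrr.
apply/eqP; rewrite eq_le nrm_ge0 andbT -(es _ ye).
rewrite -(ler_pXn2r (n := 2)) ?nnegrE // !pythagoras //.
by rewrite big_cons lerD2l lerN2 lerDr sqr_ge0.
Qed.

Lemma orthonormal_nrm s u : orthonormal s -> u \in s -> nrm u = 1.
Proof.
elim: s => [//|x s IHs] /= [x1 _ os].
by rewrite inE => /predU1P[->//|]; exact: IHs.
Qed.

(** * Functionals and finite-rank operators, up to a small error *)

(** An approximate representing vector is enough here, and it exists without
    completeness.  If [g] is a unit vector at which [phi] nearly attains its
    norm [b], then [phi] is nearly zero on the orthogonal complement of [g],
    because a combination of [g] and of an orthogonal vector [h'] cannot do
    better than [b]. *)
Lemma approx_riesz (phi : V -> R[i]) (c eps : R) :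
  (forall a f g, phi (a *: f + g) = a * phi f + phi g) ->
  (forall h, normc (phi h) <= c * nrm h) -> 0 < eps ->
  exists g, forall h, normc (phi h - << h, g >>) <= eps * nrm h.
Proof.
move=> lin bnd eps0.
have phi0 : phi 0 = 0.
  by apply/eqP; rewrite -normc_eq0 eq_le normc_ge0 andbT -(mulr0 c) -nrm0.
have phiZ a f : phi (a *: f) = a * phi f.
  by have := lin a f 0; rewrite phi0 !addr0.
have phiD f g : phi (f + g) = phi f + phi g.
  by have := lin 1 f g; rewrite scale1r mul1r.
pose E := [set normc (phi h) | h in [set h | nrm h <= 1]].
have E0 : E 0 by exists 0; rewrite /= ?nrm0 // phi0 ComplexField.Normc.normc0.
have c0 : has_ubound E.
  exists (Num.max c 0) => _ [h /= h1 <-]; rewrite (le_trans (bnd h)) //.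
  have [c0|c0] := leP 0 c; first by rewrite ler_piMr.
  by rewrite mulr_le0_ge0 // ltW.
pose b := sup E.
have supE : has_sup E by split => //; exists 0.
have b0 : 0 <= b by exact: ub_le_sup.
have bndb h : normc (phi h) <= b * nrm h.
  have [h0|h0] := eqVneq (nrm h) 0; first by have := bnd h; rewrite h0 !mulr0.
  have {}h0 : 0 < nrm h by rewrite lt_neqAle eq_sym h0 nrm_ge0.
  rewrite -ler_pdivrMr //; apply: ub_le_sup => //.
  exists ((nrm h)^-1%:C *: h) => /=.
    by rewrite nrmZ normc_real ger0_norm ?invr_ge0 // mulVf // gt_eqF.
  rewrite phiZ ComplexField.Normc.normcM normc_real ger0_norm ?invr_ge0 //.
  exact: mulrC.
have [beps|beps] := leP b eps.
  by exists 0 => h; rewrite ip0r subr0 (le_trans (bndb h)) // ler_wpM2r.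
have bp : 0 < b by exact: lt_trans beps.
pose d := eps ^+ 2 / (2 * b).
have dp : 0 < d by rewrite divr_gt0 ?exprn_gt0 // mulr_gt0.
have dbE : 2 * b * d = eps ^+ 2.
  by rewrite /d mulrCA divff ?mulr1 // gt_eqF // mulr_gt0.
have db : d < b.
  rewrite -(ltr_pM2l (x := 2 * b)) ?mulr_gt0 // dbE.
  have : eps ^+ 2 < b ^+ 2 by rewrite ltr_pXn2r ?nnegrE // ltW.
  have : 0 < b ^+ 2 by rewrite exprn_gt0.
  rewrite -mulrA -expr2; lra.
have [_ [g0 /= g01 <-] bg0] := sup_adherent dp supE; rewrite -/b in bg0.
have g0p : 0 < nrm g0.
  rewrite lt_neqAle nrm_ge0 andbT; apply/eqP => g00.
  have := bndb g0; rewrite -g00 mulr0; lra.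
pose g1 := (nrm g0)^-1%:C *: g0.
have g11 : nrm g1 = 1.
  by rewrite nrmZ normc_real ger0_norm ?invr_ge0 // mulVf // gt_eqF.
have og1 : orthonormal [:: g1] by split.
set a := phi g1.
have ab : b - d < normc a.
  rewrite /a phiZ ComplexField.Normc.normcM normc_real ger0_norm ?invr_ge0 //.
  rewrite mulrC ltr_pdivlMr // (le_lt_trans _ bg0) // ler_piMr //; lra.
clearbody g1; exists (a^* *: g1) => h; rewrite ipZr conjcK.
pose h' := h - proj [:: g1] h.
have h'E : h = h' + << h, g1 >> *: g1.
  by rewrite /h' /proj big_seq1 subrK.
have -> : phi h - a * << h, g1 >> = phi h'.
  by rewrite [in phi h]h'E phiD phiZ -/a mulrC addrK.
have hg : << g1, h' >> = 0.
  by rewrite (ip_conj ipS h') /h' proj_orth ?inE // conjc0.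
have h'h : nrm h' <= nrm h by exact: nrm_compl.
pose B := nrm h' ^+ 2.
pose X := normc a ^+ 2 * B + normc (phi h') ^+ 2.
(* the coefficients maximize [phi] over the span of [g1] and [h'], up to scaling *)
have XB : X <= b ^+ 2 * B.
  have := bndb ((a^* * B%:C) *: g1 + (phi h')^* *: h').
  rewrite lin phiZ -/a mulrAC (mulrC a^*) (mulrC (phi h')^*) !mulcJ.
  rewrite -rmorphM -rmorphD -/X.
  have X0 : 0 <= X by rewrite /X addr_ge0 ?mulr_ge0 ?sqr_ge0 ?normc_ge0.
  rewrite normc_real ger0_norm // => le1.
  have : X ^+ 2 <= b ^+ 2 * (B * X).
    have -> : B * X = nrm ((a^* * B%:C) *: g1 + (phi h')^* *: h') ^+ 2.
      rewrite nrmD_sqr ipZl ipZr hg !mulr0 addr0 !nrmZ g11.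
      rewrite ComplexField.Normc.normcM !normc_conj normc_real ger0_norm ?sqr_ge0 //.
      by rewrite /X -/B !exprMn -/B; ring.
    by rewrite -exprMn ler_pXn2r ?nnegrE ?mulr_ge0.
  move: X0; rewrite le_eqVlt => /predU1P[<- _|Xp].
    by rewrite mulr_ge0 ?sqr_ge0.
  by rewrite mulrA expr2 ler_pM2r.
rewrite -(ler_pXn2r (n := 2)) ?nnegrE ?mulr_ge0 ?normc_ge0 ?(ltW eps0) //.
have : normc (phi h') ^+ 2 <= eps ^+ 2 * B.
  have : (b ^+ 2 - normc a ^+ 2) * B <= eps ^+ 2 * B.
    rewrite ler_wpM2r ?sqr_ge0 // -dbE.
    have : (b - d) ^+ 2 <= normc a ^+ 2.
      by rewrite ler_pXn2r ?nnegrE ?normc_ge0 ?subr_ge0 ?ltW.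
    have := sqr_ge0 d; nra.
  move: XB; rewrite /X; lra.
move=> /le_trans; apply; rewrite exprMn ler_wpM2l ?sqr_ge0 //.
by rewrite ler_pXn2r ?nnegrE.
Qed.

(** Linear up to null vectors: the abstract form of linearity almost
    everywhere. *)
Definition qlinear (S : V -> V) :=
  forall a f g, nrm (S (a *: f + g) - (a *: S f + S g)) = 0.

(** Orthonormalize the range: the coordinates of [S h] are bounded functionals of
    [h], to be replaced by inner products. *)
Lemma finite_rank_approx (S : V -> V) (c eps : R) n (e : 'I_n -> V) :
  qlinear S -> (forall h, nrm (S h) <= c * nrm h) ->
  (forall h, exists a : 'I_n -> R[i], nrm (S h - \sum_(i < n) a i *: e i) = 0) ->
  0 < eps ->
  exists l, (size l <= n)%N /\ forall h, nrm (S h - finop l h) <= eps * nrm h.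
Proof.
move=> linS bndS rkS eps0.
have [s [os ss es]] := gram_schmidt [seq e i | i <- enum 'I_n].
rewrite size_map size_enum_ord in ss.
have projS h : nrm (S h - proj s (S h)) = 0.
  have [a aE] := rkS h; set y := \sum_(i < n) _ in aE.
  apply/eqP; rewrite eq_le nrm_ge0 andbT.
  have -> : S h - proj s (S h) =
      ((S h - y) - proj s (S h - y)) + (y - proj s y).
    have -> : proj s (S h) = proj s (S h - y) + proj s y.
      by rewrite -projD subrK.
    by rewrite opprD addrA [RHS]addrA (addrAC _ _ y) subrK.
  rewrite (le_trans (nrmD _ _)) // -[leRHS]add0r lerD //.
    by rewrite -aE nrm_compl.
  have -> : y - proj s y = \sum_(i < n) a i *: (e i - proj s (e i)).
    rewrite /y proj_finop; elim/big_ind2: _ => [|x1 x2 y1 y2 <- <-|i _].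
    - by rewrite -(scale0r 0) finopZ !scale0r subr0.
    - by rewrite finopD opprD addrACA.
    - by rewrite finopZ scalerBr proj_finop.
  rewrite (le_trans (nrm_sum _ _)) // big1 // => i _.
  by rewrite nrmZ es ?mulr0 // map_f // mem_enum.
have [g gP] : {g : V -> V & forall u, u \in s ->
    forall h, normc (<< S h, u >> - << h, g u >>) <= eps / (size s).+1%:R * nrm h}.
  apply: (@choice _ _ (fun u g => u \in s ->
    forall h, normc (<< S h, u >> - << h, g >>) <= eps / (size s).+1%:R * nrm h)).
  move=> u; have [us|] := boolP (u \in s); last by exists 0.
  have [|||g gP] := @approx_riesz (fun h => << S h, u >>) c (eps / (size s).+1%:R).
  - move=> a f g; apply/eqP; rewrite -subr_eq0 -ipZl -ipDl -ipBl; apply/eqP.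
    by rewrite ip_null.
  - move=> h; rewrite (le_trans (cauchy_schwarz _ _)) //.
    by rewrite (orthonormal_nrm os us) mulr1.
  - by rewrite divr_gt0.
  - by exists g.
exists [seq (u, g u) | u <- s]; split; first by rewrite size_map.
move=> h; rewrite (le_trans (nrmB _ (proj s (S h)) _)) // projS add0r.
rewrite /proj /finop big_map -sumrB /=.
under eq_bigr do rewrite -scalerBl.
rewrite (le_trans (nrm_sum _ _)) //.
rewrite (@le_trans _ _ (\sum_(u <- s) eps / (size s).+1%:R * nrm h)) //.
  rewrite big_seq [leRHS]big_seq; apply: ler_sum => u us.
  by rewrite nrmZ (orthonormal_nrm os us) mulr1; exact: gP.
rewrite big_const_seq count_predT iter_addr_0 -[_ *+ size s]mulr_natl mulrA.
rewrite ler_wpM2r // mulrCA ler_piMr ?(ltW eps0) //.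
by rewrite ler_pdivrMr // mul1r ler_nat.
Qed.

(** Once the first components are orthonormal, the second ones are the images of
    unit vectors under the adjoint, hence bounded by the norm of the
    operator. *)
Lemma finop_orthonormalize l (c : R) : 0 <= c ->
  (forall h, nrm (finop l h) <= c * nrm h) ->
  exists l', [/\ (size l' <= size l)%N,
    forall h, nrm (finop l h - finop l' h) = 0 &
    forall p, p \in l' -> nrm p.1 <= 1 /\ nrm p.2 <= c].
Proof.
move=> c0 bnd.
have [s [os ss es]] := gram_schmidt [seq p.1 | p <- l].
exists [seq (u, adj l u) | u <- s]; split => [|h|_ /mapP[u us ->]] /=.
- by rewrite size_map (leq_trans ss) // size_map.
- have -> : finop [seq (u, adj l u) | u <- s] h = proj s (finop l h).
    by rewrite /finop big_map; apply: eq_bigr => u _; rewrite -ip_finop.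
  apply/eqP; rewrite eq_le nrm_ge0 andbT.
  have -> : finop l h - proj s (finop l h) =
      \sum_(p <- l) << h, p.2 >> *: (p.1 - proj s p.1).
    rewrite /finop proj_finop; elim/big_ind2: _ => [|x1 x2 y1 y2 <- <-|i _].
    - by rewrite -(scale0r 0) finopZ !scale0r subr0.
    - by rewrite finopD opprD addrACA.
    - by rewrite finopZ scalerBr proj_finop.
  rewrite (le_trans (nrm_sum _ _)) // big_seq big1 // => p pl.
  by rewrite nrmZ es ?mulr0 // map_f.
- split; first by rewrite (orthonormal_nrm os us).
  set y := adj l u; have [->//|y0] := eqVneq (nrm y) 0.
  have {}y0 : 0 < nrm y by rewrite lt_neqAle eq_sym y0 nrm_ge0.
  rewrite -(ler_pM2r y0) -expr2 nrm_sqr {2}/y -ip_finop.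
  rewrite (le_trans (ler_norm _)) // (le_trans (le_Re_normc _)) //.
  rewrite (le_trans (cauchy_schwarz _ _)) // (orthonormal_nrm os us) mulr1.
  exact: bnd.
Qed.

(** * Finite-rank approximation of nuclear operators *)

Lemma cauchy_schwarz_sum (I : Type) (s : seq I) (a b : I -> R) (A B : R) :
  0 <= A -> 0 <= B ->
  \sum_(i <- s) a i ^+ 2 <= A ^+ 2 -> \sum_(i <- s) b i ^+ 2 <= B ^+ 2 ->
  \sum_(i <- s) a i * b i <= A * B.
Proof.
move=> A0 B0 aA bB.
have key t : 0 < t -> 2 * \sum_(i <- s) a i * b i <= t * A ^+ 2 + B ^+ 2 / t.
  move=> t0; rewrite (@le_trans _ _
      (t * \sum_(i <- s) a i ^+ 2 + (\sum_(i <- s) b i ^+ 2) / t)) //.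
    rewrite !mulr_sumr mulr_suml -big_split; apply: ler_sum => i _ /=.
    rewrite -subr_ge0.
    have -> : t * a i ^+ 2 + b i ^+ 2 / t - 2 * (a i * b i) =
        (t * a i - b i) ^+ 2 / t by field; rewrite gt_eqF.
    by rewrite mulr_ge0 ?sqr_ge0 // invr_ge0 ltW.
  by rewrite lerD // ?ler_wpM2l ?ler_wpM2r ?invr_ge0 // ltW.
apply/ler_addgt0Pr => e e0.
(* [key] will be applied to the ratio of the bounds, made positive by [e] *)
pose A' := A + e / (A + B + e + 1); pose B' := B + e / (A + B + e + 1).
have D0 : 0 < A + B + e + 1 by lra.
have A'p : 0 < A' by rewrite /A' ltr_wpDl // divr_gt0.
have B'p : 0 < B' by rewrite /B' ltr_wpDl // divr_gt0.
have AA : A <= A' by rewrite lerDl divr_ge0 // ltW.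
have BB : B <= B' by rewrite lerDl divr_ge0 // ltW.
have := key (B' / A') (divr_gt0 B'p A'p).
have h1 : B' / A' * A ^+ 2 <= B' * A'.
  rewrite mulrAC ler_pdivrMr // -mulrA -expr2 ler_wpM2l ?(ltW B'p) //.
  by rewrite ler_pXn2r ?nnegrE // ltW.
have h2 : B ^+ 2 / (B' / A') <= A' * B'.
  rewrite invf_div mulrA ler_pdivrMr // mulrC -mulrA -expr2.
  rewrite ler_wpM2l ?(ltW A'p) //.
  by rewrite ler_pXn2r ?nnegrE // ltW.
have h3 : A' * B' <= A * B + e.
  rewrite /A' /B'; set u := e / _.
  have u0 : 0 <= u by rewrite /u divr_ge0 // ltW.
  have uD : u * (A + B + e + 1) = e by rewrite /u mulfVK // gt_eqF.
  have ue : u <= e by rewrite /u ler_pdivrMr //; nra.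
  nra.
lra.
Qed.

(** The Bessel inequality, applied to the two components of each pair of [l]. *)
Lemma sum_bilinear_nuc l (w : seq (V * V)) :
  orthonormal [seq p.1 | p <- w] -> orthonormal [seq p.2 | p <- w] ->
  \sum_(p <- w) normc << finop l p.1, p.2 >> <= nuc l.
Proof.
move=> o1 o2; rewrite (@le_trans _ _ (\sum_(p <- w) \sum_(q <- l)
    normc << p.1, q.2 >> * normc << q.1, p.2 >>)) //.
  apply: ler_sum => p _; rewrite ip_suml (le_trans (normc_sum _ _)) //.
  by apply: ler_sum => q _; rewrite ipZl ComplexField.Normc.normcM.
rewrite exchange_big; apply: ler_sum => q _ /=; rewrite mulrC.
apply: cauchy_schwarz_sum => //.
- have := bessel q.2 o1; rewrite big_map => /(le_trans _); apply.
  by apply: ler_sum => p _; rewrite normc_ipC.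
- by have := bessel q.1 o2; rewrite big_map.
Qed.

(** With [U] and [W] the vectors found so far, compressing [finop l] to their
    orthogonal complements changes it by an operator of rank at most [2 * k];
    a vector at which the compression is large yields the next pair. *)
Lemma greedy_orthonormal l (sigma : R) N : 0 <= sigma ->
  (forall l', (size l' <= N.*2)%N ->
    exists h, sigma * nrm h < nrm (finop l h - finop l' h)) ->
  forall k, (k <= N.+1)%N -> exists w : seq (V * V),
    [/\ size w = k, orthonormal [seq p.1 | p <- w],
        orthonormal [seq p.2 | p <- w] &
        forall p, p \in w -> sigma < normc << finop l p.1, p.2 >>].
Proof.
move=> sigma0 far; elim=> [_|k IHk kN]; first by exists [::].
have [w [sw o1 o2 wl]] := IHk (ltnW kN).
set U := [seq p.1 | p <- w] in o1; set W := [seq p.2 | p <- w] in o2.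
pose l' := [seq (v, adj l v) | v <- W] ++
           [seq (finop l u - proj W (finop l u), u) | u <- U].
have l'E h : finop l h - finop l' h =
    finop l (h - proj U h) - proj W (finop l (h - proj U h)).
  have -> : finop l' h = proj W (finop l h) +
      (finop l (proj U h) - proj W (finop l (proj U h))).
    rewrite finop_cat; congr (_ + _).
      by rewrite /finop big_map; apply: eq_bigr => v _; rewrite -ip_finop.
    pose G g := finop l g - proj W (finop l g).
    have GZ a g : G (a *: g) = a *: G g by rewrite /G finopZ projZ scalerBr.
    have GD g1 g2 : G (g1 + g2) = G g1 + G g2.
      by rewrite /G finopD projD opprD addrACA.
    have G0 : G 0 = 0 by rewrite -(scale0r 0) GZ !scale0r.
    rewrite -/(G (proj U h)) {1}/finop big_map /= /proj (big_morph G GD G0).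
    by apply: eq_bigr => u _; rewrite GZ.
  by rewrite finopB projB !opprD !opprK !addrA; congr (_ + _); exact: addrAC.
have [|h] := far l'.
  rewrite size_cat !size_map sw addnn leq_double; exact: kN.
rewrite l'E; set x := h - proj U h; set y := finop l x - _ => hy.
have xh : nrm x <= nrm h by exact: nrm_compl.
have yp : 0 < nrm y by rewrite (le_lt_trans _ hy) // mulr_ge0.
have xp : 0 < nrm x.
  rewrite lt_neqAle nrm_ge0 andbT; apply/eqP => x0.
  have : nrm y <= 0.
    by rewrite (le_trans (nrm_compl _ o2)) // (le_trans (nrm_finop _ _)) // -x0 mulr0.
  by rewrite leNgt yp.
exists (((nrm x)^-1%:C *: x, (nrm y)^-1%:C *: y) :: w); split => /=.
- by rewrite sw.
- by apply: (orthonormal_cons o1).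
- by apply: (orthonormal_cons o2).
- move=> p; rewrite inE => /predU1P[->/=|]; last exact: wl.
  rewrite finopZ ipZl ipZr conjc_real.
  have -> : << finop l x, y >> = (nrm y ^+ 2)%:C.
    have -> : finop l x = y + proj W (finop l x) by rewrite subrK.
    rewrite ipDl ipff [X in _ + X](_ : _ = 0) ?addr0 //.
    rewrite /proj ip_suml big_seq big1 // => v vW.
    by rewrite ipZl (ip_conj ipS y v) proj_orth // conjc0 mulr0.
  rewrite -!rmorphM normc_real ger0_norm ?mulr_ge0 ?invr_ge0 ?sqr_ge0 //.
  rewrite expr2 mulKf ?gt_eqF // mulrC ltr_pdivlMr //.
  by rewrite (le_lt_trans _ hy) // ler_wpM2l.
Qed.

(** If no operator of rank [2 * N] is close, one can keep finding pairs of unit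
    vectors, orthogonal to the previous ones, on which the operator is large;
    but the sum of its values on orthonormal pairs is at most [nuc l].  This
    replaces the singular value decomposition. *)
Lemma nuclear_rank l N : exists l', (size l' <= N.*2)%N /\
  forall h, nrm (finop l h - finop l' h) <= nuc l / N.+1%:R * nrm h.
Proof.
apply: contrapT => none.
have [||w [sw o1 o2 wl]] :=
    @greedy_orthonormal l (nuc l / N.+1%:R) N _ _ N.+1 (leqnn _).
- by rewrite divr_ge0 // nuc_ge0.
- move=> l' sl'; apply: contrapT => close; apply: none; exists l'; split => // h.
  by rewrite leNgt; apply/negP => far; apply: close; exists h.
have := sum_bilinear_nuc l o1 o2; rewrite leNgt => /negP; apply.
case: w => [//|p w] in sw o1 o2 wl *.
rewrite (@le_lt_trans _ _ (\sum_(q <- p :: w) nuc l / N.+1%:R)) //.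
  by rewrite big_const_seq count_predT iter_addr_0 sw
    -[(_ / _) *+ _]mulr_natr divfK.
rewrite !big_cons ltr_leD //; first by rewrite wl // mem_head.
rewrite big_seq [leRHS]big_seq; apply: ler_sum => q qw.
by rewrite ltW // wl // inE qw orbT.
Qed.

End SemiInner.

(** * Measurable and integrable complex functions *)

Section ComplexMeasurable.
Context d (T : measurableType d) {R : realType}.
Implicit Types f g : T -> R[i].

Lemma ReD (z w : R[i]) : Re (z + w) = Re z + Re w.
Proof. by case: z; case: w. Qed.
Lemma ImD (z w : R[i]) : Im (z + w) = Im z + Im w.
Proof. by case: z; case: w. Qed.
Lemma ReM (z w : R[i]) : Re (z * w) = Re z * Re w - Im z * Im w.
Proof. by case: z; case: w. Qed.
Lemma ImM (z w : R[i]) : Im (z * w) = Re z * Im w + Im z * Re w.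
Proof. by case: z; case: w. Qed.
Lemma ReJ (z : R[i]) : Re z^* = Re z. Proof. by case: z. Qed.
Lemma ImJ (z : R[i]) : Im z^* = - Im z. Proof. by case: z. Qed.

Lemma cmeasurable_cst (a : R[i]) : cmeasurable (fun _ : T => a).
Proof. by split; exact: measurable_cst. Qed.

Lemma cmeasurableD f g : cmeasurable f -> cmeasurable g ->
  cmeasurable (fun x => f x + g x).
Proof.
move=> [f1 f2] [g1 g2]; split.
  by under eq_fun do rewrite ReD; exact: measurable_funD.
by under eq_fun do rewrite ImD; exact: measurable_funD.
Qed.

Lemma cmeasurableM f g : cmeasurable f -> cmeasurable g ->
  cmeasurable (fun x => f x * g x).
Proof.
move=> [f1 f2] [g1 g2]; split.
  under eq_fun do rewrite ReM.
  by apply: measurable_funB; exact: measurable_funM.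
under eq_fun do rewrite ImM.
by apply: measurable_funD; exact: measurable_funM.
Qed.

Lemma cmeasurableJ f : cmeasurable f -> cmeasurable (fun x => (f x)^*).
Proof.
move=> [f1 f2]; split; first by under eq_fun do rewrite ReJ.
by under eq_fun do rewrite ImJ; exact: measurable_funN.
Qed.

Lemma cmeasurable_real (f : T -> R) : measurable_fun [set: T] f ->
  cmeasurable (fun x => (f x)%:C).
Proof. by move=> mf; split => //=; exact: measurable_cst. Qed.

Lemma cmeasurable_sum (I : Type) (s : seq I) (F : I -> T -> R[i]) :
  (forall i, cmeasurable (F i)) -> cmeasurable (fun x => \sum_(i <- s) F i x).
Proof.
move=> mF; elim: s => [|i s IHs].
  by under eq_fun do rewrite big_nil; exact: cmeasurable_cst.
by under eq_fun do rewrite big_cons; exact: cmeasurableD.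
Qed.

Lemma cmeasurable_comp d' (T' : measurableType d') (h : T' -> T) f :
  measurable_fun [set: T'] h -> cmeasurable f -> cmeasurable (fun x => f (h x)).
Proof.
by move=> mh [f1 f2]; split;
  [exact: (measurableT_comp f1 mh)|exact: (measurableT_comp f2 mh)].
Qed.

Lemma measurable_normc f : cmeasurable f ->
  measurable_fun [set: T] (fun x => normc (f x)).
Proof.
move=> [f1 f2]; have -> : (fun x => normc (f x)) =
    fun x => (Re (f x) ^+ 2 + Im (f x) ^+ 2) `^ 2^-1.
  apply/funext => x; rewrite powR12_sqrt ?addr_ge0 ?sqr_ge0 //.
  by case: (f x).
have mg : measurable_fun [set: T] (fun x => Re (f x) ^+ 2 + Im (f x) ^+ 2).
  by apply: measurable_funD; exact: measurable_funX.
exact: (measurableT_comp (measurable_powR 2^-1) mg).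
Qed.

End ComplexMeasurable.

Section Integration.
Context {R : realType}.
Local Notation mu := (@lebesgue_measure R).
Implicit Types f g : R -> R[i].

Lemma aeS (P Q : R -> Prop) : (forall x, P x -> Q x) ->
  {ae mu, forall x, P x} -> {ae mu, forall x, Q x}.
Proof.
move=> PQ; apply: filterS; first exact: (ae_filter_ringOfSetsType mu).
exact: PQ.
Qed.

Lemma ae_and (P Q : R -> Prop) : {ae mu, forall x, P x} ->
  {ae mu, forall x, Q x} -> {ae mu, forall x, P x /\ Q x}.
Proof.
move=> aP aQ; have F := ae_filter_ringOfSetsType mu.
exact: (@filterI _ (almost_everywhere mu) F).
Qed.

Lemma cintegrable_meas f : cintegrable f -> cmeasurable f.
Proof.
move=> [/integrableP[/measurable_EFinP f1 _] /integrableP[/measurable_EFinP f2 _]].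
by split.
Qed.

Lemma le_cintegrable f (g : R -> R) : cmeasurable f ->
  mu.-integrable [set: R] (EFin \o g) -> (forall x, normc (f x) <= g x) ->
  cintegrable f.
Proof.
move=> [f1 f2] ig fg; split.
  apply: (le_integrable _ _ _ ig) => //; first exact/measurable_EFinP.
  move=> x _; rewrite lee_fin (le_trans (le_Re_normc _)) //.
  by rewrite (le_trans (fg x)) // ler_norm.
apply: (le_integrable _ _ _ ig) => //; first exact/measurable_EFinP.
move=> x _; rewrite lee_fin (le_trans (le_Im_normc _)) //.
by rewrite (le_trans (fg x)) // ler_norm.
Qed.

Lemma normc_le_ReIm (z : R[i]) : normc z <= `|Re z| + `|Im z|.
Proof.
rewrite -(ler_pXn2r (n := 2)) ?nnegrE ?normc_ge0 ?addr_ge0 //.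
rewrite sqr_normcE sqrrD !real_normK ?num_real // lerD2r lerDl.
by rewrite mulrn_wge0 // mulr_ge0.
Qed.

Lemma integrable_normc f : cintegrable f ->
  mu.-integrable [set: R] (EFin \o (fun x => normc (f x))).
Proof.
move=> fi; have mf := cintegrable_meas fi; case: fi => i1 i2.
apply: (@le_integrable _ _ R mu _ _ _
    (EFin \o (fun x => `|Re (f x)| + `|Im (f x)|))) => //.
- by apply/measurable_EFinP; exact: measurable_normc.
- move=> x _; rewrite lee_fin [leLHS]ger0_norm ?normc_ge0 //.
  by rewrite (le_trans (normc_le_ReIm _)) // ler_norm.
- have -> : EFin \o (fun x => `|Re (f x)| + `|Im (f x)|) =
      (abse \o (fun x => (Re (f x))%:E)) \+ (abse \o (fun x => (Im (f x))%:E)).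
    by [].
  by apply: integrableD => //; exact: integrable_abse.
Qed.

Lemma cintegrableD f g : cintegrable f -> cintegrable g ->
  cintegrable (fun x => f x + g x).
Proof.
move=> [f1 f2] [g1 g2]; split.
  by under eq_fun do rewrite ReD EFinD; exact: integrableD.
by under eq_fun do rewrite ImD EFinD; exact: integrableD.
Qed.

Lemma cintegrableZ (a : R[i]) f : cintegrable f ->
  cintegrable (fun x => a * f x).
Proof.
move=> [f1 f2]; split.
  under eq_fun do rewrite ReM EFinB !EFinM.
  by apply: integrableB => //; exact: integrableZl.
under eq_fun do rewrite ImM EFinD !EFinM.
by apply: integrableD => //; exact: integrableZl.
Qed.

Lemma cintegralD f g : cintegrable f -> cintegrable g ->
  cintegral (fun x => f x + g x) = cintegral f + cintegral g.
Proof.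
move=> [f1 f2] [g1 g2]; rewrite /cintegral; congr Complex.
  by under eq_Rintegral do rewrite ReD; rewrite RintegralD.
by under eq_Rintegral do rewrite ImD; rewrite RintegralD.
Qed.

Lemma integrableZ_EFin (k : R) (g : R -> R) :
  mu.-integrable [set: R] (EFin \o g) ->
  mu.-integrable [set: R] (EFin \o (fun x => k * g x)).
Proof.
move=> ig; have -> : EFin \o (fun x => k * g x) =
  (fun x => k%:E * (EFin \o g) x)%E by [].
exact: integrableZl.
Qed.

Lemma integrableD_EFin (g h : R -> R) :
  mu.-integrable [set: R] (EFin \o g) -> mu.-integrable [set: R] (EFin \o h) ->
  mu.-integrable [set: R] (EFin \o (fun x => g x + h x)).
Proof.
move=> ig ih; have -> : EFin \o (fun x => g x + h x) =
  (fun x => (EFin \o g) x + (EFin \o h) x)%E by [].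
exact: integrableD.
Qed.

Lemma cintegralZ (a : R[i]) f : cintegrable f ->
  cintegral (fun x => a * f x) = a * cintegral f.
Proof.
move=> [f1 f2]; rewrite /cintegral; case: a => a b /=; congr Complex.
  under eq_Rintegral do rewrite ReM /=.
  by rewrite RintegralB ?RintegralZl //; exact: integrableZ_EFin.
under eq_Rintegral do rewrite ImM /=.
by rewrite RintegralD ?RintegralZl //; exact: integrableZ_EFin.
Qed.

Lemma cintegralJ f : cintegrable f ->
  cintegral (fun x => (f x)^*) = (cintegral f)^*.
Proof.
move=> [f1 f2]; rewrite /cintegral /=; congr Complex.
  by under eq_Rintegral do rewrite ReJ.
under eq_Rintegral do rewrite ImJ -mulN1r.
by rewrite RintegralZl // mulN1r.
Qed.

Lemma cintegrable0 : cintegrable (fun _ : R => 0 : R[i]).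
Proof. by split; exact: integrable0. Qed.

Lemma cintegral0 : cintegral (fun _ : R => 0 : R[i]) = 0.
Proof. by rewrite /cintegral /= !Rintegral_cst //= !mul0r. Qed.

Lemma cintegrable_sum (I : Type) (s : seq I) (F : I -> R -> R[i]) :
  (forall i, cintegrable (F i)) -> cintegrable (fun x => \sum_(i <- s) F i x).
Proof.
move=> iF; elim: s => [|i s IHs].
  by under eq_fun do rewrite big_nil; exact: cintegrable0.
by under eq_fun do rewrite big_cons; exact: cintegrableD.
Qed.

Lemma cintegral_sum (I : Type) (s : seq I) (F : I -> R -> R[i]) :
  (forall i, cintegrable (F i)) ->
  cintegral (fun x => \sum_(i <- s) F i x) = \sum_(i <- s) cintegral (F i).
Proof.
move=> iF; elim: s => [|i s IHs].
  by under eq_fun do rewrite big_nil; rewrite cintegral0 big_nil.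
under eq_fun do rewrite big_cons.
by rewrite cintegralD ?big_cons ?IHs //; exact: cintegrable_sum.
Qed.

(** Multiply by the unimodular number that makes the integral nonnegative. *)
Lemma normc_cintegral f : cintegrable f ->
  normc (cintegral f) <= \int[mu]_x normc (f x).
Proof.
move=> fi; set z := cintegral f.
have [z0|z0] := eqVneq z 0.
  rewrite z0 ComplexField.Normc.normc0.
  by apply: Rintegral_ge0 => x _; exact: normc_ge0.
have nz : 0 < normc z by rewrite lt_neqAle eq_sym normc_eq0 z0 normc_ge0.
pose u := z^* * (normc z)^-1%:C.
have nu : normc u = 1.
  rewrite ComplexField.Normc.normcM normc_conj normc_real ger0_norm ?invr_ge0 ?ltW //.
  by rewrite divff // gt_eqF.
have -> : normc z = Re (cintegral (fun x => u * f x)).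
  rewrite cintegralZ // -/z /u mulrAC (mulrC z^*) mulcJ -rmorphM /=.
  by rewrite expr2 mulfK // gt_eqF.
have ui := cintegrableZ u fi.
apply: le_Rintegral => //; first by case: ui.
  exact: integrable_normc.
move=> x _; rewrite (le_trans (ler_norm _)) // (le_trans (le_Re_normc _)) //.
by rewrite ComplexField.Normc.normcM nu mul1r.
Qed.

Lemma measurable_integral_section (K : R * R -> \bar R) :
  measurable_fun [set: R * R] K ->
  measurable_fun [set: R] (fun x => fine (\int[mu]_y K (x, y))).
Proof.
move=> mK; apply: (measurableT_comp (@fine_measurable R setT measurableT)) => //.
have -> : (fun x => \int[mu]_y K (x, y))%E =
    (fun x => \int[mu]_y (K^\+)%E (x, y) - \int[mu]_y (K^\-)%E (x, y))%E.
  apply/funext=> x; rewrite [LHS]integralE.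
  by under eq_integral do rewrite funepos_comp/=;
     under [X in (_ - X)%E = _]eq_integral do rewrite funeneg_comp/=.
apply: emeasurable_funB.
  apply: (@measurable_fun_fubini_tonelli_F _ _ _ _ _ mu (K^\+)%E) => //.
  exact: measurable_funepos.
apply: (@measurable_fun_fubini_tonelli_F _ _ _ _ _ mu (K^\-)%E) => //.
exact: measurable_funeneg.
Qed.

Lemma cmeasurable_cintegral (K : R * R -> R[i]) : cmeasurable K ->
  cmeasurable (fun x => cintegral (fun y => K (x, y))).
Proof.
move=> [k1 k2]; split.
  apply: (@measurable_integral_section (fun z => (Re (K z))%:E)).
  exact/measurable_EFinP.
apply: (@measurable_integral_section (fun z => (Im (K z))%:E)).
exact/measurable_EFinP.
Qed.

End Integration.

(** * Square-integrable functions *)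

Section RealSequences.
Context {R : realType}.

Lemma dist_normc (z w : R[i]) : `|normc z - normc w| <= normc (z - w).
Proof.
have := le_normcD (z - w) w; rewrite subrK => h1.
have := le_normcD (w - z) z; rewrite subrK -[normc (w - z)]normcN opprB => h2.
by rewrite ler_norml; apply/andP; split; lra.
Qed.

Lemma cvg_dist_squeeze (u e : nat -> R) (l : R) :
  (forall n, `|u n - l| <= e n) -> e n @[n --> \oo] --> 0 ->
  u n @[n --> \oo] --> l.
Proof.
move=> ue e0; apply/cvgrPdistC_lt => eps eps0.
have /cvgr_lt/(_ _ eps0) := e0.
by apply: filterS => n; apply: le_lt_trans; exact: ue.
Qed.

End RealSequences.

Section InL2.
Context {R : realType}.
Local Notation mu := (@lebesgue_measure R).
Implicit Types f g : R -> R[i].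

Lemma L2norm_poweR f :
  L2norm f = ((\int[mu]_x (normc (f x) ^+ 2)%:E) `^ 2^-1)%E.
Proof.
rewrite /L2norm unlock; congr (_ `^ _)%E; apply: eq_integral => x _.
rewrite poweR_EFin ger0_norm ?normc_ge0 //.
by rewrite -[in RHS]powR_mulrn ?normc_ge0.
Qed.

Lemma inL2P f : inL2 f <-> cmeasurable f /\
  mu.-integrable [set: R] (EFin \o (fun x => normc (f x) ^+ 2)).
Proof.
rewrite /inL2 L2norm_poweR; split => -[mf fi]; split => //.
  apply/integrableP; split.
    by apply/measurable_EFinP/measurable_funX/measurable_normc.
  under eq_integral do rewrite /= ger0_norm ?sqr_ge0 //.
  by apply: lty_poweRy fi; rewrite invr_neq0.
have := integrable_fin_num measurableT fi.
rewrite /comp; set X := integral _ _ _.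
by case: X => // r _; rewrite poweR_EFin ltry.
Qed.

Lemma inL2_meas f : inL2 f -> cmeasurable f. Proof. by case. Qed.

Lemma inL2_integrable f : inL2 f ->
  mu.-integrable [set: R] (EFin \o (fun x => normc (f x) ^+ 2)).
Proof. by move=> /inL2P[]. Qed.

Lemma le_inL2 f (g : R -> R) : cmeasurable f ->
  mu.-integrable [set: R] (EFin \o g) -> (forall x, normc (f x) ^+ 2 <= g x) ->
  inL2 f.
Proof.
move=> mf ig fg; apply/inL2P; split => //; apply: le_integrable ig => //.
  by apply/measurable_EFinP/measurable_funX/measurable_normc.
move=> x _; rewrite lee_fin ger0_norm ?sqr_ge0 //.
by rewrite (le_trans (fg x)) // ler_norm.
Qed.

Lemma inL2_le f g (c : R) : cmeasurable f -> inL2 g ->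
  (forall x, normc (f x) <= c * normc (g x)) -> inL2 f.
Proof.
move=> mf ig fg; apply: (@le_inL2 _ (fun x => c ^+ 2 * normc (g x) ^+ 2)) => //.
  exact/integrableZ_EFin/inL2_integrable.
move=> x; rewrite -exprMn ler_pXn2r ?nnegrE ?normc_ge0 //.
by rewrite (le_trans _ (fg x)) // normc_ge0.
Qed.

Lemma inL2_0 : inL2 (fun _ : R => 0 : R[i]).
Proof.
apply/inL2P; split; first exact: cmeasurable_cst.
rewrite (_ : EFin \o _ = cst 0%E); first exact: integrable0.
by apply/funext => x; rewrite /comp ComplexField.Normc.normc0 expr0n.
Qed.

Lemma inL2D f g : inL2 f -> inL2 g -> inL2 (fun x => f x + g x).
Proof.
move=> fi gi; apply: (@le_inL2 _
    (fun x => 2 * normc (f x) ^+ 2 + 2 * normc (g x) ^+ 2)).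
- by apply: cmeasurableD; exact: inL2_meas.
- by apply: integrableD_EFin; exact/integrableZ_EFin/inL2_integrable.
move=> x; rewrite (@le_trans _ _ ((normc (f x) + normc (g x)) ^+ 2)) //.
  by rewrite ler_pXn2r ?nnegrE ?addr_ge0 ?normc_ge0 // le_normcD.
have := sqr_ge0 (normc (f x) - normc (g x)); nra.
Qed.

Lemma inL2Z (a : R[i]) f : inL2 f -> inL2 (fun x => a * f x).
Proof.
move=> fi; apply: (@inL2_le _ f (normc a)) => //.
  by apply: cmeasurableM; [exact: cmeasurable_cst|exact: inL2_meas].
by move=> x; rewrite ComplexField.Normc.normcM.
Qed.

Lemma inL2_bounded_mul (b : R -> R[i]) (B : R) f : cmeasurable b ->
  (forall x, normc (b x) <= B) -> inL2 f -> inL2 (fun x => b x * f x).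
Proof.
move=> mb bB fi; apply: (@inL2_le _ f B) => //.
  by apply: cmeasurableM => //; exact: inL2_meas.
by move=> x; rewrite ComplexField.Normc.normcM ler_wpM2r // normc_ge0.
Qed.

Lemma cintegrable_mul f g : inL2 f -> inL2 g ->
  cintegrable (fun x => f x * g x).
Proof.
move=> fi gi; apply: (@le_cintegrable _ _
    (fun x => normc (f x) ^+ 2 + normc (g x) ^+ 2)).
- by apply: cmeasurableM; exact: inL2_meas.
- by apply: integrableD_EFin; exact: inL2_integrable.
move=> x; rewrite ComplexField.Normc.normcM.
have := sqr_ge0 (normc (f x) - normc (g x)).
have := sqr_ge0 (normc (f x) + normc (g x)); nra.
Qed.

Lemma inL2J f : inL2 f -> inL2 (fun x => (f x)^*).
Proof.
move=> fi; apply: (@inL2_le _ f 1) => //.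
  exact/cmeasurableJ/inL2_meas.
by move=> x; rewrite normc_conj mul1r.
Qed.

Lemma inL2_normc f : inL2 f -> inL2 (fun x => (normc (f x))%:C).
Proof.
move=> fi; apply: (@inL2_le _ f 1) => //.
  exact/cmeasurable_real/measurable_normc/inL2_meas.
by move=> x; rewrite normc_real ger0_norm ?normc_ge0 // mul1r.
Qed.

End InL2.

(** Square-integrable functions, not identified almost everywhere: functions
    that vanish almost everywhere are the null vectors of [l2ip]. *)
Record L2 (R : realType) := MkL2 { L2fun :> R -> R[i]; L2_inL2 : inL2 L2fun }.

HB.instance Definition _ (R : realType) := gen_eqMixin (L2 R).
HB.instance Definition _ (R : realType) := gen_choiceMixin (L2 R).

Section L2Module.
Context {R : realType}.
Implicit Types f g h : L2 R.

Lemma L2_ext f g : (forall x, f x = g x) -> f = g.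
Proof.
case: f g => [f fi] [g gi] /= /funext e; move: fi gi.
by rewrite e => fi gi; congr MkL2; exact: Prop_irrelevance.
Qed.

Definition L2zero : L2 R := MkL2 (@inL2_0 R).
Definition L2add f g : L2 R := MkL2 (inL2D (L2_inL2 f) (L2_inL2 g)).
Definition L2scale (a : R[i]) f : L2 R := MkL2 (inL2Z a (L2_inL2 f)).
Definition L2opp f : L2 R := L2scale (-1) f.

Fact L2addA : associative L2add.
Proof. by move=> f g h; apply: L2_ext => x /=; rewrite addrA. Qed.
Fact L2addC : commutative L2add.
Proof. by move=> f g; apply: L2_ext => x /=; rewrite addrC. Qed.
Fact L2add0 : left_id L2zero L2add.
Proof. by move=> f; apply: L2_ext => x /=; rewrite add0r. Qed.
Fact L2addN : left_inverse L2zero L2opp L2add.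
Proof. by move=> f; apply: L2_ext => x /=; rewrite mulN1r addNr. Qed.

HB.instance Definition _ :=
  GRing.isZmodule.Build (L2 R) L2addA L2addC L2add0 L2addN.

Fact L2scaleA a b f : L2scale a (L2scale b f) = L2scale (a * b) f.
Proof. by apply: L2_ext => x /=; rewrite mulrA. Qed.
Fact L2scale1 : left_id 1 L2scale.
Proof. by move=> f; apply: L2_ext => x /=; rewrite mul1r. Qed.
Fact L2scaleDr : right_distributive L2scale +%R.
Proof. by move=> a f g; apply: L2_ext => x /=; rewrite mulrDr. Qed.
Fact L2scaleDl f : {morph L2scale^~ f : a b / a + b}.
Proof. by move=> a b; apply: L2_ext => x /=; rewrite mulrDl. Qed.

HB.instance Definition _ := GRing.Zmodule_isLmodule.Build R[i] (L2 R)
  L2scaleA L2scale1 L2scaleDr L2scaleDl.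

Lemma L2addE f g x : (f + g) x = f x + g x. Proof. by []. Qed.
Lemma L2scaleE a f x : (a *: f) x = a * f x. Proof. by []. Qed.
Lemma L2oppE f x : (- f) x = - f x. Proof. exact: mulN1r. Qed.
Lemma L2subE f g x : (f - g) x = f x - g x.
Proof. by rewrite L2addE L2oppE. Qed.
Lemma L2sumE (I : Type) (s : seq I) (F : I -> L2 R) x :
  (\sum_(i <- s) F i) x = \sum_(i <- s) F i x.
Proof.
elim: s => [|i s IHs]; first by rewrite !big_nil.
by rewrite !big_cons L2addE IHs.
Qed.

Definition l2ip f g : R[i] := cintegral (fun x => f x * (g x)^*).

Lemma cintegrable_ip f g : cintegrable (fun x => f x * (g x)^*).
Proof. by apply: cintegrable_mul; [|apply: inL2J]; exact: L2_inL2. Qed.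

Lemma l2ip_self f :
  l2ip f f = (\int[lebesgue_measure]_x (normc (f x) ^+ 2))%:C.
Proof.
rewrite /l2ip /cintegral; congr Complex.
  by apply: eq_Rintegral => x _; rewrite mulcJ.
under eq_Rintegral do rewrite mulcJ /=.
by rewrite Rintegral_cst // mul0r.
Qed.

Lemma l2ip_semi_inner : semi_inner l2ip.
Proof.
split.
- move=> a f g h; rewrite /l2ip -cintegralZ; last exact: cintegrable_ip.
  rewrite -cintegralD; [|exact/cintegrableZ/cintegrable_ip|
    exact: cintegrable_ip].
  by congr cintegral; apply/funext => x /=; rewrite mulrDl mulrA.
- move=> f g; rewrite /l2ip -cintegralJ; last exact: cintegrable_ip.
  by congr cintegral; apply/funext => x; rewrite conjcM conjcK mulrC.
- move=> f; rewrite l2ip_self ler0c; apply: Rintegral_ge0 => x _.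
  exact: sqr_ge0.
Qed.

Local Notation l2nrm := (nrm l2ip).

Lemma l2nrm_sqr f :
  l2nrm f ^+ 2 = \int[lebesgue_measure]_x (normc (f x) ^+ 2).
Proof. by rewrite (nrm_sqr l2ip_semi_inner) l2ip_self. Qed.

Lemma l2nrm_sqrE f : ((l2nrm f ^+ 2)%:E =
  \int[lebesgue_measure]_x (normc (f x) ^+ 2)%:E)%E.
Proof.
rewrite l2nrm_sqr /Rintegral fineK //.
exact: (integrable_fin_num measurableT (inL2_integrable (L2_inL2 f))).
Qed.

Lemma l2nrm_ge0 f : 0 <= l2nrm f. Proof. exact: nrm_ge0. Qed.

Lemma L2norm_nrm f : L2norm f = (l2nrm f)%:E.
Proof.
rewrite L2norm_poweR -l2nrm_sqrE poweR_EFin.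
by rewrite powR12_sqrt ?sqr_ge0 // sqrtr_sqr ger0_norm // l2nrm_ge0.
Qed.

Lemma l2nrm_le f g (c : R) : 0 <= c ->
  {ae lebesgue_measure, forall x, normc (f x) <= c * normc (g x)} ->
  l2nrm f <= c * l2nrm g.
Proof.
move=> c0 fg; rewrite -(ler_pXn2r (n := 2)) ?nnegrE ?mulr_ge0 ?l2nrm_ge0 //.
have -> : c * l2nrm g = l2nrm (c%:C *: g).
  by rewrite (nrmZ l2ip_semi_inner) normc_real ger0_norm.
rewrite -lee_fin !l2nrm_sqrE; apply: ae_ge0_le_integral => //.
- by move=> x _; rewrite lee_fin sqr_ge0.
- by case/integrableP: (inL2_integrable (L2_inL2 f)).
- by move=> x _; rewrite lee_fin sqr_ge0.
- by case/integrableP: (inL2_integrable (L2_inL2 (c%:C *: g))).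
- apply: aeS fg => x fgx _; rewrite lee_fin ler_pXn2r ?nnegrE ?normc_ge0 //.
  by rewrite ComplexField.Normc.normcM normc_real ger0_norm.
Qed.

Lemma l2nrm_eq0 f : l2nrm f = 0 <-> eq_ae f (fun _ => 0).
Proof.
split => [f0|f0].
  have mf : measurable_fun [set: R] (fun x => (normc (f x) ^+ 2)%:E).
    by case/integrableP: (inL2_integrable (L2_inL2 f)).
  have ae0 : (\int[lebesgue_measure]_x `|(normc (f x) ^+ 2)%:E| = 0)%E.
    under eq_integral do rewrite /= ger0_norm ?sqr_ge0 //.
    by rewrite -l2nrm_sqrE f0 expr0n.
  have := (ae_eq_integral_abs lebesgue_measure measurableT mf).1 ae0.
  apply: aeS => x /(_ I) [] /eqP; rewrite sqrf_eq0 normc_eq0.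
  by move/eqP.
apply/eqP; rewrite eq_le l2nrm_ge0 andbT -(mul0r (l2nrm f)).
apply: l2nrm_le => //; apply: aeS f0 => x ->.
by rewrite ComplexField.Normc.normc0 mul0r.
Qed.

Lemma eq_ae_nrm f g : eq_ae f g <-> l2nrm (f - g) = 0.
Proof.
rewrite l2nrm_eq0; split; apply: aeS => x; rewrite L2subE.
  by move=> ->; rewrite subrr.
by move/eqP; rewrite subr_eq0 => /eqP.
Qed.

(** Besides the bound on its norm, this yields that a pointwise limit is square
    integrable. *)
Lemma fatou_L2 (F : nat -> L2 R) (f : R -> R[i]) (c : R) : 0 <= c ->
  cmeasurable f ->
  {ae lebesgue_measure, forall x, normc (F n x - f x) @[n --> \oo] --> (0 : R)} ->
  (forall n, l2nrm (F n) <= c) ->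
  exists g : L2 R, L2fun g = f /\ l2nrm g <= c.
Proof.
move=> c0 mf Ff Fc.
have mg (h : R -> R[i]) : cmeasurable h ->
    measurable_fun [set: R] (fun x => (normc (h x) ^+ 2)%:E).
  by move=> mh; apply/measurable_EFinP/measurable_funX/measurable_normc.
have le1 : (\int[lebesgue_measure]_x (normc (f x) ^+ 2)%:E <= (c ^+ 2)%:E)%E.
  apply: (@le_trans _ _ (\int[lebesgue_measure]_x
      limn_einf (fun n => (normc (F n x) ^+ 2)%:E))%E).
    apply: ae_ge0_le_integral => //.
    - by move=> x _; rewrite lee_fin sqr_ge0.
    - exact: mg.
    - move=> x _; rewrite limn_einf_lim; apply: lime_ge.
        exact: is_cvg_einfs.
      apply: nearW => n; apply: le_ereal_inf_tmp => _ [m _ <-].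
      by rewrite lee_fin sqr_ge0.
    - have -> : (fun x => limn_einf (fun n => (normc (F n x) ^+ 2)%:E)) =
          (fun x => - limn_esup (fun n => - (normc (F n x) ^+ 2)%:E))%E.
        apply/funext => x.
        by rewrite (limn_esupN (fun n => (normc (F n x) ^+ 2)%:E)) oppeK.
      apply: measurableT_comp => //; apply: measurable_fun_limn_esup => n.
      apply: measurableT_comp => //; apply: mg; exact/inL2_meas/L2_inL2.
    apply: aeS Ff => x Fx _.
    have cv : (normc (F n x) ^+ 2)%:E @[n --> \oo] --> (normc (f x) ^+ 2)%:E.
      apply/fine_cvgP; split; first exact: nearW.
      apply: (@cvg_comp _ _ _ (fun n => normc (F n x)) (fun t : R => t ^+ 2)).
        apply: (@cvg_dist_squeeze _ _ (fun n => normc (F n x - f x))); last exact: Fx.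
        by move=> n; exact: dist_normc.
      exact: exprn_continuous.
    by rewrite (cvg_limn_einf_sup cv).1.
  apply: le_trans (fatou _ measurableT _ _) _ => //.
  - by move=> n; apply: mg; exact/inL2_meas/L2_inL2.
  - by move=> n x _; rewrite lee_fin sqr_ge0.
  rewrite limn_einf_lim; apply: lime_le; first exact: is_cvg_einfs.
  apply: nearW => n.
  apply: (@le_trans _ _ (\int[lebesgue_measure]_x (normc (F n x) ^+ 2)%:E)%E).
    by apply: ereal_inf_lbound; exists n => /=.
  by rewrite -l2nrm_sqrE lee_fin ler_pXn2r ?nnegrE ?l2nrm_ge0.
have fi : inL2 f.
  apply/inL2P; split => //; apply/integrableP; split; first exact: mg.
  under eq_integral do rewrite /= ger0_norm ?sqr_ge0 //.
  by rewrite (le_lt_trans le1) // ltry.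
exists (MkL2 fi); split => //.
rewrite -(ler_pXn2r (n := 2)) ?nnegrE ?l2nrm_ge0 //.
by rewrite -lee_fin l2nrm_sqrE.
Qed.

End L2Module.

Notation l2nrm := (nrm l2ip).

(** * Operators, singular numbers and explicit operators *)

Section Operators.
Context {R : realType}.
Local Notation mu := (@lebesgue_measure R).
Local Notation opl := (@finop R (L2 R) l2ip).
Local Notation nrmH := (l2ip_semi_inner (R := R)).
Implicit Types (U T S : (R -> R[i]) -> (R -> R[i])) (A B : L2 R -> L2 R).

Definition represents U A := forall f : L2 R, U f = A f :> (R -> R[i]).

Definition bounded_by A (c : R) := forall f : L2 R, l2nrm (A f) <= c * l2nrm f.

Lemma L2_lift (f : R -> R[i]) : inL2 f -> {g : L2 R | L2fun g = f}.
Proof. by move=> fi; exists (MkL2 fi). Qed.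

Lemma opnorm_ge0 U : (0 <= opnorm U)%E.
Proof.
apply: (@le_trans _ _ (L2norm (U (fun=> 0)))).
  by rewrite L2norm_poweR; exact: poweR_ge0.
apply: ereal_sup_ubound; exists (fun=> 0) => //; split; first exact: inL2_0.
have -> : L2norm (fun=> 0) = L2norm (0 : L2 R) by [].
by rewrite L2norm_nrm (nrm0 nrmH).
Qed.

Lemma opnorm_le U A (c : R) : represents U A -> 0 <= c -> bounded_by A c ->
  (opnorm U <= c%:E)%E.
Proof.
move=> UA c0 Ac; apply: ge_ereal_sup => _ [f [fi f1] <-].
have [g gE] := L2_lift fi; move: f1; rewrite -gE UA !L2norm_nrm !lee_fin => f1.
by rewrite (le_trans (Ac g)) // ler_piMr.
Qed.

Lemma qlinearZ A a f : qlinear l2ip A -> l2nrm (A (a *: f)) = normc a * l2nrm (A f).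
Proof.
move=> linA.
have A0 : l2nrm (A 0) = 0.
  have := linA 1 0 0; rewrite !scale1r addr0 opprD addrA subrr add0r.
  by rewrite (nrmN nrmH).
have := linA a f 0; rewrite addr0; set X := A (a *: f); set Y := a *: A f.
move=> e; rewrite -[RHS](nrmZ nrmH) -/Y.
have h1 : l2nrm (X - Y) <= 0.
  have -> : X - Y = (X - (Y + A 0)) + A 0 by rewrite opprD addrA subrK.
  by rewrite (le_trans (nrmD nrmH _ _)) // e A0 addr0.
apply/eqP; rewrite eq_le; apply/andP; split.
  have := nrmD nrmH (X - Y) Y; rewrite subrK; move: h1; lra.
have := nrmD nrmH (Y - X) X; rewrite subrK (nrm_distC nrmH).
by move: h1; lra.
Qed.

Lemma opnorm_bounded_by U A (c : R) : represents U A -> qlinear l2ip A ->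
  (opnorm U <= c%:E)%E -> bounded_by A c.
Proof.
move=> UA linA Uc.
have unit (g : L2 R) : l2nrm g <= 1 -> l2nrm (A g) <= c.
  move=> g1; rewrite -lee_fin -L2norm_nrm -UA (le_trans _ Uc) //.
  apply: ereal_sup_ubound; exists (L2fun g) => //; split; first exact: L2_inL2.
  by rewrite L2norm_nrm lee_fin.
have c0 : 0 <= c by rewrite -lee_fin (le_trans (opnorm_ge0 U)).
move=> f; have [f0|f0] := eqVneq (l2nrm f) 0.
  (* a null vector stays in the unit ball under every scaling *)
  rewrite f0 mulr0 leNgt; apply/negP => Af.
  have c1 : 0 <= (c + 1) / l2nrm (A f) by rewrite divr_ge0 ?ltW // ltr_wpDl.
  have := @unit (((c + 1) / l2nrm (A f))%:C *: f).
  rewrite (nrmZ nrmH) f0 mulr0 ler01 => /(_ isT).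
  rewrite (qlinearZ _ _ linA) normc_real ger0_norm //.
  by rewrite divfK ?gt_eqF //; lra.
have {}f0 : 0 < l2nrm f by rewrite lt_neqAle eq_sym f0 l2nrm_ge0.
have := @unit ((l2nrm f)^-1%:C *: f).
rewrite (nrmZ nrmH) (qlinearZ _ _ linA) normc_real.
rewrite ger0_norm ?invr_ge0 ?(ltW f0) // mulVf ?gt_eqF // lexx => /(_ isT).
by rewrite mulrC ler_pdivrMr.
Qed.

Lemma bounded_represents U : bounded_operator U ->
  exists A, [/\ represents U A, qlinear l2ip A & exists2 c, 0 <= c & bounded_by A c].
Proof.
move=> [UL Ulin Ufin].
pose A (f : L2 R) := MkL2 (UL _ (L2_inL2 f)).
have UA : represents U A by [].
have linA : qlinear l2ip A.
  move=> a f g; apply/eq_ae_nrm; rewrite /eq_ae.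
  exact: (Ulin a f g (L2_inL2 f) (L2_inL2 g)).
exists A; split => //.
have [c cE] : exists c : R, opnorm U = c%:E.
  by move: Ufin (opnorm_ge0 U); case: (opnorm U) => // c _ _; exists c.
exists c; first by rewrite -lee_fin -cE opnorm_ge0.
by apply: (opnorm_bounded_by UA linA); rewrite cE.
Qed.

Lemma represents_bounded U A (c : R) : represents U A -> qlinear l2ip A ->
  0 <= c -> bounded_by A c -> bounded_operator U.
Proof.
move=> UA linA c0 Ac; split.
- by move=> f /L2_lift[g <-]; rewrite UA; exact: L2_inL2.
- move=> a f g /L2_lift[f' <-] /L2_lift[g' <-].
  have -> : (fun x => a * f' x + g' x) = (a *: f' + g' : L2 R) by [].
  rewrite !UA; have -> : (fun x => a * A f' x + A g' x) =
    (a *: A f' + A g' : L2 R) by [].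
  exact/eq_ae_nrm/linA.
- by rewrite (le_lt_trans (opnorm_le UA c0 Ac)) // ltry.
Qed.

Definition raw_finop (l : seq (L2 R * L2 R)) (f : R -> R[i]) : R -> R[i] :=
  fun x => \sum_(p <- l) cintegral (fun y => f y * (p.2 y)^*) * p.1 x.

Lemma raw_finop_represents l : represents (raw_finop l) (opl l).
Proof. by move=> f; apply/funext => x; rewrite L2sumE. Qed.

Lemma finop_qlinear l : qlinear l2ip (opl l).
Proof.
by move=> a f g; rewrite (finopD nrmH) (finopZ nrmH) subrr; exact: (nrm0 nrmH).
Qed.

Lemma finop_bounded_by l : bounded_by (opl l) (nuc l2ip l).
Proof. by move=> f; exact: (nrm_finop nrmH). Qed.

Lemma raw_finop_bounded l : bounded_operator (raw_finop l).
Proof.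
apply: (represents_bounded (raw_finop_represents l) (finop_qlinear l) _
  (@finop_bounded_by l)).
exact: nuc_ge0.
Qed.

Lemma raw_finop_rank l n : (size l <= n)%N -> rank_le n (raw_finop l).
Proof.
pose p i : L2 R * L2 R := nth (0, 0) l i.
pose c (f : R -> R[i]) i := cintegral (fun y => f y * ((p i).2 y)^*).
move=> ln; exists (fun i => L2fun (p i).1); split => [i|f fi].
  exact: L2_inL2.
exists (fun i => c f i).
apply: aeW => x; rewrite /raw_finop (big_nth (0, 0)) big_mkord.
rewrite (big_ord_widen n (fun i => c f i * (p i).1 x) ln).
rewrite [RHS](bigID (fun i : 'I_n => (i < size l)%N)) /=.
rewrite [X in _ + X]big1 ?addr0 // => i.
by rewrite -leqNgt => li; rewrite /p (nth_default _ li) mulr0.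
Qed.

Lemma singular_number_le U A n l (c : R) : represents U A -> 0 <= c ->
  (size l <= n)%N -> bounded_by (fun h => A h - opl l h) c ->
  (singular_number n U <= c%:E)%E.
Proof.
move=> UA c0 ln Ac.
apply: (@le_trans _ _ (opnorm (fun f x => U f x - raw_finop l f x))).
  apply: ereal_inf_lbound; exists (raw_finop l) => //; split.
    exact: raw_finop_bounded.
  exact: raw_finop_rank.
apply: opnorm_le Ac => // f; apply/funext => x.
by rewrite L2subE UA raw_finop_represents.
Qed.

Lemma represents_rank U A n : represents U A -> rank_le n U ->
  exists e : 'I_n -> L2 R, forall h, exists a : 'I_n -> R[i],
    nrm l2ip (A h - \sum_(i < n) a i *: e i) = 0.
Proof.
move=> UA [e [ei eU]]; exists (fun i => MkL2 (ei i)) => h.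
have [a aE] := eU h (L2_inL2 h); exists a; apply/eq_ae_nrm.
by apply: aeS aE => x; rewrite UA L2sumE.
Qed.

Lemma singular_number_ge0 n U : (0 <= singular_number n U)%E.
Proof. by apply: le_ereal_inf_tmp => _ [S _ <-]; exact: opnorm_ge0. Qed.

Lemma singular_number_anti n m U : (n <= m)%N ->
  (singular_number m U <= singular_number n U)%E.
Proof.
move=> nm; apply: ereal_inf_le_tmp => _ [S [bS [e [ei eS]]] <-].
exists S => //; split => //.
exists (fun i : 'I_m => if insub (i : nat) is Some j then e j else fun=> 0).
split=> [i|f fi]; first by case: insubP => *; [exact: ei|exact: inL2_0].
have [c cE] := eS f fi.
exists (fun i : 'I_m => if insub (i : nat) is Some j then c j else 0).
apply: aeS cE => x ->.
pose G (i : nat) := if insub i is Some j then c j * e j x else 0.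
transitivity (\sum_(i < n) G i).
  by apply: eq_bigr => i _; rewrite /G valK.
rewrite (big_ord_widen m G nm) big_mkcond; apply: eq_bigr => i _.
rewrite /G; case: insubP => [j -> _//|]; rewrite mul0r.
by move=> /negbTE ->.
Qed.

(** One [eps] is spent on a near-optimal operator of rank [n], the other one on
    replacing it by an explicit operator. *)
Lemma explicit_approx U A n (eps : R) : represents U A -> qlinear l2ip A ->
  0 < eps -> (singular_number n U < eps%:E)%E ->
  exists l, (size l <= n)%N /\ bounded_by (fun h => A h - opl l h) (2 * eps).
Proof.
move=> UA linA eps0 /ereal_inf_lt[_ [S [bS rS] <-] Se].
have [B [SB linB [c c0 Bc]]] := bounded_represents bS.
have [e eP] := represents_rank SB rS.
have [l [ln lP]] := finite_rank_approx nrmH linB Bc eP eps0.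
exists l; split => // h.
have AB : bounded_by (fun h => A h - B h) eps.
  apply: (opnorm_bounded_by (U := fun f x => U f x - S f x)).
  - by move=> f; apply/funext => x; rewrite L2subE UA SB.
  - move=> a f g; apply/eq_ae_nrm.
    have h1 := (eq_ae_nrm _ _).2 (linA a f g).
    have h2 := (eq_ae_nrm _ _).2 (linB a f g).
    apply: aeS (ae_and h1 h2) => x [].
    rewrite !L2addE !L2scaleE !L2subE => -> ->.
    by rewrite !mulN1r mulrBr opprD addrACA.
  - exact: ltW.
rewrite (le_trans (nrmB nrmH _ (B h) _)) // mulr_natl mulr2n mulrDl lerD //.
Qed.

End Operators.

(** * Decomposition of an operator of Schatten class one half *)

Section Decomposition.
Context {R : realType}.
Local Notation opl := (@finop R (L2 R) l2ip).
Local Notation nrmH := (l2ip_semi_inner (R := R)).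
Implicit Types (U : (R -> R[i]) -> (R -> R[i])) (A B : L2 R -> L2 R).

Lemma schatten_half_sqrt U : schatten (2^-1 : R) U ->
  exists s : nat -> R, exists S : R,
    [/\ forall n, singular_number n U = (s n)%:E, forall n, 0 <= s n,
        forall n m, (n <= m)%N -> s m <= s n &
        forall N, \sum_(n < N) Num.sqrt (s n) <= S].
Proof.
move=> [bU]; set X := (\sum_(0 <= n <oo) _)%E => Xfin.
have term_ge0 n : (0 <= singular_number n U `^ 2^-1)%E by exact: poweR_ge0.
have part N : (\sum_(0 <= n < N) singular_number n U `^ 2^-1 <= X)%E.
  exact: nneseries_lim_ge.
have fin n : singular_number n U \is a fin_num.
  rewrite ge0_fin_numE ?singular_number_ge0 //.
  apply: (@lty_poweRy _ _ (2^-1)); first by rewrite invr_neq0.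
  rewrite (le_lt_trans _ Xfin) // (le_trans _ (part n.+1)) //.
  by rewrite big_nat_recr //= leeDr // sume_ge0.
pose s n := fine (singular_number n U).
have sE n : singular_number n U = (s n)%:E by rewrite /s fineK.
have s0 n : 0 <= s n by rewrite -lee_fin -sE singular_number_ge0.
have X0 : (0 <= X)%E by apply: nneseries_ge0.
exists s, (fine X); split => // [n m nm|N].
  by rewrite -lee_fin -!sE singular_number_anti.
have XE : X = (fine X)%:E by rewrite fineK // ge0_fin_numE.
rewrite -lee_fin -XE (le_trans _ (part N)) //.
rewrite -sumEFin big_mkord; apply: lee_sum => n _.
by rewrite sE poweR_EFin powR12_sqrt.
Qed.

(** Cauchy condensation; the value at zero takes care of the term of index
    one. *)
Lemma condensation (a : nat -> R) : (forall n m, (n <= m)%N -> a m <= a n) ->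
  (forall n, 0 <= a n) -> forall M,
  \sum_(m < M.+1) 2 ^+ m * a (2 ^ m)%N <= a 0 + 2 * \sum_(n < 2 ^ M) a n.
Proof.
move=> anti a0; elim=> [|M IHM].
  rewrite big_ord_recl big_ord0 addr0 expr0 mul1r expn0 big_ord_recl big_ord0.
  have := anti 0%N 1%N isT; have := a0 0%N; lra.
rewrite big_ord_recr /= (le_trans (lerD IHM (lexx _))) //.
rewrite -addrA lerD2l.
have -> : (2 ^ M.+1 = 2 ^ M + 2 ^ M)%N by rewrite expnS mul2n addnn.
rewrite big_split_ord /= mulrDr lerD2l exprS -mulrA ler_pM2l //.
rewrite (@le_trans _ _ (\sum_(i < 2 ^ M) a (2 ^ M + 2 ^ M)%N)) //.
  by rewrite sumr_const card_ord -natrX mulr_natl.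
by apply: ler_sum => i _; apply: anti; rewrite leq_add2l ltnW.
Qed.

Lemma geometric_half_le M : \sum_(m < M) (2^-1 : R) ^+ m <= 2.
Proof.
suff -> : \sum_(m < M) (2^-1 : R) ^+ m = 2 - 2 * 2^-1 ^+ M.
  by rewrite gerBl mulr_ge0 // exprn_ge0 // invr_ge0.
elim: M => [|M IHM]; first by rewrite big_ord0 expr0 mulr1 subrr.
rewrite big_ord_recr /= IHM exprS; lra.
Qed.

(** The errors are written as squares to have the sums of the [r m], instead of
    their square roots, in the sequel; the positive summand [q m] leaves
    room above the infimum that defines the singular number. *)
Lemma dyadic_approx U A : schatten (2^-1 : R) U -> represents U A ->
  qlinear l2ip A ->
  exists (l : nat -> seq (L2 R * L2 R)) (r : nat -> R) (L : R),
    [/\ l 0%N = [::], forall m, (size (l m) <= 2 ^ m)%N, forall m, 0 < r m,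
        forall m, bounded_by (fun h => A h - opl (l m) h) (r m ^+ 2) &
        forall M, \sum_(m < M) 2 ^+ m * r m <= L].
Proof.
move=> sU UA linA.
have [bU _] := sU.
have [B [UB _ [c c0 Bc]]] := bounded_represents bU.
have Ac : bounded_by A c.
  by move=> h; have -> : A h = B h by apply: L2_ext => x; rewrite -UA -UB.
have [s [S [sE s0 anti sS]]] := schatten_half_sqrt sU.
pose q m : R := 4^-1 ^+ m.
have q0 m : 0 < q m by rewrite exprn_gt0 // invr_gt0.
have ex m : exists l, (size l <= 2 ^ m)%N /\
    bounded_by (fun h => A h - opl l h) (2 * (s (2 ^ m)%N + q m ^+ 2)).
  have e0 : 0 < s (2 ^ m)%N + q m ^+ 2 by rewrite ltr_wpDl // exprn_gt0.
  apply: (explicit_approx UA linA e0).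
  by rewrite sE lte_fin ltrDl exprn_gt0.
have [l lP] := choice ex.
pose r m := 2 * (Num.sqrt (s (2 ^ m)%N) + q m).
have r0 m : 0 < r m by rewrite mulr_gt0 // ltr_wpDl // sqrtr_ge0.
exists (fun m => if m is 0 then [::] else l m).
exists (fun m => if m is 0 then c + 1 else r m).
exists (c + 1 + 2 * (Num.sqrt (s 0) + 2 * S + 2)).
split => // [[|m]|[|m]|[|m]|M] //.
- by have [] := lP m.+1.
- by rewrite ltr_wpDl.
- move=> h; rewrite finop_nil subr0 (le_trans (Ac h)) //.
  rewrite ler_wpM2r ?l2nrm_ge0 // expr2; nra.
- have [_ lb] := lP m.+1 => h; rewrite (le_trans (lb h)) //.
  rewrite ler_wpM2r ?l2nrm_ge0 // /r.
  have := sqr_sqrtr (s0 (2 ^ m.+1)%N); have := sqrtr_ge0 (s (2 ^ m.+1)%N).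
  have := q0 m.+1; set u := Num.sqrt _; set v := q _.
  move=> v0 u0 <-; nra.
have S0 : 0 <= Num.sqrt (s 0) + 2 * S + 2.
  have := sS 0%N; rewrite big_ord0 => S0.
  by rewrite !addr_ge0 ?sqrtr_ge0 ?mulr_ge0.
case: M => [|M]; first by rewrite big_ord0; move: S0 c0; lra.
rewrite big_ord_recl /= expr0 mul1r lerD2l.
have le1 : \sum_(i < M) 2 ^+ bump 0 i * r (bump 0 i) <=
    \sum_(i < M.+1) 2 ^+ i * r i.
  rewrite big_ord_recl /= lerDr mul1r; exact: ltW.
rewrite (le_trans le1) //.
rewrite /r; under eq_bigr do rewrite mulrCA mulrDr.
rewrite -mulr_sumr ler_pM2l // big_split /= lerD //.
  have anti_sqrt n m : (n <= m)%N -> Num.sqrt (s m) <= Num.sqrt (s n).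
    by move=> nm; rewrite ler_sqrt ?anti.
  have sqrt0 n : 0 <= Num.sqrt (s n) by exact: sqrtr_ge0.
  rewrite (le_trans (condensation anti_sqrt sqrt0 M)) //.
  by rewrite lerD2l ler_pM2l.
rewrite (le_trans _ (geometric_half_le M.+1)) //; apply: ler_sum => i _.
by rewrite -exprMn; have -> : (2 : R) * 4^-1 = 2^-1 by field.
Qed.

(** Consecutive approximations of [dyadic_approx] differ by an operator of rank
    at most [3 * 2 ^ m] and norm at most [r m ^+ 2 + r m.+1 ^+ 2], which splits
    into as many rank-one operators without loss in norm. *)
Lemma atomic_decomposition U A : schatten (2^-1 : R) U -> represents U A ->
  qlinear l2ip A ->
  exists (D : nat -> seq (L2 R * L2 R)) (t : nat -> R) (L : R),
    [/\ forall m, (size (D m) <= 3 * 2 ^ m)%N,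
        forall m, 0 < t m,
        forall m p, p \in D m -> l2nrm p.1 <= 1 /\ l2nrm p.2 <= t m ^+ 2,
        forall M, \sum_(m < M) 2 ^+ m * t m <= L &
        forall M, bounded_by (fun h => A h - \sum_(m < M) opl (D m) h)
                    ((L / 2 ^+ M) ^+ 2)].
Proof.
move=> sU UA linA.
have [l [r [L [l0 sl r0 lA rL]]]] := dyadic_approx sU UA linA.
pose t m := r m + r m.+1.
have t0 m : 0 < t m by rewrite addr_gt0.
have ex m : exists d, [/\ (size d <= 3 * 2 ^ m)%N,
    forall h, l2nrm (opl (l m.+1) h - opl (l m) h - opl d h) = 0 &
    forall p, p \in d -> l2nrm p.1 <= 1 /\ l2nrm p.2 <= t m ^+ 2].
  have dE h : opl (l m.+1 ++ neg_pairs (l m)) h = opl (l m.+1) h - opl (l m) h.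
    by rewrite finop_cat (finop_neg _).
  have [||d [sd dd dP]] := @finop_orthonormalize _ _ _ nrmH
      (l m.+1 ++ neg_pairs (l m)) (t m ^+ 2).
  - exact: sqr_ge0.
  - move=> h; rewrite dE.
    rewrite (le_trans (nrmB nrmH _ (A h) _)) //.
    rewrite (nrm_distC nrmH).
    rewrite (le_trans (lerD (lA m.+1 h) (lA m h))) //.
    rewrite -mulrDl ler_wpM2r ?l2nrm_ge0 // /t.
    by have := r0 m; have := r0 m.+1; nra.
  exists d; split => // [|h]; last by rewrite -dE.
  rewrite (leq_trans sd) // size_cat size_map mulSn addnC.
  rewrite leq_add // (leq_trans (sl _)) // expnS //.
have [D DP] := choice ex.
exists D, t, (L + L).
have L0 : 0 <= L by rewrite (le_trans _ (rL 0%N)) // big_ord0.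
have rLm m : 2 ^+ m * r m <= L.
  rewrite (le_trans _ (rL m.+1)) // big_ord_recr /= lerDr sumr_ge0 // => i _.
  by rewrite mulr_ge0 ?exprn_ge0 // ltW.
split => // [m|m p|M|M h].
- by have [] := DP m.
- by have [_ _] := DP m; exact.
- rewrite /t; under eq_bigr do rewrite mulrDr.
  rewrite big_split /= lerD ?rL //.
  rewrite (le_trans _ (rL M.+1)) // big_ord_recl /=.
  rewrite -[leLHS]add0r lerD //; first by rewrite mulr_ge0 // ltW.
  apply: ler_sum => i _; rewrite /bump add1n ler_wpM2r ?(ltW (r0 _)) //.
  by rewrite ler_eXn2l // ?ltr1n // leqnSn.
have tele : l2nrm (opl (l M) h - \sum_(m < M) opl (D m) h) = 0.
  elim: M => [|M IHM].
    by rewrite big_ord0 l0 finop_nil subr0 (nrm0 nrmH).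
  apply/eqP; rewrite eq_le l2nrm_ge0 andbT big_ord_recr /=.
  have [_ /(_ h) dh _] := DP M.
  have -> : opl (l M.+1) h - (\sum_(m < M) opl (D m) h + opl (D M) h) =
      (opl (l M.+1) h - opl (l M) h - opl (D M) h) +
      (opl (l M) h - \sum_(m < M) opl (D m) h).
    by rewrite opprD addrA [RHS]addrA (addrAC _ _ (opl (l M) h)) subrK addrAC.
  by rewrite (le_trans (nrmD nrmH _ _)) // dh IHM addr0.
rewrite (le_trans (nrmB nrmH _ (opl (l M) h) _)) // tele addr0.
rewrite (le_trans (lA M h)) // ler_wpM2r ?l2nrm_ge0 //.
rewrite ler_pXn2r ?nnegrE ?(ltW (r0 _)) //; last first.
  by rewrite divr_ge0 ?addr_ge0 ?exprn_ge0.
rewrite ler_pdivlMr ?exprn_gt0 // mulrC (le_trans (rLm M)) //.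
by rewrite lerDl.
Qed.

End Decomposition.

(** * Rank-one operators distorted by a weight *)

Section Weights.
Context {R : realType}.
Local Notation mu := (@lebesgue_measure R).
Local Notation opl := (@finop R (L2 R) l2ip).
Local Notation nrmH := (l2ip_semi_inner (R := R)).
Implicit Types (f g : L2 R) (w : R * R -> R[i]) (p : L2 R * L2 R).

Definition toL2 (f : R -> R[i]) : L2 R :=
  if pselect (inL2 f) is left fi then MkL2 fi else 0.

Lemma toL2E (f : R -> R[i]) : inL2 f -> L2fun (toL2 f) = f.
Proof. by rewrite /toL2; case: pselect. Qed.

Lemma cmeasurable_fst (f : R -> R[i]) : cmeasurable f ->
  cmeasurable (fun z : R * R => f z.1).
Proof. by move=> mf; exact: (cmeasurable_comp measurable_fst mf). Qed.

Lemma cmeasurable_snd (f : R -> R[i]) : cmeasurable f ->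
  cmeasurable (fun z : R * R => f z.2).
Proof. by move=> mf; exact: (cmeasurable_comp measurable_snd mf). Qed.

Lemma cmeasurable_section (w : R * R -> R[i]) (x : R) : cmeasurable w ->
  cmeasurable (fun y => w (x, y)).
Proof. by move=> mw; apply: (cmeasurable_comp _ mw); exact: pair1_measurable. Qed.

Lemma cmeasurable_max (psi : R -> R[i]) : cmeasurable psi ->
  cmeasurable (fun z : R * R => psi (Num.max z.1 z.2)).
Proof.
move=> mpsi; apply: (cmeasurable_comp _ mpsi).
by apply: measurable_maxr; [exact: measurable_fst|exact: measurable_snd].
Qed.

Lemma cmeasurable_ip f g : cmeasurable (fun x => f x * (g x)^*).
Proof. exact/cintegrable_meas/cintegrable_ip. Qed.

Lemma integral_normc_mul f g :
  \int[mu]_x (normc (f x * (g x)^*)) <= l2nrm f * l2nrm g.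
Proof.
pose f' := MkL2 (inL2_normc (L2_inL2 f)).
pose g' := MkL2 (inL2_normc (L2_inL2 g)).
have nf (h : L2 R) : l2nrm (MkL2 (inL2_normc (L2_inL2 h))) <= l2nrm h.
  rewrite -[leRHS]mul1r; apply: l2nrm_le => //; apply: aeW => x.
  by rewrite normc_real ger0_norm ?normc_ge0 // mul1r.
apply: (@le_trans _ _ (l2nrm f' * l2nrm g')); last first.
  by rewrite ler_pM ?l2nrm_ge0 // nf.
rewrite (le_trans _ (cauchy_schwarz nrmH f' g')) //.
rewrite (le_trans _ (le_Re_normc _)) // (le_trans _ (ler_norm _)) //=.
rewrite le_eqVlt; apply/orP; left; apply/eqP; apply: eq_Rintegral => x _.
by rewrite ComplexField.Normc.normcM normc_conj /= oppr0 !mulr0 subr0.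
Qed.

Definition weight w (B : R) := cmeasurable w /\ forall z, normc (w z) <= B.

Lemma weight_ge0 w B : weight w B -> 0 <= B.
Proof. by move=> [_ wB]; rewrite (le_trans (normc_ge0 _) (wB (0, 0))). Qed.

Lemma cintegrable_weight_mul w B (g : R -> R[i]) x : weight w B ->
  cintegrable g -> cintegrable (fun y => w (x, y) * g y).
Proof.
move=> [mw wB] ig; apply: (@le_cintegrable _ _ (fun y => B * normc (g y))).
- by apply: cmeasurableM; [exact: cmeasurable_section|exact: cintegrable_meas].
- exact/integrableZ_EFin/integrable_normc.
- by move=> y; rewrite ComplexField.Normc.normcM ler_wpM2r ?normc_ge0.
Qed.

Lemma cintegrable_weight w B f g x : weight w B ->
  cintegrable (fun y => w (x, y) * (f y * (g y)^*)).
Proof. by move=> /cintegrable_weight_mul; apply; exact: cintegrable_ip. Qed.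

Lemma normc_cintegral_weight w B f g x : weight w B ->
  normc (cintegral (fun y => w (x, y) * (f y * (g y)^*))) <=
  B * (l2nrm f * l2nrm g).
Proof.
move=> wB; have iw := cintegrable_weight f g x wB.
rewrite (le_trans (normc_cintegral iw)) //.
apply: (@le_trans _ _ (\int[mu]_y (B * normc (f y * (g y)^*)))).
  apply: le_Rintegral => //; first exact: integrable_normc.
    exact/integrableZ_EFin/integrable_normc/cintegrable_ip.
  move=> y _; rewrite ComplexField.Normc.normcM ler_wpM2r ?normc_ge0 //.
  by case: wB.
rewrite RintegralZl //; last exact/integrable_normc/cintegrable_ip.
by rewrite ler_wpM2l ?(weight_ge0 wB) // integral_normc_mul.
Qed.

(** The operator with kernel [w (x, y) * p.1 x * (p.2 y)^*]: a rank-one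
    operator distorted by the weight [w]. *)
Definition rwop w p f : R -> R[i] :=
  fun x => p.1 x * cintegral (fun y => w (x, y) * (f y * (p.2 y)^*)).

Lemma cmeasurable_rwop w p f : cmeasurable w -> cmeasurable (rwop w p f).
Proof.
move=> mw; apply: cmeasurableM; first exact/inL2_meas/L2_inL2.
apply: (cmeasurable_cintegral (K := fun z => w z * (f z.2 * (p.2 z.2)^*))).
apply: cmeasurableM => //.
exact: (cmeasurable_snd (cmeasurable_ip f p.2)).
Qed.

Lemma normc_rwop w B p f x : weight w B ->
  normc (rwop w p f x) <= B * (l2nrm f * l2nrm p.2) * normc (p.1 x).
Proof.
move=> wB; rewrite ComplexField.Normc.normcM mulrC.
by rewrite ler_wpM2r ?normc_ge0 // normc_cintegral_weight.
Qed.

Lemma inL2_rwop w B p f : weight w B -> inL2 (rwop w p f).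
Proof.
move=> wB; apply: inL2_le (L2_inL2 p.1) _ => [|x].
  by apply: cmeasurable_rwop; case: wB.
exact: (normc_rwop p f x wB).
Qed.

Definition wop w p f : L2 R := toL2 (rwop w p f).

Lemma wopE w B p f : weight w B -> wop w p f = rwop w p f :> (R -> R[i]).
Proof. by move=> wB; rewrite toL2E //; exact: inL2_rwop wB. Qed.

Lemma wop_bounded w B p : weight w B ->
  bounded_by (wop w p) (B * (l2nrm p.1 * l2nrm p.2)).
Proof.
move=> wB f; have B0 := weight_ge0 wB.
have -> : B * (l2nrm p.1 * l2nrm p.2) * l2nrm f =
  B * (l2nrm f * l2nrm p.2) * l2nrm p.1 by ring.
apply: l2nrm_le; first by rewrite !mulr_ge0 ?l2nrm_ge0.
by apply: aeW => x; rewrite (wopE _ _ wB) normc_rwop.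
Qed.

Lemma weightD w1 w2 B1 B2 : weight w1 B1 -> weight w2 B2 ->
  weight (fun z => w1 z + w2 z) (B1 + B2).
Proof.
move=> [m1 b1] [m2 b2]; split; first exact: cmeasurableD.
by move=> z; rewrite (le_trans (le_normcD _ _)) // lerD.
Qed.

Lemma weightZ a w B : weight w B -> weight (fun z => a * w z) (normc a * B).
Proof.
move=> [m b]; split.
  by apply: cmeasurableM => //; exact: cmeasurable_cst.
by move=> z; rewrite ComplexField.Normc.normcM ler_wpM2l ?normc_ge0.
Qed.

Lemma wopD w1 w2 B1 B2 p f : weight w1 B1 -> weight w2 B2 ->
  wop (fun z => w1 z + w2 z) p f = wop w1 p f + wop w2 p f.
Proof.
move=> h1 h2; apply: L2_ext => x; rewrite L2addE.
rewrite (wopE _ _ (weightD h1 h2)) (wopE _ _ h1) (wopE _ _ h2) /rwop.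
rewrite -mulrDr -cintegralD; [|exact: cintegrable_weight h1|
  exact: cintegrable_weight h2].
by congr (_ * cintegral _); apply/funext => y; rewrite mulrDl.
Qed.

Lemma wopZ a w B p f : weight w B ->
  wop (fun z => a * w z) p f = a *: wop w p f.
Proof.
move=> h; apply: L2_ext => x; rewrite L2scaleE.
rewrite (wopE _ _ (weightZ a h)) (wopE _ _ h) /rwop.
rewrite mulrCA -(cintegralZ a); last exact: cintegrable_weight h.
by congr (_ * cintegral _); apply/funext => y; rewrite !mulrA.
Qed.

Lemma wop_scale w B p (a : R[i]) f : weight w B ->
  wop w (p.1, a *: p.2) f = a^* *: wop w p f.
Proof.
move=> h; apply: L2_ext => x; rewrite L2scaleE !(wopE _ _ h) /rwop /=.
rewrite mulrCA -(cintegralZ a^*); last exact: cintegrable_weight h.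
congr (_ * cintegral _); apply/funext => y.
by rewrite conjcM; ring.
Qed.

Definition mulL2 (b : R -> R[i]) f : L2 R := toL2 (fun x => b x * f x).

Definition bounded_meas (b : R -> R[i]) (B : R) :=
  cmeasurable b /\ forall x, normc (b x) <= B.

Lemma mulL2E b B f x : bounded_meas b B -> mulL2 b f x = b x * f x.
Proof.
by move=> [mb bB]; rewrite /mulL2 toL2E //; exact: inL2_bounded_mul (L2_inL2 f).
Qed.

Lemma mulL2_bounded b B : bounded_meas b B -> bounded_by (mulL2 b) B.
Proof.
move=> bB f; apply: l2nrm_le.
  by rewrite (le_trans (normc_ge0 (b 0))) //; case: bB.
apply: aeW => x; rewrite (mulL2E _ _ bB) ComplexField.Normc.normcM.
by rewrite ler_wpM2r ?normc_ge0 //; case: bB.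
Qed.

Lemma bounded_meas_conj b B : bounded_meas b B -> bounded_meas (fun x => (b x)^*) B.
Proof.
by move=> [mb bB]; split => [|x]; [exact: cmeasurableJ|rewrite normc_conj].
Qed.

Lemma weight_prod b c B C : bounded_meas b B -> bounded_meas c C ->
  weight (fun z => b z.1 * c z.2) (B * C).
Proof.
move=> [mb bB] [mc cC]; split.
  by apply: cmeasurableM; [exact: cmeasurable_fst|exact: cmeasurable_snd].
by move=> z; rewrite ComplexField.Normc.normcM ler_pM ?normc_ge0.
Qed.

Lemma wop_prod b c B C p f : bounded_meas b B -> bounded_meas c C ->
  wop (fun z => b z.1 * c z.2) p f =
  opl [:: (mulL2 b p.1, mulL2 (fun y => (c y)^*) p.2)] f.
Proof.
move=> hb hc; apply: L2_ext => x.
rewrite (wopE _ _ (weight_prod hb hc)) /rwop /= /finop big_seq1 L2scaleE.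
rewrite (mulL2E _ _ hb) /l2ip /= [RHS]mulrC -mulrA mulrCA; congr (_ * _).
rewrite -(cintegralZ (b x)); last exact: cintegrable_ip.
congr cintegral; apply/funext => y.
by rewrite (mulL2E _ _ (bounded_meas_conj hc)) conjcM conjcK; ring.
Qed.

End Weights.

(** * Restrictions to intervals *)

Section Indicators.
Context {R : realType}.
Local Notation mu := (@lebesgue_measure R).
Local Notation nrmH := (l2ip_semi_inner (R := R)).
Implicit Types (E : pred R) (f g : L2 R).

Definition convexp E := forall s t u : R, s <= t <= u -> E s -> E u -> E t.

Lemma normc_bool (b : bool) : normc (b%:R : R[i]) = b%:R.
Proof.
by case: b; rewrite ?ComplexField.Normc.normc1 ?ComplexField.Normc.normc0.
Qed.

Lemma bounded_meas_indicator E : convexp E -> bounded_meas (fun x => (E x)%:R : R[i]) 1.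
Proof.
move=> cE; split => [|x]; last by rewrite normc_bool; case: (E x).
have mE : measurable [set x | E x].
  by apply: is_interval_measurable => s u /= Es Eu t stu; apply: (cE s t u).
have -> : (fun x => (E x)%:R : R[i]) = fun x => (\1_[set x | E x] x)%:C.
  apply/funext => x; rewrite indicE; have [Ex|Ex] := boolP (E x).
    by rewrite mem_set.
  by rewrite memNset //; exact/negP.
exact/cmeasurable_real/measurable_indic.
Qed.

Definition mulI E f : L2 R := mulL2 (fun x => (E x)%:R) f.

Lemma mulIE E f x : convexp E -> mulI E f x = (E x)%:R * f x.
Proof. by move=> cE; rewrite (mulL2E _ _ (bounded_meas_indicator cE)). Qed.

Lemma nrm_mulI E f : convexp E -> l2nrm (mulI E f) <= l2nrm f.
Proof.
by move=> /bounded_meas_indicator cE; rewrite (le_trans (mulL2_bounded cE f)) // mul1r.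
Qed.

(** Running maxima of points of [E] chosen above each rational number, where that
    is possible. *)
Lemma cofinal_sequence E c : E c -> exists t : nat -> R,
  [/\ forall n, E (t n), forall n, c <= t n &
      forall x y, E y -> x < y -> \forall n \near \oo, x <= t n].
Proof.
move=> Ec.
have ex k : exists y, E y /\ forall (q : rat) x,
    unpickle k = Some q -> E x -> ratr q < x -> ratr q < y.
  case: (pselect (exists (q : rat) x, [/\ unpickle k = Some q, E x & ratr q < x])).
    by move=> [q [x [qE Ex qx]]]; exists x; split => // q' x'; rewrite qE => -[<-].
  by move=> nex; exists c; split => // q x qE Ex qx; case: nex; exists q, x.
have [y yP] := choice ex.
exists (fun n => \big[Num.max/c]_(k < n) y k); split => [n|n|x z Ez xz].
- elim/big_ind: _ => // [a b Ea Eb|k _]; first by rewrite maxEle; case: ifP.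
  by have [] := yP k.
- exact: bigmax_ge_id.
- have [q] := rat_in_itvoo xz; rewrite in_itv /= => /andP[xq qz].
  exists (pickle q).+1 => // n /= nq.
  have [_ /(_ q z (pickleK q) Ez qz) qy] := yP (pickle q).
  apply: ltW; apply: (lt_trans xq); apply: (lt_le_trans qy).
  exact: (le_bigmax _ (fun k : 'I_n => y k) (Ordinal nq)).
Qed.

Lemma ae_neq (a : R) : {ae mu, forall x, x <> a}.
Proof.
exists [set a]; split => [//||x /= /contrapT //].
exact: lebesgue_measure_set1.
Qed.

Lemma ae_not_max E : {ae mu, forall x, E x -> exists y, E y /\ x < y}.
Proof.
case: (pselect (exists e, E e /\ forall y, E y -> y <= e)) => [[e [Ee em]]|nex].
  apply: aeS (ae_neq e) => x xe Ex; exists e; split => //.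
  by rewrite lt_neqAle em // andbT; exact/eqP.
apply: aeW => x Ex; apply: contrapT => nex'; apply: nex; exists x; split => // y Ey.
by rewrite leNgt; apply/negP => xy; apply: nex'; exists y.
Qed.

(** The intervals between two points of [E] exhaust [E] up to its endpoints, which
    carry no mass. *)
Lemma nrm_convex E f (c : R) : convexp E -> 0 <= c ->
  (forall s t, E s -> E t -> s <= t ->
    l2nrm (mulI (fun x => s < x <= t) f) <= c) ->
  l2nrm (mulI E f) <= c.
Proof.
move=> cE c0 Ec.
case: (pselect (exists e, E e)) => [[e Ee]|nE]; last first.
  have -> : mulI E f = 0.
    apply: L2_ext => x; rewrite mulIE //; have [Ex|] := boolP (E x).
      by case: nE; exists x.
    by rewrite mul0r.
  by rewrite (nrm0 nrmH).
have [t [Et et tP]] := cofinal_sequence Ee.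
have Ee' : (fun x => E (- x)) (- e) by rewrite opprK.
have [s [Es es sP]] := @cofinal_sequence (fun x => E (- x)) (- e) Ee'.
have cst a b : convexp (fun x : R => a < x <= b).
  move=> x y z /andP[xy yz] /andP[ax _] /andP[_ zb].
  by rewrite (lt_le_trans ax xy) (le_trans yz zb).
pose F n := mulI (fun x => - s n < x <= t n) f.
have [|||g [gE gc]] := @fatou_L2 _ F (fun x => (E x)%:R * f x) c c0.
- apply: cmeasurableM; first by case: (bounded_meas_indicator cE).
  exact/inL2_meas/L2_inL2.
- have h1 := ae_not_max E; have h2 : {ae mu, forall x, E x -> exists y, E y /\ y < x}.
    case: (pselect (exists m, E m /\ forall y, E y -> m <= y)) => [[m [Em mm]]|nex].
      apply: aeS (ae_neq m) => x xm Ex; exists m; split => //.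
      by rewrite lt_neqAle mm // andbT; apply/eqP => /esym.
    apply: aeW => x Ex; apply: contrapT => nex'; apply: nex.
    exists x; split => // y Ey.
    by rewrite leNgt; apply/negP => xy; apply: nex'; exists y.
  apply: aeS (ae_and h1 h2) => x [xmax xmin].
  have [Ex|Ex] := boolP (E x).
    have [y [Ey xy]] := xmax Ex; have [z [Ez zx]] := xmin Ex.
    apply: cvg_near_cst.
    have near1 := tP _ _ Ey xy.
    have near2 : \forall n \near \oo, - ((z + x) / 2) <= s n.
      apply: (sP _ (- z)); first by rewrite opprK.
      by rewrite ltrN2; lra.
    apply: filterS2 near1 near2 => n xt xs.
    rewrite /F mulIE // xt andbT; have -> : - s n < x by lra.
    by rewrite subrr ComplexField.Normc.normc0.
  apply: cvg_near_cst; apply: nearW => n; rewrite /F mulIE //.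
  have -> : (- s n < x <= t n) = false.
    apply/negP => /andP[sx xt]; move/negP: Ex; apply.
    by apply: (cE (- s n) _ (t n)); rewrite ?(ltW sx).
  by rewrite mul0r subrr ComplexField.Normc.normc0.
- move=> n; apply: Ec => //.
  by rewrite (le_trans _ (et n)) // -lerNl.
by have -> : mulI E f = g by apply: L2_ext => x; rewrite mulIE // gE.
Qed.

Lemma mulL2_supp E (b : R -> R[i]) (B beta : R) f : bounded_meas b B -> convexp E ->
  0 <= beta -> (forall x, normc (b x) <= beta * (E x)%:R) ->
  l2nrm (mulL2 b f) <= beta * l2nrm (mulI E f).
Proof.
move=> hb cE b0 bE; apply: l2nrm_le => //; apply: aeW => x.
rewrite (mulL2E _ _ hb) mulIE // !ComplexField.Normc.normcM normc_bool mulrA.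
by rewrite ler_wpM2r ?normc_ge0.
Qed.

(** The distribution function of the density [normc (f x) ^+ 2]. *)
Definition mass f (t : R) : R := l2nrm (mulI (fun x => x <= t) f) ^+ 2.

Lemma massB f s t : s <= t ->
  mass f t - mass f s = l2nrm (mulI (fun x => s < x <= t) f) ^+ 2.
Proof.
move=> st.
have c1 a : convexp (fun x : R => x <= a).
  by move=> x y z /andP[xy yz] _; exact: le_trans.
have c2 : convexp (fun x : R => s < x <= t).
  move=> x y z /andP[xy yz] /andP[ax _] /andP[_ zb].
  by rewrite (lt_le_trans ax xy) (le_trans yz zb).
rewrite /mass; set u := mulI _ _; set w := mulI _ _; set z := mulI _ _.
have -> : u = w + z.
  apply: L2_ext => x; rewrite L2addE !mulIE // -mulrDl -natrD; congr (_%:R * _).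
  have [xs|xs] := leP x s; first by rewrite (le_trans xs st).
  by rewrite add0n.
have wz : l2ip w z = 0.
  rewrite /l2ip -[RHS](cintegral0 (R := R)); congr cintegral; apply/funext => x.
  rewrite !mulIE //; have [xs|xs] := leP x s; last by rewrite !mul0r.
  by rewrite mul0r conjc0 mulr0.
by rewrite (nrmD_sqr nrmH) wz mulr0 addr0 addrAC subrr add0r.
Qed.

Lemma mass_ge0 f t : 0 <= mass f t. Proof. exact: sqr_ge0. Qed.

Lemma mass_le f t : mass f t <= l2nrm f ^+ 2.
Proof.
rewrite ler_pXn2r ?nnegrE ?l2nrm_ge0 // nrm_mulI //.
by move=> x y z /andP[xy yz] _; exact: le_trans.
Qed.

Lemma mass_nd f s t : s <= t -> mass f s <= mass f t.
Proof. by move=> /(massB f) e; rewrite -subr_ge0 e sqr_ge0. Qed.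

Lemma nrm_mulI_mass E f (d : R) : convexp E -> 0 <= d ->
  (forall s t, E s -> E t -> s <= t -> mass f t - mass f s <= d) ->
  l2nrm (mulI E f) ^+ 2 <= d.
Proof.
move=> cE d0 Ed; rewrite -[leRHS]sqr_sqrtr //.
rewrite ler_pXn2r ?nnegrE ?l2nrm_ge0 ?sqrtr_ge0 //.
apply: nrm_convex => //.
move=> s t Es Et st; rewrite -(ler_pXn2r (n := 2)) ?nnegrE ?l2nrm_ge0 ?sqrtr_ge0 //.
by rewrite [leRHS]sqr_sqrtr // -(massB f st) Ed.
Qed.

End Indicators.

(** * Splitting into finite rank and small nuclear norm *)

Section Splits.
Context {R : realType}.
Local Notation opl := (@finop R (L2 R) l2ip).
Local Notation nrmH := (l2ip_semi_inner (R := R)).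

(** The rank [r] may be discarded at no cost, the nuclear norm [nu] can be traded
    for rank, and the error [e] is to be made arbitrarily small. *)
Definition splits (W : L2 R -> L2 R) (r nu e : R) :=
  exists l1 l2, [/\ (size l1)%:R <= r, nuc l2ip l2 <= nu &
    bounded_by (fun h => W h - opl l1 h - opl l2 h) e].

Lemma big_iota0 (T : Type) (idx : T) (op : T -> T -> T) n (F : nat -> T) :
  \big[op/idx]_(i <- iota 0 n) F i = \big[op/idx]_(i < n) F i.
Proof. by rewrite -(big_mkord xpredT) /index_iota subn0. Qed.

Lemma weight_sum (I : Type) (s : seq I) (w : I -> R * R -> R[i]) (B : I -> R) :
  (forall i, weight (w i) (B i)) ->
  weight (fun z => \sum_(i <- s) w i z) (\sum_(i <- s) B i).
Proof.
move=> wB; split=> [|z]; first by apply: cmeasurable_sum => i; case: (wB i).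
rewrite (le_trans (normc_sum _ _)) //; apply: ler_sum => i _.
by case: (wB i).
Qed.

Lemma wop_sum (I : Type) (s : seq I) (w : I -> R * R -> R[i]) (B : I -> R) p f :
  (forall i, weight (w i) (B i)) ->
  wop (fun z => \sum_(i <- s) w i z) p f = \sum_(i <- s) wop (w i) p f.
Proof.
move=> wB; elim: s => [|i s IHs].
  have w0 : weight (fun z : R * R => \sum_(i <- [::]) w i z) 0.
    by have := weight_sum [::] wB; rewrite [X in weight _ X]big_nil.
  rewrite big_nil; apply: L2_ext => x; rewrite (wopE _ _ w0) /rwop.
  under eq_fun do rewrite big_nil mul0r.
  by rewrite cintegral0 mulr0.
have -> : (fun z => \sum_(j <- i :: s) w j z) =
    fun z => w i z + \sum_(j <- s) w j z.
  by apply/funext => z; rewrite big_cons.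
by rewrite (wopD _ _ (wB i) (weight_sum s wB)) IHs big_cons.
Qed.

End Splits.

(** * Dyadic refinement for a rank-one kernel *)

Section Levels.
Context {R : realType} (v : R -> R).
Hypothesis v_nd : forall s t, s <= t -> v s <= v t.
Hypothesis v_ge0 : forall t, 0 <= v t.
Hypothesis v_lt1 : forall t, v t < 1.
Local Notation opl := (@finop R (L2 R) l2ip).
Local Notation nrmH := (l2ip_semi_inner (R := R)).

(** The index of the dyadic interval of length [2 ^- l] that contains [v t]. *)
Definition lev (l : nat) (t : R) : nat := Num.truncn (2 ^+ l * v t).

Lemma lev_itv l t : (lev l t)%:R <= 2 ^+ l * v t < (lev l t).+1%:R.
Proof. by apply: truncn_itv; rewrite mulr_ge0 ?exprn_ge0. Qed.

Lemma lev_lt l t : (lev l t < 2 ^ l)%N.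
Proof.
rewrite truncn_lt_nat ?mulr_ge0 ?exprn_ge0 // natrX.
by rewrite gtr_pMr ?exprn_gt0.
Qed.

Lemma lev_nd l s t : s <= t -> (lev l s <= lev l t)%N.
Proof. by move=> st; apply: le_truncn; rewrite ler_pM2l ?exprn_gt0 ?v_nd. Qed.

Lemma lev_gt l s t : (lev l s < lev l t)%N -> s < t.
Proof. by move=> h; rewrite ltNge; apply/negP => /(lev_nd l); rewrite leqNgt h. Qed.

Lemma lev_half l t : (lev l.+1 t)./2 = lev l t.
Proof.
apply/esym/truncn_def; have := lev_itv l.+1 t; set n := lev l.+1 t.
have nE : n%:R = (odd n)%:R + 2 * (n./2)%:R :> R.
  by rewrite -{1}(odd_double_half n) natrD -mul2n natrM.
have o0 : 0 <= (odd n)%:R :> R by [].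
have o1 : (odd n)%:R <= 1 :> R by case: (odd n).
rewrite -!natr1 nE exprS -mulrA => /andP[h1 h2].
by apply/andP; split; lra.
Qed.

Lemma lev_close l s t : lev l s = lev l t -> v t - v s <= 2^-1 ^+ l.
Proof.
move=> e; have /andP[s1 _] := lev_itv l s; have /andP[_ t2] := lev_itv l t.
rewrite exprVn -(ler_pM2l (x := 2 ^+ l)) ?exprn_gt0 // divff ?expf_neq0 //.
by move: s1 t2; rewrite e -natr1 mulrBr; lra.
Qed.

Lemma lev_convex l i : convexp (fun t => lev l t == i).
Proof.
move=> s t u /andP[st tu] /eqP si /eqP ui; rewrite eqn_leq.
by rewrite -{1}ui -{1}si !lev_nd.
Qed.

Lemma lev_lt_convex l i : convexp (fun t => (lev l t < i)%N).
Proof.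
by move=> s t u /andP[_ tu] _; apply: leq_ltn_trans; exact: lev_nd.
Qed.

Context (psi : R -> R[i]) (K B : R).
Hypothesis psi_var : forall s t, s <= t ->
  normc (psi t - psi s) <= K * (v t - v s).
Hypothesis psi_meas : cmeasurable psi.
Hypothesis psi_B : forall t, normc (psi t) <= B.
Hypothesis K_ge0 : 0 <= K.

Lemma psi_osc l s t : lev l s = lev l t ->
  normc (psi t - psi s) <= K * 2^-1 ^+ l.
Proof.
move=> e; have [st|ts] := leP s t.
  by rewrite (le_trans (psi_var st)) // ler_wpM2l // lev_close.
rewrite -normcN opprB (le_trans (psi_var (ltW ts))) // ler_wpM2l //.
exact: lev_close.
Qed.

(** The value of [psi] at a point of the level set, when there is one. *)
Lemma level_constants : exists c : nat -> nat -> R[i],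
  forall l t, normc (psi t - c l (lev l t)) <= K * 2^-1 ^+ l.
Proof.
have ex (li : nat * nat) : exists a : R[i], forall t, lev li.1 t = li.2 ->
    normc (psi t - a) <= K * 2^-1 ^+ li.1.
  case: (pselect (exists s, lev li.1 s = li.2)) => [[s sE]|ns].
    by exists (psi s) => t tE; apply: psi_osc; rewrite sE tE.
  by exists 0 => t tE; case: ns; exists t.
have [c cP] := choice ex.
by exists (fun l i => c (l, i)) => l t; exact: (cP (l, lev l t)).
Qed.

Context (c : nat -> nat -> R[i]).
Hypothesis c_close : forall l t, normc (psi t - c l (lev l t)) <= K * 2^-1 ^+ l.

Lemma B_ge0 : 0 <= B. Proof. exact: le_trans (normc_ge0 _) (psi_B 0). Qed.

(** The difference between [psi (max x y)] and the function obtained from it by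
    freezing its value to a constant on each diagonal block of level [l]. *)
Definition err l (z : R * R) : R[i] :=
  \sum_(i < 2 ^ l) ((lev l z.1 == i)%:R * (lev l z.2 == i)%:R) *
     (psi (Num.max z.1 z.2) - c l i).

Lemma errE l x y : err l (x, y) =
  if lev l x == lev l y then psi (Num.max x y) - c l (lev l x) else 0.
Proof.
rewrite /err /= (bigD1 (Ordinal (lev_lt l x))) //= eqxx mul1r big1 => [|i ix].
  by rewrite addr0 eq_sym; case: ifP => _; rewrite ?mul1r ?mul0r.
have -> : (lev l x == i) = false by apply/negbTE; rewrite eq_sym.
by rewrite !mul0r.
Qed.

Lemma err_weight l : weight (err l) (K * 2^-1 ^+ l).
Proof.
split=> [|[x y]].
  apply: cmeasurable_sum => i; apply: cmeasurableM.
    have [mi _] := bounded_meas_indicator (@lev_convex l i).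
    by apply: cmeasurableM; [exact: cmeasurable_fst mi|exact: cmeasurable_snd mi].
  by apply: cmeasurableD; [exact: cmeasurable_max|exact: cmeasurable_cst].
rewrite errE; case: eqP => [e|_]; last first.
  by rewrite ComplexField.Normc.normc0 mulr_ge0 ?exprn_ge0 ?invr_ge0.
have [xy|xy] := leP x y; last exact: c_close.
by rewrite e; exact: c_close.
Qed.

Definition sibling (a : nat) := if odd a then a.-1 else a.+1.

Lemma half_eq a b : (a./2 == b./2) = (b == a) || (b == sibling a).
Proof.
rewrite /sibling; have := odd_double_half a; have := odd_double_half b.
move: (a./2) (b./2) => m n; rewrite -!mul2n.
by case: (odd a); case: (odd b) => /= <- <-; apply/idP/idP; lia.
Qed.

Definition diag_l l a x : R[i] := (lev l.+1 x == a)%:R * (c l.+1 a - c l a./2).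
Definition diag_r l a y : R[i] := (lev l.+1 y == a)%:R.
(** The variable [x] is in the block [a] and [y] in its sibling: since [v] is
    nondecreasing, [x] is the larger one exactly when [a] is odd. *)
Definition off_l l a x : R[i] :=
  (lev l.+1 x == a)%:R * (if odd a then psi x - c l a./2 else 1).
Definition off_r l a y : R[i] :=
  (lev l.+1 y == sibling a)%:R * (if odd a then 1 else psi y - c l a./2).

(** Halving the blocks: the two new diagonal blocks change their constants, and
    the two blocks off the diagonal are of rank one, since there the larger
    variable is known. *)
Lemma err_refine l z : err l z = err l.+1 z +
  \sum_(a < 2 ^ l.+1) (diag_l l a z.1 * diag_r l a z.2 +
                       off_l l a z.1 * off_r l a z.2).
Proof.
case: z => x y; rewrite !errE -(lev_half l x) -(lev_half l y).
rewrite (bigD1 (Ordinal (lev_lt l.+1 x))) //= [X in _ + (_ + X)]big1; last first.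
  move=> a ax; have xa : (lev l.+1 x == a) = false.
    by apply/negbTE; rewrite eq_sym.
  by rewrite /diag_l /off_l xa !mul0r addr0.
rewrite addr0 /diag_l /diag_r /off_l /off_r !eqxx !mul1r.
set X := lev l.+1 x; set Y := lev l.+1 y.
rewrite half_eq (eq_sym X Y); have [YX|YX] /= := eqVneq Y X.
  have -> : (Y == sibling X) = false.
    by rewrite YX /sibling; apply/negbTE; case: X {YX} => [|a] //; case: ifP => _ /=; lia.
  by rewrite mul0r mulr0 addr0 mulr1 addrA subrK.
rewrite mulr0 !add0r; have [YS|_] := eqVneq Y (sibling X); last by rewrite mul0r mulr0.
rewrite mul1r; have := YS; rewrite /sibling; case: ifP => oX YE.
  have yx : y < x.
    by apply: (@lev_gt l.+1); rewrite -/X -/Y YE; case: (X) oX.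
  by rewrite mulr1 max_l // ltW.
have xy : x < y by apply: (@lev_gt l.+1); rewrite -/X -/Y YE.
by rewrite mul1r max_r // ltW.
Qed.

Context (p : L2 R * L2 R) (kappa : R).
Hypothesis p1_le1 : l2nrm p.1 <= 1.
Hypothesis p2_le1 : l2nrm p.2 <= 1.
Hypothesis kappa_ge0 : 0 <= kappa.
Hypothesis p1_mass : forall l a,
  l2nrm (mulI (fun t => lev l t == a) p.1) ^+ 2 <= kappa * 2^-1 ^+ l.
Hypothesis p2_mass : forall l a,
  l2nrm (mulI (fun t => lev l t == a) p.2) ^+ 2 <= kappa * 2^-1 ^+ l.

Local Notation half := (2^-1 : R).

Lemma half_ge0 l : 0 <= half ^+ l. Proof. by rewrite exprn_ge0 ?invr_ge0. Qed.

Lemma normc_ind_mul l a (z : R -> R[i]) (beta : R) : 0 <= beta ->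
  (forall x, lev l x = a -> normc (z x) <= beta) ->
  forall x, normc ((lev l x == a)%:R * z x) <= beta * (lev l x == a)%:R.
Proof.
move=> b0 zb x; rewrite ComplexField.Normc.normcM normc_bool.
by case: eqP => [xa|_]; rewrite ?mul1r ?mulr1 ?zb // mul0r mulr0.
Qed.

Lemma bounded_meas_ind_mul l a (z : R -> R[i]) (beta : R) : 0 <= beta ->
  cmeasurable z -> (forall x, lev l x = a -> normc (z x) <= beta) ->
  bounded_meas (fun x => (lev l x == a)%:R * z x) beta.
Proof.
move=> b0 mz zb; split=> [|x].
  by apply: cmeasurableM => //; case: (bounded_meas_indicator (@lev_convex l a)).
rewrite (le_trans (normc_ind_mul b0 zb x)) //.
by case: eqP; rewrite ?mulr1 ?mulr0.
Qed.

Lemma nrm_ind_mul l a (z : R -> R[i]) (beta : R) f : 0 <= beta ->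
  cmeasurable z -> (forall x, lev l x = a -> normc (z x) <= beta) ->
  l2nrm (mulL2 (fun x => (lev l x == a)%:R * z x) f) <=
  beta * l2nrm (mulI (fun x => lev l x == a) f).
Proof.
move=> b0 mz zb; apply: (mulL2_supp _ (bounded_meas_ind_mul b0 mz zb)) => //.
  exact: lev_convex.
exact: normc_ind_mul.
Qed.

Lemma mass_product l a b :
  l2nrm (mulI (fun t => lev l t == a) p.1) *
  l2nrm (mulI (fun t => lev l t == b) p.2) <= kappa * half ^+ l.
Proof.
have := p1_mass l a; have := p2_mass l b.
set u := l2nrm _; set w := l2nrm _ => uk wk.
by have := sqr_ge0 (u - w); rewrite sqrrB; lra.
Qed.

Lemma psi_close l a t : lev l.+1 t = a ->
  normc (psi t - c l a./2) <= K * half ^+ l.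
Proof. by move=> <-; rewrite lev_half. Qed.

Lemma const_close l a t : lev l.+1 t = a ->
  normc (c l.+1 a - c l a./2) <= 2 * K * half ^+ l.
Proof.
move=> ta; have h1 := psi_close ta; have := c_close l.+1 t; rewrite ta => h2.
have -> : c l.+1 a - c l a./2 = (psi t - c l a./2) - (psi t - c l.+1 a).
  by ring.
rewrite (le_trans (le_normcD _ _)) // normcN.
have : K * half ^+ l.+1 <= K * half ^+ l.
  rewrite ler_wpM2l // exprS; have := half_ge0 l; lra.
move: h1 h2; lra.
Qed.

Definition off_bound (b : bool) l : R := if b then K * half ^+ l else 1.

Lemma off_bound_ge0 b l : 0 <= off_bound b l.
Proof. by case: b => //=; rewrite mulr_ge0 ?half_ge0. Qed.

Lemma normc1_le1 : normc (1 : R[i]) <= 1.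
Proof. by rewrite ComplexField.Normc.normc1. Qed.

Lemma off_l_close l a x : lev l.+1 x = a ->
  normc (if odd a then psi x - c l a./2 else 1) <= off_bound (odd a) l.
Proof.
move=> xa; have := psi_close xa; have := normc1_le1; rewrite /off_bound.
by case: (odd a).
Qed.

Lemma half_sibling a : (sibling a)./2 = a./2.
Proof. by apply/esym/eqP; rewrite half_eq eqxx orbT. Qed.

Lemma off_r_close l a y : lev l.+1 y = sibling a ->
  normc (if odd a then 1 else psi y - c l a./2) <= off_bound (~~ odd a) l.
Proof.
move=> ya; have := psi_close ya; have := normc1_le1.
by rewrite half_sibling /off_bound; case: (odd a).
Qed.

Lemma cmeasurable_psi_cst (z : R[i]) : cmeasurable (fun x => psi x - z).
Proof. by apply: cmeasurableD => //; exact: cmeasurable_cst. Qed.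

Lemma off_l_meas l a :
  cmeasurable (fun x => if odd a then psi x - c l a./2 else 1).
Proof. by case: (odd a); [exact: cmeasurable_psi_cst|exact: cmeasurable_cst]. Qed.

Lemma off_r_meas l a :
  cmeasurable (fun x => if odd a then 1 else psi x - c l a./2).
Proof. by case: (odd a); [exact: cmeasurable_cst|exact: cmeasurable_psi_cst]. Qed.

Lemma K2_ge0 l : 0 <= 2 * K * half ^+ l.
Proof. by rewrite !mulr_ge0 ?half_ge0. Qed.

Lemma diag_l_bounded l a : bounded_meas (diag_l l a) (2 * K * half ^+ l).
Proof.
apply: bounded_meas_ind_mul => [||x]; [exact: K2_ge0|exact: cmeasurable_cst|].
exact: const_close.
Qed.

Lemma diag_r_bounded l a : bounded_meas (diag_r l a) 1.
Proof. exact: bounded_meas_indicator (@lev_convex l.+1 a). Qed.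

Lemma off_l_bounded l a : bounded_meas (off_l l a) (off_bound (odd a) l).
Proof.
apply: bounded_meas_ind_mul => [||x]; [exact: off_bound_ge0|exact: off_l_meas|].
exact: off_l_close.
Qed.

Lemma off_r_bounded l a : bounded_meas (off_r l a) (off_bound (~~ odd a) l).
Proof.
apply: bounded_meas_ind_mul => [||y]; [exact: off_bound_ge0|exact: off_r_meas|].
exact: off_r_close.
Qed.

Definition diag_atom l a : L2 R * L2 R :=
  (mulL2 (diag_l l a) p.1, mulL2 (fun y => (diag_r l a y)^*) p.2).
Definition off_atom l a : L2 R * L2 R :=
  (mulL2 (off_l l a) p.1, mulL2 (fun y => (off_r l a y)^*) p.2).

Lemma nrm_conj_mul l a (z : R -> R[i]) (beta : R) f : 0 <= beta ->
  cmeasurable z -> (forall x, lev l x = a -> normc (z x) <= beta) ->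
  l2nrm (mulL2 (fun x => ((lev l x == a)%:R * z x)^*) f) <=
  beta * l2nrm (mulI (fun x => lev l x == a) f).
Proof.
move=> b0 mz zb; have := bounded_meas_conj (bounded_meas_ind_mul b0 mz zb).
move=> /mulL2_supp; apply => //; first exact: lev_convex.
by move=> x; rewrite normc_conj; exact: normc_ind_mul.
Qed.

Lemma diag_atom_le l a : l2nrm (diag_atom l a).1 * l2nrm (diag_atom l a).2 <=
  K * kappa * 4^-1 ^+ l.
Proof.
have h1 : l2nrm (diag_atom l a).1 <=
    2 * K * half ^+ l * l2nrm (mulI (fun t => lev l.+1 t == a) p.1).
  apply: nrm_ind_mul => [||x]; [exact: K2_ge0|exact: cmeasurable_cst|].
  exact: const_close.
have h2 : l2nrm (diag_atom l a).2 <=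
    1 * l2nrm (mulI (fun t => lev l.+1 t == a) p.2).
  have -> : (diag_atom l a).2 =
      mulL2 (fun y => ((lev l.+1 y == a)%:R * 1)^*) p.2.
    by congr mulL2; apply/funext => y; rewrite mulr1.
  apply: nrm_conj_mul => [//||x _]; first exact: cmeasurable_cst.
  exact: normc1_le1.
rewrite (le_trans (ler_pM _ _ h1 h2)) ?l2nrm_ge0 // mul1r -[leLHS]mulrA.
rewrite (le_trans (ler_wpM2l (K2_ge0 l) (mass_product l.+1 a a))) //.
have -> : (4^-1 : R) = half * half by field.
by rewrite exprMn exprS le_eqVlt; apply/orP; left; apply/eqP; field.
Qed.

(** Only one of the two factors carries the oscillation of [psi], whatever the
    parity of [a]. *)
Lemma off_atom_le l a : l2nrm (off_atom l a).1 * l2nrm (off_atom l a).2 <=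
  K * kappa * 4^-1 ^+ l.
Proof.
have h1 : l2nrm (off_atom l a).1 <= off_bound (odd a) l *
    l2nrm (mulI (fun t => lev l.+1 t == a) p.1).
  apply: nrm_ind_mul => [||x]; [exact: off_bound_ge0|exact: off_l_meas|].
  exact: off_l_close.
have h2 : l2nrm (off_atom l a).2 <= off_bound (~~ odd a) l *
    l2nrm (mulI (fun t => lev l.+1 t == sibling a) p.2).
  apply: nrm_conj_mul => [||y]; [exact: off_bound_ge0|exact: off_r_meas|].
  exact: off_r_close.
rewrite (le_trans (ler_pM _ _ h1 h2)) ?l2nrm_ge0 // mulrACA.
have -> : off_bound (odd a) l * off_bound (~~ odd a) l = K * half ^+ l.
  by rewrite /off_bound; case: (odd a); rewrite /= ?mulr1 ?mul1r.
have Kl : 0 <= K * half ^+ l by rewrite mulr_ge0 ?half_ge0.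
rewrite (le_trans (ler_wpM2l Kl (mass_product l.+1 a (sibling a)))) //.
have -> : (4^-1 : R) = half * half by field.
rewrite exprMn exprS.
have : 0 <= K * kappa * (half ^+ l * half ^+ l) by rewrite !mulr_ge0 ?half_ge0.
have -> : K * half ^+ l * (kappa * (half * half ^+ l)) =
  half * (K * kappa * (half ^+ l * half ^+ l)) by ring.
by move=> X0; rewrite ler_piMl // invf_le1 ?ler1n.
Qed.

Definition atoms l : seq (L2 R * L2 R) :=
  [seq diag_atom l a | a <- iota 0 (2 ^ l.+1)] ++
  [seq off_atom l a | a <- iota 0 (2 ^ l.+1)].

Lemma size_atoms l : size (atoms l) = (2 ^ l.+2)%N.
Proof. by rewrite size_cat !size_map size_iota addnn -mul2n -expnS. Qed.

Lemma nuc_atoms l : nuc l2ip (atoms l) <= 4 * (K * kappa) * half ^+ l.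
Proof.
rewrite nuc_cat /nuc !big_map.
have bnd (F : nat -> R) : (forall a, F a <= K * kappa * 4^-1 ^+ l) ->
    \sum_(a <- iota 0 (2 ^ l.+1)) F a <= 2 * (K * kappa) * half ^+ l.
  move=> hF; rewrite (le_trans (ler_sum _ (fun a _ => hF a))) //.
  rewrite big_const_seq count_predT size_iota iter_addr_0.
  rewrite -[_ *+ (2 ^ l.+1)]mulr_natl natrX exprS.
  have -> : (4^-1 : R) = half * half by field.
  rewrite exprMn le_eqVlt; apply/orP; left; apply/eqP.
  have e : 2 ^+ l * half ^+ l = 1 by rewrite -exprMn divff // expr1n.
  transitivity (2 * (K * kappa) * (2 ^+ l * half ^+ l) * half ^+ l).
    by ring.
  by rewrite e mulr1.
rewrite (le_trans (lerD (bnd _ (diag_atom_le l)) (bnd _ (off_atom_le l)))) //.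
by rewrite le_eqVlt; apply/orP; left; apply/eqP; ring.
Qed.

Lemma wop_refine l f :
  wop (err l) p f = wop (err l.+1) p f + opl (atoms l) f.
Proof.
pose w a z := diag_l l a z.1 * diag_r l a z.2 + off_l l a z.1 * off_r l a z.2.
pose Bw a := 2 * K * half ^+ l * 1 + off_bound (odd a) l * off_bound (~~ odd a) l.
have wB a : weight (w a) (Bw a).
  apply: weightD; apply: weight_prod.
  - exact: diag_l_bounded.
  - exact: diag_r_bounded.
  - exact: off_l_bounded.
  - exact: off_r_bounded.
have -> : err l = fun z => err l.+1 z + \sum_(a <- iota 0 (2 ^ l.+1)) w a z.
  apply/funext => z; rewrite err_refine; congr (_ + _).
  by rewrite big_iota0.
rewrite (wopD _ _ (err_weight l.+1) (weight_sum _ wB)); congr (_ + _).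
rewrite (wop_sum _ _ _ wB) finop_cat /finop !big_map -big_split.
apply: eq_bigr => a _ /=.
have d1 := weight_prod (diag_l_bounded l a) (diag_r_bounded l a).
have d2 := weight_prod (off_l_bounded l a) (off_r_bounded l a).
rewrite (wopD _ _ d1 d2) (wop_prod _ _ (diag_l_bounded l a) (diag_r_bounded l a)).
rewrite (wop_prod _ _ (off_l_bounded l a) (off_r_bounded l a)).
by rewrite /finop !big_seq1.
Qed.

Lemma lev0 t : lev 0 t = 0%N.
Proof. by apply/eqP; rewrite -leqn0 -ltnS -[X in (_ < X)%N](expn0 2) lev_lt. Qed.

(** The term of index zero is the constant that approximates [psi] on the whole
    line, the only block of level zero. *)
Definition pieces l : seq (L2 R * L2 R) :=
  if l is l'.+1 then atoms l' else [:: (c 0 0 *: p.1, p.2)].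

Lemma wop_pieces n f : wop (fun z => psi (Num.max z.1 z.2)) p f =
  \sum_(l < n.+1) opl (pieces l) f + wop (err n) p f.
Proof.
elim: n => [|n ->]; last first.
  by rewrite [in RHS]big_ord_recr /= wop_refine addrA addrAC.
rewrite big_ord_recl big_ord0 addr0 /= /finop big_seq1 /=.
have b1 : bounded_meas (fun _ : R => c 0 0) (normc (c 0 0)).
  by split => //; exact: cmeasurable_cst.
have b2 : bounded_meas (fun _ : R => 1 : R[i]) 1.
  by split => [|_]; [exact: cmeasurable_cst|rewrite ComplexField.Normc.normc1].
have -> : l2ip f p.2 *: (c 0 0 *: p.1) =
    wop (fun z => c 0 0 * 1) p f.
  rewrite (wop_prod p f b1 b2) /finop big_seq1 /=.
  congr (l2ip _ _ *: _); apply: L2_ext => x.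
    by rewrite (mulL2E _ _ (bounded_meas_conj b2)) conjc1 mul1r.
  by rewrite (mulL2E _ _ b1).
have -> : (fun z => psi (Num.max z.1 z.2)) = fun z => c 0 0 * 1 + err 0 z.
  by apply/funext => -[x y]; rewrite errE !lev0 eqxx mulr1 addrC subrK.
exact: wopD (weight_prod b1 b2) (err_weight 0).
Qed.

Lemma size_pieces l : (size (pieces l) <= 4 * 2 ^ l)%N.
Proof.
case: l => [|l] //=; rewrite size_atoms -[4%N]/(2 ^ 2)%N -expnD.
by rewrite leq_exp2l // !addSn add0n.
Qed.

Lemma c00_le : normc (c 0 0) <= B + K.
Proof.
have := c_close 0 0; rewrite lev0 expr0 mulr1 => h.
have -> : c 0 0 = psi 0 - (psi 0 - c 0 0) by ring.
by rewrite (le_trans (le_normcD _ _)) // normcN lerD.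
Qed.

Lemma nuc_pieces l :
  nuc l2ip (pieces l) <= (B + K + 8 * (K * kappa)) * half ^+ l.
Proof.
have Kk : 0 <= K * kappa by rewrite mulr_ge0.
have BK : 0 <= B + K by rewrite addr_ge0 ?B_ge0.
case: l => [|l] /=.
  rewrite /nuc big_seq1 /= expr0 mulr1 (nrmZ nrmH).
  have := c00_le; have := normc_ge0 (c 0 0).
  have := l2nrm_ge0 p.1; have := l2nrm_ge0 p.2; move: p1_le1 p2_le1.
  set u := normc _; set a := l2nrm _; set b := l2nrm _ => a1 b1 b0 a0 u0 uB.
  have ab : a * b <= 1 by nra.
  have ab0 : 0 <= a * b by rewrite mulr_ge0.
  rewrite -mulrA; nra.
rewrite (le_trans (nuc_atoms l)) // exprS.
have := half_ge0 l; have : 0 <= (B + K) * half ^+ l by rewrite mulr_ge0 ?half_ge0.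
by lra.
Qed.

Lemma finop_flatten (s : seq nat) (E : nat -> seq (L2 R * L2 R)) f :
  opl (flatten [seq E l | l <- s]) f = \sum_(l <- s) opl (E l) f.
Proof. by rewrite /finop big_flatten big_map. Qed.

Lemma nuc_flatten (s : seq nat) (E : nat -> seq (L2 R * L2 R)) :
  nuc l2ip (flatten [seq E l | l <- s]) = \sum_(l <- s) nuc l2ip (E l).
Proof. by rewrite /nuc big_flatten big_map. Qed.

Lemma sum_pow2 n : (\sum_(l < n) 2 ^ l)%N = (2 ^ n).-1.
Proof.
elim: n => [|n IHn]; first by rewrite big_ord0.
rewrite big_ord_recr /= IHn expnS; have := expn_gt0 2 n; lia.
Qed.

(** The levels below the first [n0] such that [x <= 2 ^+ n0] have at most [8 * x]
    pieces; the nuclear norms of the following ones form a geometric series. *)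
Lemma wop_splits (x e : R) : 0 < x -> 0 < e ->
  splits (wop (fun z => psi (Num.max z.1 z.2)) p) (8 * x)
    (2 * (B + K + 8 * (K * kappa)) / x) e.
Proof.
move=> x0 e0.
have ex (y : R) : exists n, y <= 2 ^+ n.
  exists (Num.truncn y).+1; apply: ltW; apply: (lt_trans (truncnS_gt y)).
  by rewrite -natrX ltr_nat ltn_expl.
case: (ex_minnP (ex x)) => n0 xn0 n0min.
have [m mP] := ex (K / e).
pose n := (n0 + m)%N.
exists (flatten [seq pieces l | l <- iota 0 n0]).
exists (flatten [seq pieces l | l <- iota n0 m.+1]); split.
- have : (size (flatten [seq pieces l | l <- iota 0 n0]) <= 4 * (2 ^ n0).-1)%N.
    rewrite size_flatten /shape -map_comp sumnE big_map.
    rewrite -sum_pow2 big_distrr /= big_iota0.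
    by apply: leq_sum => l _; exact: size_pieces.
  rewrite -(ler_nat R) => /le_trans; apply.
  case: n0 n0min {xn0 n} => [|n1] n0min.
    by rewrite muln0 mulr_ge0 // ltW.
  have n1x : 2 ^+ n1 < x.
    by rewrite ltNge; apply/negP => /n0min; rewrite ltnn.
  rewrite natrM (le_trans (y := 4 * 2 ^+ n1.+1)) //.
    by rewrite ler_pM2l // -natrX ler_nat leq_pred.
  by rewrite exprS; move: n1x; lra.
- set C := B + K + _.
  have C0 : 0 <= C by rewrite !addr_ge0 ?B_ge0 ?mulr_ge0.
  rewrite nuc_flatten.
  apply: (@le_trans _ _ (\sum_(l <- iota n0 m.+1) C * half ^+ l)).
    by apply: ler_sum => l _; exact: nuc_pieces.
  have -> : \sum_(l <- iota n0 m.+1) C * half ^+ l =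
      C * half ^+ n0 * \sum_(j < m.+1) half ^+ j.
    rewrite -[n0 in iota n0]addn0 iotaDl big_map mulr_sumr.
    rewrite big_iota0.
    by apply: eq_bigr => j _; rewrite exprD mulrA.
  rewrite (le_trans (ler_wpM2l _ (geometric_half_le m.+1))) //.
    by rewrite mulr_ge0 ?half_ge0.
  rewrite mulrC mulrA ler_wpM2l ?mulr_ge0 //.
  by rewrite exprVn lef_pV2 ?posrE // exprn_gt0.
- have Kn : K * half ^+ n <= e.
    rewrite exprVn ler_pdivrMr ?exprn_gt0 // mulrC -ler_pdivrMr //.
    rewrite (le_trans mP) //.
    by rewrite ler_eXn2l // ?ltr1n // leq_addl.
  have -> : (fun h => wop (fun z => psi (Num.max z.1 z.2)) p h -
      opl (flatten [seq pieces l | l <- iota 0 n0]) h -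
      opl (flatten [seq pieces l | l <- iota n0 m.+1]) h) = wop (err n) p.
    apply/funext => h; rewrite !finop_flatten (wop_pieces n).
    rewrite -addrA -opprD -big_cat -[X in iota X m.+1]add0n -iotaD.
    rewrite big_iota0 addnS.
    by rewrite addrC addrA addNr add0r.
  move=> h; rewrite (le_trans (wop_bounded p (err_weight n) h)) //.
  rewrite ler_wpM2r ?l2nrm_ge0 // (le_trans _ Kn) //.
  rewrite ler_piMr ?mulr_ge0 ?half_ge0 // mulr_ile1 ?l2nrm_ge0 //.
Qed.

End Levels.

(** * Functions of bounded variation *)

Section Variation.
Context {R : realType}.

Definition chain_sum (psi : R -> R[i]) (s : seq R) : R :=
  \sum_(i < (size s).-1) normc (psi s`_i.+1 - psi s`_i).

Lemma chain_sum_rcons (psi : R -> R[i]) r s t :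
  chain_sum psi (rcons (rcons r s) t) =
  chain_sum psi (rcons r s) + normc (psi t - psi s).
Proof.
rewrite /chain_sum !size_rcons /= big_ord_recr /=; congr (_ + normc (_ - _)).
- apply: eq_bigr => i _; rewrite [(rcons (rcons r s) t)`_i.+1]nth_rcons.
  rewrite [(rcons (rcons r s) t)`_i]nth_rcons size_rcons.
  by rewrite !ltnS (ltn_ord i) ltnW ?ltn_ord // ltnS.
- by rewrite nth_rcons size_rcons ltnn eqxx.
- by rewrite nth_rcons size_rcons ltnSn nth_rcons ltnn eqxx.
Qed.

Lemma sorted_rcons2 (r : seq R) s t : sorted <%R (rcons r s) -> s < t ->
  sorted <%R (rcons (rcons r s) t).
Proof.
case: r => [|a r] /= rs st; first by rewrite st.
by rewrite rcons_path rs last_rcons.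
Qed.

(** [V t] is the supremum of the chain sums over the chains that end at [t].  A
    chain that ends at [s] extends to [t] at the gain of one term. *)
Lemma variation_function (psi : R -> R[i]) : bounded_variation_line psi ->
  exists (V : R -> R) (K : R), [/\ 0 <= K, forall t, 0 <= V t <= K &
    forall s t, s <= t -> normc (psi t - psi s) <= V t - V s].
Proof.
move=> [K bv].
pose E t := [set chain_sum psi (rcons r t) | r in [set r | sorted <%R (rcons r t)]].
have E0 t : E t 0.
  by exists [::] => //; rewrite /chain_sum /= big_ord0.
have EK t : ubound (E t) K by move=> _ [r /= sr <-]; exact: bv.
have supE t : has_sup (E t) by split; [exists 0|exists K].
have K0 : 0 <= K by exact: (EK 0).
exists (fun t => sup (E t)), K; split => // [t|s t].
  apply/andP; split; first by apply: ub_le_sup => //; exists K.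
  by apply: ge_sup => //; exists 0.
rewrite le_eqVlt => /predU1P[->|st].
  by rewrite !subrr ComplexField.Normc.normc0.
rewrite lerBrDr -lerBrDl; apply: ge_sup; first by exists 0.
move=> _ [r /= sr <-]; rewrite lerBrDl addrC -chain_sum_rcons.
apply: ub_le_sup; first by exists K.
by exists (rcons r s) => //=; exact: sorted_rcons2.
Qed.

(** The real and imaginary parts of [psi] become nondecreasing when [V] is added
    to them. *)
Lemma variation_measurable (psi : R -> R[i]) (V : R -> R) :
  (forall s t, s <= t -> normc (psi t - psi s) <= V t - V s) ->
  cmeasurable psi.
Proof.
move=> var.
have Vnd : nondecreasing_fun V.
  by move=> s t st; rewrite -subr_ge0 (le_trans (normc_ge0 _) (var s t st)).
have part (part : R[i] -> R) : (forall z w, part (z - w) = part z - part w) ->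
    (forall z, `|part z| <= normc z) ->
    measurable_fun [set: R] (fun x => part (psi x)).
  move=> partB part_le.
  have -> : (fun x => part (psi x)) = fun x => (part (psi x) + V x) - V x.
    by apply/funext => x; rewrite addrK.
  apply: measurable_funB; apply: nondecreasing_measurable => // s t st.
  rewrite -subr_ge0 opprD addrACA -partB.
  have := var s t st; have := part_le (psi t - psi s).
  by rewrite ler_norml => /andP[h _]; move: h; lra.
split; apply: part; [|exact: le_Re_normc| |exact: le_Im_normc].
  by move=> z w; rewrite ReD; case: w.
by move=> z w; rewrite ImD; case: w.
Qed.

End Variation.

(** * Passing to the limit in operator norm *)

Section Transfer.
Context {R : realType} (v : R -> R).
Hypothesis v_nd : forall s t, s <= t -> v s <= v t.
Hypothesis v_ge0 : forall t, 0 <= v t.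
Hypothesis v_lt1 : forall t, v t < 1.
Local Notation opl := (@finop R (L2 R) l2ip).
Local Notation nrmH := (l2ip_semi_inner (R := R)).
Local Notation lev := (lev v).
Context (psi : R -> R[i]) (K B : R).
Hypothesis psi_meas : cmeasurable psi.
Hypothesis psi_B : forall t, normc (psi t) <= B.
Hypothesis K_ge0 : 0 <= K.
Context (c : nat -> nat -> R[i]).
Hypothesis c_close : forall l t, normc (psi t - c l (lev l t)) <= K * 2^-1 ^+ l.

Definition below n i : pred R := fun t => (lev n t < i)%N.

Lemma below_convex n i : convexp (below n i).
Proof. exact: lev_lt_convex. Qed.

(** The weight of a compression to a half-line [below n i].  Lower half-lines are
    the right sets here: such a set contains [max x y] exactly when it contains
    both [x] and [y]. *)
Definition mask n i (z : R * R) : R[i] :=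
  (below n i z.1)%:R * (below n i z.2)%:R.

Lemma maskE n i x y : mask n i (x, y) = (below n i (Num.max x y))%:R.
Proof.
rewrite /mask /below -natrM mulnb /=; congr (nat_of_bool _)%:R.
by have [xy|xy] := leP x y; apply/andP/idP => [[]|h] //; split => //;
  apply: leq_ltn_trans h; apply: lev_nd => //; exact: ltW.
Qed.

Lemma mask_weight n i : weight (mask n i) (1 * 1).
Proof.
have bi := bounded_meas_indicator (@below_convex n i); exact: (weight_prod bi bi).
Qed.

Definition step n (z : R * R) : R[i] :=
  \sum_(i < 2 ^ n) c n i * (mask n i.+1 z + -1 * mask n i z).

Lemma stepE n x y : step n (x, y) = c n (lev n (Num.max x y)).
Proof.
set m := Num.max x y; rewrite /step.
rewrite (bigD1 (Ordinal (lev_lt v_ge0 v_lt1 n m))) //= big1 => [|i im].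
  by rewrite !maskE /below -/m ltnSn ltnn mulr0 !addr0 mulr1.
have {}im : (i != lev n m :> nat) by [].
rewrite !maskE /below -/m ltnS leq_eqVlt eq_sym (negbTE im) /=.
by rewrite mulN1r subrr mulr0.
Qed.

Lemma step_close n x y :
  normc (step n (x, y) - psi (Num.max x y)) <= K * 2^-1 ^+ n.
Proof. by rewrite stepE -normcN opprB. Qed.

Lemma step_summand_weight n (i : nat) :
  weight (fun z => c n i * (mask n i.+1 z + -1 * mask n i z))
    (normc (c n i) * (1 * 1 + normc (-1) * (1 * 1))).
Proof.
apply: weightZ; apply: weightD; first exact: mask_weight.
exact/weightZ/mask_weight.
Qed.

Lemma step_weight n : weight (step n) (B + K).
Proof.
split=> [|[x y]].
  apply: cmeasurable_sum => i; by case: (step_summand_weight n i).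
have -> : step n (x, y) = psi (Num.max x y) +
    (step n (x, y) - psi (Num.max x y)) by ring.
rewrite (le_trans (le_normcD _ _)) // lerD // (le_trans (step_close _ _ _)) //.
by rewrite ler_piMr // exprn_ile1 ?invr_ge0 // invf_le1 // ler1n.
Qed.

Definition compress n i (A : L2 R -> L2 R) f : L2 R :=
  mulI (below n i) (A (mulI (below n i) f)).

Definition step_op n (A : L2 R -> L2 R) f : L2 R :=
  \sum_(i < 2 ^ n) c n i *: (compress n i.+1 A f + -1 *: compress n i A f).

Lemma compress_wop n i l f :
  compress n i (opl l) f = \sum_(p <- l) wop (mask n i) p f.
Proof.
apply: L2_ext => x; rewrite mulIE; last exact: below_convex.
rewrite !L2sumE mulr_sumr; apply: eq_bigr => p _.
rewrite L2scaleE (wopE _ _ (mask_weight n i)) /rwop /mask /=.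
rewrite mulrA mulrC; congr (_ * _); rewrite /l2ip -cintegralZ; last first.
  exact: cintegrable_ip.
congr cintegral; apply/funext => y; rewrite mulIE; last exact: below_convex.
by rewrite !mulrA.
Qed.

Lemma step_op_wop n l f :
  step_op n (opl l) f = \sum_(p <- l) wop (step n) p f.
Proof.
transitivity (\sum_(p <- l) \sum_(i < 2 ^ n)
    wop (fun z => c n i * (mask n i.+1 z + -1 * mask n i z)) p f).
  rewrite exchange_big; apply: eq_bigr => i _ /=.
  rewrite !compress_wop !scaler_sumr -big_split scaler_sumr.
  apply: eq_bigr => p _ /=.
  have w1 := mask_weight n i.+1; have w2 := mask_weight n i.
  by rewrite (wopZ _ _ _ (weightD w1 (weightZ (-1) w2)))
    (wopD _ _ w1 (weightZ (-1) w2)) (wopZ _ _ _ w2).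
apply: eq_bigr => p _; rewrite -big_enum /=.
rewrite -(wop_sum _ _ _ (fun i : 'I_(2 ^ n) => step_summand_weight n i)).
by congr (wop _ p f); apply/funext => z; rewrite big_enum.
Qed.

Lemma nrm_step_op_finop n l f :
  l2nrm (step_op n (opl l) f) <= (B + K) * nuc l2ip l * l2nrm f.
Proof.
rewrite step_op_wop (le_trans (nrm_sum nrmH _ _)) // mulr_sumr mulr_suml.
by apply: ler_sum => p _; exact: (wop_bounded p (step_weight n)).
Qed.

Lemma step_op_dist n A1 A2 f (rho : R) : 0 <= rho ->
  bounded_by (fun h => A1 h - A2 h) rho ->
  l2nrm (step_op n A1 f - step_op n A2 f) <=
  (\sum_(i < 2 ^ n) normc (c n i)) * 2 * rho * l2nrm f.
Proof.
move=> rho0 A12.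
have cd i : l2nrm (compress n i A1 f - compress n i A2 f) <= rho * l2nrm f.
  have bc := @below_convex n i.
  have -> : compress n i A1 f - compress n i A2 f =
      mulI (below n i) (A1 (mulI (below n i) f) - A2 (mulI (below n i) f)).
    by apply: L2_ext => x; rewrite L2subE !mulIE // L2subE mulrBr.
  rewrite (le_trans (nrm_mulI _ bc)) // (le_trans (A12 _)) //.
  by rewrite ler_wpM2l // nrm_mulI.
rewrite -sumrB (le_trans (nrm_sum nrmH _ _)) // !mulr_suml.
apply: ler_sum => i _; rewrite -scalerBr (nrmZ nrmH) -!mulrA.
rewrite ler_wpM2l ?normc_ge0 //.
have -> : compress n i.+1 A1 f + -1 *: compress n i A1 f -
    (compress n i.+1 A2 f + -1 *: compress n i A2 f) =
    (compress n i.+1 A1 f - compress n i.+1 A2 f) +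
    -1 *: (compress n i A1 f - compress n i A2 f).
  by rewrite scalerBr opprD addrACA.
rewrite (le_trans (nrmD nrmH _ _)) // (nrmZ nrmH) normcN.
rewrite ComplexField.Normc.normc1 mul1r mulr_natl mulr2n.
by rewrite lerD.
Qed.

Lemma step_op_kernel n (k : R * R -> R[i]) A (f : L2 R) (x : R) : cmeasurable k ->
  represents (integral_operator k) A ->
  cintegrable (fun y => k (x, y) * f y) ->
  step_op n A f x = cintegral (fun y => step n (x, y) * (k (x, y) * f y)).
Proof.
move=> mk kA ikf.
have iw w Bw (wB : weight w Bw) := cintegrable_weight_mul x wB ikf.
have ce i : compress n i A f x =
    cintegral (fun y => mask n i (x, y) * (k (x, y) * f y)).
  rewrite mulIE; last exact: below_convex.
  rewrite -kA /integral_operator; rewrite /mask /=.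
  have i1 : cintegrable (fun y => (below n i y)%:R * (k (x, y) * f y)).
    have [mi _] := bounded_meas_indicator (@below_convex n i).
    apply: (@le_cintegrable _ _ (fun y => normc (k (x, y) * f y))).
    - by apply: cmeasurableM => //; exact: cintegrable_meas.
    - exact: integrable_normc.
    - move=> y; rewrite ComplexField.Normc.normcM normc_bool.
      by case: (below n i y); rewrite ?mul1r // mul0r normc_ge0.
  have -> : (fun y => k (x, y) * mulI (below n i) f y) =
      fun y => (below n i y)%:R * (k (x, y) * f y).
    apply/funext => y; rewrite mulIE; last exact: below_convex.
    by rewrite mulrCA.
  rewrite -cintegralZ //; congr cintegral; apply/funext => y.
  by rewrite mulrA.
rewrite L2sumE.
under [in RHS]eq_fun do rewrite mulr_suml.
rewrite (cintegral_sum _ (fun i : 'I_(2 ^ n) => iw _ _ (step_summand_weight n i))).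
apply: eq_bigr => i _; rewrite L2scaleE L2addE L2scaleE !ce.
have i1 := iw _ _ (mask_weight n i.+1); have i2 := iw _ _ (mask_weight n i).
rewrite -(cintegralZ (-1)) // -cintegralD //; last exact: cintegrableZ.
rewrite -cintegralZ; last by apply: cintegrableD => //; exact: cintegrableZ.
by congr cintegral; apply/funext => y; ring.
Qed.

(** When [psi] is a step function, the multiplied operator is a combination of
    compressions of the original one to half-lines, so that convergence in
    operator norm suffices to pass to the limit, without any information on the
    kernels.  The bound obtained depends on the supremum of the step function
    only, and a general [psi] is a uniform limit of step functions. *)
Lemma transfer (k : R * R -> R[i]) A (tau : R) : kernel_function k ->
  represents (integral_operator k) A -> 0 <= tau ->
  (forall rho, 0 < rho -> exists l, nuc l2ip l <= tau /\
     bounded_by (fun h => A h - opl l h) rho) ->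
  exists A',
    represents (integral_operator (fun z => psi (Num.max z.1 z.2) * k z)) A' /\
    bounded_by A' ((B + K) * tau).
Proof.
move=> [mk kint] kA tau0 approx.
have BK : 0 <= B + K by rewrite addr_ge0 // (le_trans (normc_ge0 _) (psi_B 0)).
have stepA n f : l2nrm (step_op n A f) <= (B + K) * tau * l2nrm f.
  pose S := (\sum_(i < 2 ^ n) normc (c n i)) * 2.
  have S0 : 0 <= S by rewrite mulr_ge0 // sumr_ge0 // => i _; exact: normc_ge0.
  apply/ler_addgt0Pr => e e0.
  pose rho := e / (S * l2nrm f + 1).
  have Sf : 0 <= S * l2nrm f by rewrite mulr_ge0 // l2nrm_ge0.
  have D0 : 0 < S * l2nrm f + 1 by lra.
  have rho0 : 0 < rho by rewrite divr_gt0.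
  have [l [nl lA]] := approx rho rho0.
  rewrite -[X in l2nrm X](subrK (step_op n (opl l) f)).
  rewrite (le_trans (nrmD nrmH _ _)) // addrC lerD //.
    rewrite (le_trans (nrm_step_op_finop _ _ _)) // ler_wpM2r ?l2nrm_ge0 //.
    by rewrite ler_wpM2l.
  rewrite (le_trans (step_op_dist _ _ (ltW rho0) lA)) // -/S.
  rewrite mulrAC /rho mulrA ler_pdivrMr // mulrC ler_wpM2l ?(ltW e0) //.
  by rewrite lerDl.
pose w z := psi (Num.max z.1 z.2).
have mw : cmeasurable w by exact: cmeasurable_max.
have key (f : L2 R) : exists g : L2 R,
    L2fun g = integral_operator (fun z => w z * k z) f /\
    l2nrm g <= (B + K) * tau * l2nrm f.
  apply: (@fatou_L2 _ (fun n => step_op n A f)) => //.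
  - by rewrite !mulr_ge0 // l2nrm_ge0.
  - apply: (cmeasurable_cintegral (K := fun z => w z * k z * f z.2)).
    apply: cmeasurableM; first exact: cmeasurableM.
    exact/cmeasurable_snd/inL2_meas/L2_inL2.
  apply: aeS (kint f (L2_inL2 f)) => x ikf.
  pose I := \int[lebesgue_measure]_y normc (k (x, y) * f y).
  have I0 : 0 <= I by apply: Rintegral_ge0 => y _; exact: normc_ge0.
  apply: (@cvg_dist_squeeze _ _ (fun n => K * I * 2^-1 ^+ n)); last first.
    rewrite -[X in _ --> X](mulr0 (K * I)); apply: cvgMr.
    by apply: cvg_expr; rewrite ger0_norm ?invr_ge0 // invf_lt1 // ltr1n.
  move=> n; rewrite subr0 ger0_norm ?normc_ge0 //.
  rewrite (step_op_kernel _ mk kA ikf) /integral_operator.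
  have iw u Bu (uB : weight u Bu) := cintegrable_weight_mul x uB ikf.
  have wB : weight w B by split => // z; exact: psi_B.
  have dw : weight (fun z => step n z + -1 * w z) (K * 2^-1 ^+ n).
    split=> [|[x' y']]; last by rewrite mulN1r; exact: step_close.
    apply: cmeasurableD; first by case: (step_weight n).
    by apply: cmeasurableM => //; exact: cmeasurable_cst.
  have -> : cintegral (fun y => step n (x, y) * (k (x, y) * f y)) -
      cintegral (fun y => w (x, y) * k (x, y) * f y) =
      cintegral (fun y => (step n (x, y) + -1 * w (x, y)) * (k (x, y) * f y)).
    rewrite -[- cintegral _]mulN1r.
    have -> : (fun y => w (x, y) * k (x, y) * f y) =
      fun y => w (x, y) * (k (x, y) * f y) by apply/funext => y; rewrite mulrA.
    rewrite -(cintegralZ (-1)); last exact: iw wB.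
    rewrite -cintegralD; [|exact: iw (step_weight n)|exact/cintegrableZ/(iw _ _ wB)].
    by congr cintegral; apply/funext => y; ring.
  rewrite (le_trans (normc_cintegral (iw _ _ dw))) //.
  rewrite mulrAC -RintegralZl //; last exact: integrable_normc.
  apply: le_Rintegral => //.
  - exact/integrable_normc/(iw _ _ dw).
  - exact/integrableZ_EFin/integrable_normc.
  move=> y _; rewrite ComplexField.Normc.normcM ler_wpM2r ?normc_ge0 //.
  by case: dw.
have [A' A'P] := choice key.
by exists A'; split => [f|f]; have [] := A'P f.
Qed.

End Transfer.

(** * Stability of splittings *)

Section SplitsAlgebra.
Context {R : realType}.
Local Notation opl := (@finop R (L2 R) l2ip).
Local Notation nrmH := (l2ip_semi_inner (R := R)).
Implicit Types W : L2 R -> L2 R.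

Lemma splits_le W r nu e r' nu' e' : r <= r' -> nu <= nu' -> e <= e' ->
  splits W r nu e -> splits W r' nu' e'.
Proof.
move=> rr nn ee [l1 [l2 [h1 h2 h3]]]; exists l1, l2; split.
- exact: le_trans rr.
- exact: le_trans nn.
- by move=> f; rewrite (le_trans (h3 f)) // ler_wpM2r ?l2nrm_ge0.
Qed.

Lemma splits0 : splits (fun _ : L2 R => 0) 0 0 0.
Proof.
exists [::], [::]; split => //; first by rewrite /nuc big_nil.
by move=> f; rewrite !finop_nil !subr0 mul0r (nrm0 nrmH).
Qed.

Lemma splitsD W1 W2 r1 r2 nu1 nu2 e1 e2 : splits W1 r1 nu1 e1 ->
  splits W2 r2 nu2 e2 ->
  splits (fun f => W1 f + W2 f) (r1 + r2) (nu1 + nu2) (e1 + e2).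
Proof.
move=> [l1 [m1 [s1 n1 b1]]] [l2 [m2 [s2 n2 b2]]].
exists (l1 ++ l2), (m1 ++ m2); split.
- by rewrite size_cat natrD lerD.
- by rewrite nuc_cat lerD.
- move=> f; rewrite !finop_cat mulrDl.
  have -> : W1 f + W2 f - (opl l1 f + opl l2 f) - (opl m1 f + opl m2 f) =
      (W1 f - opl l1 f - opl m1 f) + (W2 f - opl l2 f - opl m2 f).
    by rewrite (opprD (opl l1 f)) (addrACA (W1 f)) (opprD (opl m1 f))
      (addrACA (W1 f - opl l1 f)).
  by rewrite (le_trans (nrmD nrmH _ _)) // lerD.
Qed.

Lemma splits_sum (I : eqType) (s : seq I) (W : I -> L2 R -> L2 R)
    (r nu e : I -> R) :
  (forall i, i \in s -> splits (W i) (r i) (nu i) (e i)) ->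
  splits (fun f => \sum_(i <- s) W i f)
    (\sum_(i <- s) r i) (\sum_(i <- s) nu i) (\sum_(i <- s) e i).
Proof.
elim: s => [_|i s IHs hs].
  rewrite !big_nil; have -> : (fun f => \sum_(i <- [::]) W i f) = (fun _ : L2 R => 0).
    by apply/funext => f; rewrite big_nil.
  exact: splits0.
rewrite !big_cons; have -> : (fun f => \sum_(j <- i :: s) W j f) =
    fun f => W i f + \sum_(j <- s) W j f.
  by apply/funext => f; rewrite big_cons.
apply: splitsD; first by apply: hs; rewrite mem_head.
by apply: IHs => j js; apply: hs; rewrite inE js orbT.
Qed.

Lemma splits_perturb W W' r nu e d : bounded_by (fun f => W f - W' f) d ->
  splits W' r nu e -> splits W r nu (d + e).
Proof.
move=> WW' [l1 [l2 [h1 h2 h3]]]; exists l1, l2; split => // f.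
have -> : W f - opl l1 f - opl l2 f =
    (W f - W' f) + (W' f - opl l1 f - opl l2 f) by rewrite !addrA subrK.
by rewrite mulrDl (le_trans (nrmD nrmH _ _)) // lerD.
Qed.

Lemma splitsZ (a : R) W r nu e : 0 <= a -> splits W r nu e ->
  splits (fun f => a%:C *: W f) r (a * nu) (a * e).
Proof.
move=> a0 [l1 [l2 [h1 h2 h3]]].
pose sc (l : seq (L2 R * L2 R)) := [seq (a%:C *: p.1, p.2) | p <- l].
have scE l f : opl (sc l) f = a%:C *: opl l f.
  rewrite /finop big_map scaler_sumr; apply: eq_bigr => p _ /=.
  by rewrite !scalerA mulrC.
exists (sc l1), (sc l2); split.
- by rewrite size_map.
- rewrite /nuc big_map (le_trans _ (ler_wpM2l a0 h2)) // mulr_sumr.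
  apply: ler_sum => p _ /=.
  by rewrite (nrmZ nrmH) normc_real ger0_norm // mulrA.
- move=> f; rewrite !scE -!scalerBr (nrmZ nrmH) normc_real ger0_norm //.
  by rewrite -mulrA ler_wpM2l.
Qed.

(** The nuclear part is itself approximated with rank [2 * N]. *)
Lemma splits_singular U (A : L2 R -> L2 R) (r nu e : R) N n : represents U A -> splits A r nu e ->
  0 <= e -> 0 <= nu -> r + (N.*2)%:R <= n%:R ->
  (singular_number n U <= (e + nu / N.+1%:R)%:E)%E.
Proof.
move=> UA [l1 [l2 [h1 h2 h3]]] e0 nu0 rn.
have [l' [sl' l'P]] := nuclear_rank nrmH l2 N.
apply: (singular_number_le (l := l1 ++ l') UA).
- by rewrite addr_ge0 // divr_ge0.
- rewrite size_cat -(ler_nat R) natrD (le_trans _ rn) // lerD //.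
  by rewrite ler_nat.
- move=> f; rewrite finop_cat.
  have -> : A f - (opl l1 f + opl l' f) =
      (A f - opl l1 f - opl l2 f) + (opl l2 f - opl l' f).
    by rewrite opprD !addrA subrK.
  rewrite mulrDl (le_trans (nrmD nrmH _ _)) // lerD //.
  rewrite (le_trans (l'P f)) // ler_wpM2r ?l2nrm_ge0 //.
  by rewrite ler_wpM2r ?invr_ge0.
Qed.

End SplitsAlgebra.

(** * Kernels *)

Section Kernels.
Context {R : realType}.
Local Notation opl := (@finop R (L2 R) l2ip).
Local Notation nrmH := (l2ip_semi_inner (R := R)).
Implicit Types (k w : R * R -> R[i]) (f g : L2 R).

Lemma kernel_functionM w (B : R) k : weight w B -> kernel_function k ->
  kernel_function (fun z => w z * k z).
Proof.
move=> [mw wB] [mk kint]; split; first exact: cmeasurableM.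
move=> f fi; apply: aeS (kint f fi) => x ikf.
have -> : (fun y => w (x, y) * k (x, y) * f y) =
    fun y => w (x, y) * (k (x, y) * f y) by apply/funext => y; rewrite mulrA.
by apply: cintegrable_weight_mul ikf; split.
Qed.

Lemma integral_operator_qlinear k A : kernel_function k ->
  represents (integral_operator k) A -> qlinear l2ip A.
Proof.
move=> [mk kint] kA a f g; apply/eq_ae_nrm.
apply: aeS (ae_and (kint f (L2_inL2 f)) (kint g (L2_inL2 g))) => x [kf kg].
rewrite L2addE L2scaleE -!kA /integral_operator.
rewrite -cintegralZ // -cintegralD //; last exact: cintegrableZ.
by congr cintegral; apply/funext => y; rewrite L2addE L2scaleE; ring.
Qed.

Definition kernel_of (l : seq (L2 R * L2 R)) (z : R * R) : R[i] :=
  \sum_(p <- l) p.1 z.1 * (p.2 z.2)^*.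

Lemma kernel_of_section w (B : R) l f x : weight w B ->
  cintegrable (fun y => w (x, y) * kernel_of l (x, y) * f y) /\
  cintegral (fun y => w (x, y) * kernel_of l (x, y) * f y) =
  \sum_(p <- l) rwop w p f x.
Proof.
move=> wB.
have -> : (fun y => w (x, y) * kernel_of l (x, y) * f y) =
    fun y => \sum_(p <- l) p.1 x * (w (x, y) * (f y * (p.2 y)^*)).
  apply/funext => y; rewrite /kernel_of mulr_sumr mulr_suml.
  by apply: eq_bigr => p _ /=; ring.
have ip (p : L2 R * L2 R) : cintegrable (fun y => p.1 x * (w (x, y) * (f y * (p.2 y)^*))).
  by apply: cintegrableZ; exact: (cintegrable_weight f p.2 x wB).
split; first exact: cintegrable_sum.
rewrite cintegral_sum //; apply: eq_bigr => p _.
by rewrite cintegralZ //; exact: cintegrable_weight wB.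
Qed.

Lemma one_weight : weight (fun _ : R * R => 1 : R[i]) 1.
Proof.
split; first exact: cmeasurable_cst.
by move=> _; rewrite ComplexField.Normc.normc1.
Qed.

Lemma kernel_of_plain l f x : cintegrable (fun y => kernel_of l (x, y) * f y) /\
  cintegral (fun y => kernel_of l (x, y) * f y) = opl l f x.
Proof.
have [h1 h2] := kernel_of_section l f x one_weight.
have e : (fun y => 1 * kernel_of l (x, y) * f y) =
    fun y => kernel_of l (x, y) * f y by apply/funext => y; rewrite mul1r.
rewrite e in h1 h2; split => //; rewrite h2 L2sumE; apply: eq_bigr => p _.
rewrite /rwop mulrC; congr (cintegral _ * _); apply/funext => y.
by rewrite mul1r.
Qed.

Lemma cmeasurable_kernel_of l : cmeasurable (kernel_of l).
Proof.
apply: cmeasurable_sum => p; apply: cmeasurableM.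
  exact/cmeasurable_fst/inL2_meas/L2_inL2.
exact: (cmeasurable_snd (cmeasurableJ (inL2_meas (L2_inL2 p.2)))).
Qed.

Definition residual k l (z : R * R) : R[i] := k z + -1 * kernel_of l z.

Lemma residual_kernel k l : kernel_function k -> kernel_function (residual k l).
Proof.
move=> [mk kint]; split.
  apply: cmeasurableD => //; apply: cmeasurableM; first exact: cmeasurable_cst.
  exact: cmeasurable_kernel_of.
move=> f /[dup] fi /L2_lift[g gE]; apply: aeS (kint f fi) => x ikf.
have -> : (fun y => residual k l (x, y) * f y) =
    fun y => k (x, y) * f y + -1 * (kernel_of l (x, y) * f y).
  by apply/funext => y; rewrite /residual mulrDl mulrA.
apply: cintegrableD => //; apply: cintegrableZ; rewrite -gE.
by have [] := kernel_of_plain l g x.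
Qed.

(** The integral splits at almost every point only, so the new operator is the
    difference of the given ones up to null vectors. *)
Lemma residual_operator k A l : kernel_function k ->
  represents (integral_operator k) A -> exists A',
    represents (integral_operator (residual k l)) A' /\
    forall f, l2nrm (A' f - (A f - opl l f)) = 0.
Proof.
move=> kk kA; have [mr _] := residual_kernel l kk; have [mk kint] := kk.
have key f : exists g : L2 R,
    L2fun g = integral_operator (residual k l) f /\
    l2nrm (g - (A f - opl l f)) = 0.
  have eqae : {ae lebesgue_measure, forall x,
      integral_operator (residual k l) f x = (A f - opl l f) x}.
    apply: aeS (kint f (L2_inL2 f)) => x ikf; rewrite L2subE -kA.
    have [i1 e1] := kernel_of_plain l f x.
    rewrite -e1 /integral_operator -[- cintegral _]mulN1r -(cintegralZ (-1)) //.
    rewrite -cintegralD //; last exact: cintegrableZ.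
    by congr cintegral; apply/funext => y; rewrite /residual mulrDl mulrA.
  have [|||g [gE _]] := @fatou_L2 _ (fun=> A f - opl l f)
      (integral_operator (residual k l) f) _ (l2nrm_ge0 (A f - opl l f)).
  - apply: (cmeasurable_cintegral (K := fun z => residual k l z * f z.2)).
    by apply: cmeasurableM => //; exact/cmeasurable_snd/inL2_meas/L2_inL2.
  - apply: aeS eqae => x ->; apply: cvg_near_cst; apply: nearW => _.
    by rewrite subrr ComplexField.Normc.normc0.
  - by [].
  exists g; split => //; apply/eq_ae_nrm.
  by apply: aeS eqae => x <-; rewrite gE.
have [A' A'P] := choice key.
by exists A'; split => f; have [] := A'P f.
Qed.

End Kernels.

(** * The multiplier *)

Section Average.
Context {R : realFieldType}.
Implicit Types a b c : R.

(** Dividing by four keeps the average of three numbers of the unit interval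
    away from one, as dyadic levels require. *)
Definition avg3 a b c := (a + b + c) / 4.

Lemma avg3_ge0 a b c : 0 <= a -> 0 <= b -> 0 <= c -> 0 <= avg3 a b c.
Proof. by rewrite /avg3; lra. Qed.

Lemma avg3_lt1 a b c : a <= 1 -> b <= 1 -> c <= 1 -> avg3 a b c < 1.
Proof. by rewrite /avg3; lra. Qed.

Lemma avg3_incr a b c a' b' c' : a <= a' -> b <= b' -> c <= c' ->
  [/\ avg3 a b c <= avg3 a' b' c', a' - a <= 4 * (avg3 a' b' c' - avg3 a b c),
      b' - b <= 4 * (avg3 a' b' c' - avg3 a b c) &
      c' - c <= 4 * (avg3 a' b' c' - avg3 a b c)].
Proof. by rewrite /avg3 => *; split; lra. Qed.

End Average.

Section MaxMultiplier.
Context {R : realType} (psi : R -> R[i]) (V : R -> R) (K B : R).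
Hypothesis V_itv : forall t, 0 <= V t <= K.
Hypothesis psi_var : forall s t, s <= t -> normc (psi t - psi s) <= V t - V s.
Hypothesis psi_meas : cmeasurable psi.
Hypothesis psi_B : forall t, normc (psi t) <= B.
Local Notation opl := (@finop R (L2 R) l2ip).
Local Notation nrmH := (l2ip_semi_inner (R := R)).
Local Notation psimax := (fun z : R * R => psi (Num.max z.1 z.2)).

Lemma V_nd s t : s <= t -> V s <= V t.
Proof. by move=> st; rewrite -subr_ge0 (le_trans (normc_ge0 _) (psi_var st)). Qed.

Lemma psimax_weight : weight psimax B.
Proof. by split=> [|z]; [exact: cmeasurable_max|exact: psi_B]. Qed.

(* [K] may vanish, and [V] may attain it *)
Let K1 : R := K + 1.

Lemma K_ge0 : 0 <= K.
Proof. by have /andP[h1 h2] := V_itv 0; exact: le_trans h2. Qed.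

Lemma K1_gt0 : 0 < K1. Proof. by rewrite ltr_wpDl // K_ge0. Qed.

Lemma V_K1 t : V t / K1 <= 1.
Proof.
rewrite ler_pdivrMr ?K1_gt0 // mul1r /K1.
by have /andP[_] := V_itv t; lra.
Qed.

Lemma V_K1_lt1 t : V t / K1 < 1.
Proof.
rewrite ltr_pdivrMr ?K1_gt0 // mul1r /K1.
by have /andP[_] := V_itv t; lra.
Qed.

Lemma V_K1_ge0 t : 0 <= V t / K1.
Proof. by have /andP[h _] := V_itv t; rewrite divr_ge0 // ltW // K1_gt0. Qed.

Lemma max_transfer k A (tau : R) : kernel_function k ->
  represents (integral_operator k) A -> 0 <= tau ->
  (forall rho, 0 < rho -> exists l, nuc l2ip l <= tau /\
     bounded_by (fun h => A h - opl l h) rho) ->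
  exists A', represents (integral_operator (fun z => psimax z * k z)) A' /\
    bounded_by A' ((B + K1) * tau).
Proof.
have v_nd s t : s <= t -> V s / K1 <= V t / K1.
  by move=> st; rewrite ler_wpM2r ?V_nd // invr_ge0 ltW // K1_gt0.
have var s t : s <= t -> normc (psi t - psi s) <= K1 * (V t / K1 - V s / K1).
  move=> st; rewrite (le_trans (psi_var st)) // mulrBr.
  by rewrite ![K1 * _]mulrC !divfK // gt_eqF // K1_gt0.
have [c cP] := level_constants V_K1_ge0 var (ltW K1_gt0).
exact: (transfer v_nd V_K1_ge0 V_K1_lt1 psi_meas psi_B (ltW K1_gt0) cP).
Qed.

Let C : R := 2 * (B + 4 * K1 + 8 * (4 * K1 * 4)).

Lemma C_ge0 : 0 <= C.
Proof.
have B0 : 0 <= B by rewrite (le_trans (normc_ge0 _) (psi_B 0)).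
have := K1_gt0; rewrite /C; lra.
Qed.

(** The partition is adapted to the variation of [psi] and to the masses of both
    functions at once. *)
Lemma unit_rank_one_splits p (x e : R) : l2nrm p.1 <= 1 -> l2nrm p.2 <= 1 ->
  0 < x -> 0 < e -> splits (wop psimax p) (8 * x) (C / x) e.
Proof.
move=> p1 p2 x0 e0.
pose v t := avg3 (V t / K1) (mass p.1 t) (mass p.2 t).
have mass1 (f : L2 R) t : l2nrm f <= 1 -> mass f t <= 1.
  by move=> f1; rewrite (le_trans (mass_le _ _)) // exprn_ile1 // l2nrm_ge0.
have v_incr s t (st : s <= t) := avg3_incr
  (ler_wpM2r (ltW (etrans (invr_gt0 K1) K1_gt0)) (V_nd st))
  (mass_nd p.1 st) (mass_nd p.2 st).
have v_nd s t : s <= t -> v s <= v t by move=> /v_incr[].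
have v_ge0 t : 0 <= v t by apply: avg3_ge0; rewrite ?V_K1_ge0 ?mass_ge0.
have v_lt1 t : v t < 1 by apply: avg3_lt1; rewrite ?V_K1 ?mass1.
have var s t : s <= t -> normc (psi t - psi s) <= 4 * K1 * (v t - v s).
  move=> st; rewrite (le_trans (psi_var st)) //.
  have -> : V t - V s = K1 * (V t / K1 - V s / K1).
    by rewrite mulrBr ![K1 * _]mulrC !divfK // gt_eqF // K1_gt0.
  rewrite (mulrC 4) -mulrA ler_wpM2l // ?(ltW K1_gt0) //.
  by case: (v_incr s t st).
have mass_v1 s t : s <= t -> mass p.1 t - mass p.1 s <= 4 * (v t - v s).
  by move=> st; have [_ _ h _] := v_incr s t st; exact: h.
have mass_v2 s t : s <= t -> mass p.2 t - mass p.2 s <= 4 * (v t - v s).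
  by move=> st; have [_ _ _ h] := v_incr s t st; exact: h.
clearbody v.
have K4 : 0 <= 4 * K1 by rewrite mulr_ge0 // ltW // K1_gt0.
have [c cP] := level_constants v_ge0 var K4.
have massle (f : L2 R) : (forall s t, s <= t ->
    mass f t - mass f s <= 4 * (v t - v s)) ->
    forall l a, l2nrm (mulI (fun t => lev v l t == a) f) ^+ 2 <= 4 * 2^-1 ^+ l.
  move=> fv l a; apply: nrm_mulI_mass.
  - exact: lev_convex.
  - by rewrite mulr_ge0 // exprn_ge0 // invr_ge0.
  - move=> s t /eqP sa /eqP ta st; rewrite (le_trans (fv _ _ st)) //.
    by apply: ler_wpM2l => //; apply: (lev_close v_ge0); rewrite sa ta.
apply: (wop_splits v_nd v_ge0 v_lt1 psi_meas psi_B K4 cP p1 p2) => //.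
- exact: (massle _ mass_v1).
- exact: (massle _ mass_v2).
Qed.

(** Scaling: the rank does not depend on the norm of the operator. *)
Lemma rank_one_splits p (a x e : R) : l2nrm p.1 <= 1 -> l2nrm p.2 <= a ->
  0 < a -> 0 < x -> 0 < e -> splits (wop psimax p) (8 * x) (a * (C / x)) e.
Proof.
move=> p1 p2 a0 x0 e0.
have q2 : l2nrm (a^-1%:C *: p.2) <= 1.
  rewrite (nrmZ nrmH) normc_real ger0_norm ?invr_ge0 ?(ltW a0) //.
  by rewrite mulrC ler_pdivrMr // mul1r.
have := @unit_rank_one_splits (p.1, a^-1%:C *: p.2) x (e / a) p1 q2 x0.
rewrite divr_gt0 // => /(_ isT) /(splitsZ (ltW a0)).
rewrite [a * (e / a)]mulrC divfK ?gt_eqF //.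
have -> // : (fun f => a%:C *: wop psimax (p.1, a^-1%:C *: p.2) f) =
  wop psimax p.
apply/funext => f; rewrite (wop_scale p _ f psimax_weight) conjc_real scalerA.
by rewrite -rmorphM /= divff ?gt_eqF // scale1r.
Qed.

Context (D : nat -> seq (L2 R * L2 R)) (t : nat -> R) (L : R).
Hypothesis D_size : forall m, (size (D m) <= 3 * 2 ^ m)%N.
Hypothesis t_gt0 : forall m, 0 < t m.
Hypothesis D_nrm : forall m p, p \in D m -> l2nrm p.1 <= 1 /\ l2nrm p.2 <= t m ^+ 2.
Hypothesis t_sum : forall M, \sum_(m < M) 2 ^+ m * t m <= L.

Lemma L_gt0 : 0 < L.
Proof.
by have := t_sum 1; rewrite big_ord1 expr0 mul1r; exact: lt_le_trans.
Qed.

Lemma t_le m : 2 ^+ m * t m <= L.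
Proof.
rewrite (le_trans _ (t_sum m.+1)) // big_ord_recr /= lerDr sumr_ge0 // => i _.
by rewrite mulr_ge0 ?exprn_ge0 // ltW.
Qed.

(** An atom of norm [t m ^+ 2] is given a rank proportional to [t m]; both the
    total rank and the total nuclear norm are then governed by the sum of the
    [2 ^+ m * t m]. *)
Lemma truncation_splits M (n e : R) : 0 < n -> 0 < e ->
  splits (fun f => \sum_(m < M) \sum_(p <- D m) wop psimax p f)
    (24 * n) (3 * C * L ^+ 2 / n) e.
Proof.
move=> n0 e0; have L0 := L_gt0; have C0 := C_ge0.
pose S : R := \sum_(m < M) 3 * 2 ^+ m + 1.
have S0 : 0 < S.
  by rewrite ltr_wpDl // sumr_ge0 // => i _; rewrite mulr_ge0 // exprn_ge0.
pose x m := n * t m / L.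
have x0 m : 0 < x m by rewrite divr_gt0 // mulr_gt0.
have group (m : 'I_M) : splits (fun f => \sum_(p <- D m) wop psimax p f)
    (3 * 2 ^+ m * (8 * x m)) (3 * 2 ^+ m * (t m ^+ 2 * (C / x m)))
    (3 * 2 ^+ m * (e / S)).
  have h := @splits_sum R _ (D m) (fun p => wop psimax p)
    (fun=> 8 * x m) (fun=> t m ^+ 2 * (C / x m)) (fun=> e / S).
  have sz (u : R) : 0 <= u -> \sum_(p <- D m) u <= 3 * 2 ^+ m * u.
    move=> u0; rewrite big_const_seq count_predT iter_addr_0.
    rewrite -[_ *+ size _]mulr_natl ler_wpM2r //.
    by rewrite -natrX -natrM ler_nat D_size.
  apply: splits_le (h _).
  - by apply: sz; rewrite mulr_ge0 // ltW.
  - by apply: sz; rewrite mulr_ge0 ?sqr_ge0 // divr_ge0 // ltW.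
  - by apply: sz; rewrite divr_ge0 // ltW.
  move=> p pD; have [p1 p2] := D_nrm pD.
  by apply: rank_one_splits => //; rewrite ?exprn_gt0 ?divr_gt0.
have h := @splits_sum R _ (index_enum 'I_M)
  (fun (m : 'I_M) f => \sum_(p <- D m) wop psimax p f)
  (fun m => 3 * 2 ^+ m * (8 * x m))
  (fun m => 3 * 2 ^+ m * (t m ^+ 2 * (C / x m)))
  (fun m => 3 * 2 ^+ m * (e / S)) (fun m _ => group m).
apply: splits_le h.
- have -> : \sum_(m < M) 3 * 2 ^+ m * (8 * x m) =
      24 * n / L * \sum_(m < M) 2 ^+ m * t m.
    by rewrite mulr_sumr; apply: eq_bigr => m _; rewrite /x; field; rewrite gt_eqF.
  rewrite (le_trans (ler_wpM2l _ (t_sum M))) //.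
    by rewrite divr_ge0 // ?ltW // mulr_gt0.
  by rewrite divfK // gt_eqF.
- have -> : \sum_(m < M) 3 * 2 ^+ m * (t m ^+ 2 * (C / x m)) =
      3 * C * L / n * \sum_(m < M) 2 ^+ m * t m.
    rewrite mulr_sumr; apply: eq_bigr => m _; rewrite /x; field.
    by rewrite !gt_eqF.
  rewrite (le_trans (ler_wpM2l _ (t_sum M))) //.
    by apply: divr_ge0 (ltW n0); exact: mulr_ge0 (mulr_ge0 _ C0) (ltW L0).
  by rewrite le_eqVlt; apply/orP; left; apply/eqP; field; rewrite gt_eqF.
- rewrite -mulr_suml mulrCA ler_piMr ?(ltW e0) //.
  by rewrite ler_pdivrMr // mul1r lerDl.
Qed.

Context (k : R * R -> R[i]) (A : L2 R -> L2 R).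
Hypothesis k_kernel : kernel_function k.
Hypothesis kA : represents (integral_operator k) A.
Hypothesis A_approx : forall M,
  bounded_by (fun h => A h - \sum_(m < M) opl (D m) h) ((L / 2 ^+ M) ^+ 2).

Definition tail M : R := 3 * L ^+ 2 / 2 ^+ M.

Lemma tail_ge0 M : 0 <= tail M.
Proof. by rewrite divr_ge0 ?exprn_ge0 // mulr_ge0 // sqr_ge0. Qed.

Lemma pow2_unbounded (y : R) : exists n, y <= 2 ^+ n.
Proof.
exists (Num.truncn y).+1; apply: ltW; apply: (lt_trans (truncnS_gt y)).
by rewrite -natrX ltr_nat ltn_expl.
Qed.

(** For [m] at least [M], the nuclear norm of the group [D m] is at most
    [3 * 2 ^+ m * t m ^+ 2], where one factor [t m] is at most [L / 2 ^+ M]. *)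
Lemma tail_approx M (rho : R) : 0 < rho -> exists l, nuc l2ip l <= tail M /\
  bounded_by (fun h => A h - \sum_(m < M) opl (D m) h - opl l h) rho.
Proof.
move=> rho0; have L0 := L_gt0.
have [j jP] := pow2_unbounded (Num.max 1 (L ^+ 2 / rho)).
exists (flatten [seq D m | m <- iota M j]); split.
  rewrite nuc_flatten.
  apply: (@le_trans _ _ (\sum_(m <- iota M j) 3 * L / 2 ^+ M * (2 ^+ m * t m))).
    rewrite big_seq [leRHS]big_seq; apply: ler_sum => m.
    rewrite mem_iota => /andP[Mm _].
    apply: (@le_trans _ _ (\sum_(p <- D m) t m ^+ 2)).
      rewrite /nuc big_seq [leRHS]big_seq; apply: ler_sum => p pD.
      have [p1 p2] := D_nrm pD.
      by rewrite -[leRHS]mul1r ler_pM ?l2nrm_ge0.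
    rewrite big_const_seq count_predT iter_addr_0 -[_ *+ size _]mulr_natl.
    apply: (@le_trans _ _ (3 * 2 ^+ m * t m ^+ 2)).
      by rewrite ler_wpM2r ?sqr_ge0 // -natrX -natrM ler_nat D_size.
    have -> : 3 * 2 ^+ m * t m ^+ 2 = 3 * t m * (2 ^+ m * t m) by ring.
    rewrite ler_wpM2r ?mulr_ge0 ?exprn_ge0 ?(ltW (t_gt0 m)) //.
    rewrite -mulrA ler_wpM2l // ler_pdivlMr ?exprn_gt0 // mulrC.
    rewrite (le_trans _ (t_le m)) // ler_wpM2r ?(ltW (t_gt0 m)) //.
    by rewrite ler_eXn2l // ltr1n.
  rewrite -mulr_sumr.
  have : \sum_(m <- iota M j) 2 ^+ m * t m <= L.
    rewrite (le_trans _ (t_sum (M + j))) // -[leRHS](big_iota0 _ _ _ (fun m => 2 ^+ m * t m)).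
    rewrite iotaD add0n big_cat /=.
    rewrite lerDr sumr_ge0 // => m _.
    by rewrite mulr_ge0 ?exprn_ge0 // ltW.
  move=> /(ler_wpM2l _) h; rewrite (le_trans (h _ _)) //.
    by rewrite divr_ge0 ?exprn_ge0 // mulr_ge0 // ltW.
  by rewrite /tail le_eqVlt; apply/orP; left; apply/eqP; ring.
move=> h; rewrite finop_flatten -(big_iota0 _ _ M (fun m => opl (D m) h)).
rewrite -addrA -opprD -big_cat -[X in iota X j]add0n -iotaD big_iota0.
rewrite (le_trans (A_approx (M + j) h)) // ler_wpM2r ?l2nrm_ge0 //.
have j1 : 1 <= 2 ^+ j :> R by rewrite (le_trans _ jP) // le_max lexx.
have j2 : L ^+ 2 / rho <= 2 ^+ j by rewrite (le_trans _ jP) // le_max lexx orbT.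
have Mj : 2 ^+ j <= (2 ^+ (M + j)) ^+ 2 :> R.
  rewrite exprD exprMn -[leLHS]mul1r ler_pM ?exprn_ge0 //.
    by rewrite -exprM exprn_ege1 // ler1n.
  by rewrite expr2 ler_peMr ?exprn_ge0.
rewrite exprMn exprVn ler_pdivrMr ?exprn_gt0 //.
rewrite mulrC -ler_pdivrMr // (le_trans j2) //.
Qed.

Lemma max_kernel : kernel_function (fun z => psimax z * k z).
Proof. exact: kernel_functionM psimax_weight k_kernel. Qed.

Lemma max_operator : exists (A' : L2 R -> L2 R) (b : R),
  [/\ represents (integral_operator (fun z => psimax z * k z)) A',
      qlinear l2ip A', 0 <= b & bounded_by A' b].
Proof.
have BK : 0 <= B + K1.
  by rewrite addr_ge0 ?(ltW K1_gt0) // (le_trans (normc_ge0 _) (psi_B 0)).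
have [rho rho0|A' [kA' A'b]] := max_transfer k_kernel kA (tail_ge0 0).
  have [l [nl lA]] := tail_approx 0 rho0; exists l; split => // h.
  by have := lA h; rewrite big_ord0 subr0.
exists A', ((B + K1) * tail 0); split => //.
- exact: integral_operator_qlinear max_kernel kA'.
- by rewrite mulr_ge0 // tail_ge0.
Qed.

(** [max_transfer] applied to [k] minus the kernel of the first [M] groups. *)
Lemma max_truncation A' M :
  represents (integral_operator (fun z => psimax z * k z)) A' ->
  bounded_by (fun f => A' f - \sum_(m < M) \sum_(p <- D m) wop psimax p f)
    ((B + K1) * tail M).
Proof.
move=> kA'.
pose l := flatten [seq D m | m <- iota 0 M].
have [Ar [kAr ArE]] := residual_operator l k_kernel kA.
have [rho rho0|A'' [kA'' A''b]] :=
    max_transfer (residual_kernel l k_kernel) kAr (tail_ge0 M).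
  have [l' [nl lA]] := tail_approx M rho0; exists l'; split => // h.
  rewrite (le_trans (nrmB nrmH _ (A h - opl l h) _)) // ArE add0r.
  by have := lA h; rewrite /l finop_flatten big_iota0.
move=> f; suff e : l2nrm (A' f - \sum_(m < M) \sum_(p <- D m) wop psimax p f -
    A'' f) = 0.
  rewrite -[X in l2nrm X](subrK (A'' f)) (le_trans (nrmD nrmH _ _)) //.
  by rewrite e add0r.
apply/eq_ae_nrm; have [_ kint] := k_kernel.
apply: aeS (kint f (L2_inL2 f)) => x ikf.
rewrite L2subE -kA' -kA''.
have [i1 e1] := kernel_of_section l f x psimax_weight.
have -> : (\sum_(m < M) \sum_(p <- D m) wop psimax p f) x =
    \sum_(p <- l) rwop psimax p f x.
  rewrite L2sumE /l big_flatten big_map big_iota0; apply: eq_bigr => m _.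
  by rewrite L2sumE; apply: eq_bigr => p _; rewrite (wopE _ _ psimax_weight).
rewrite -e1 /integral_operator -[- cintegral _]mulN1r -(cintegralZ (-1)) //.
have ik : cintegrable (fun y => psimax (x, y) * k (x, y) * f y).
  have -> : (fun y => psimax (x, y) * k (x, y) * f y) =
    fun y => psimax (x, y) * (k (x, y) * f y).
    by apply/funext => y; rewrite mulrA.
  exact: (cintegrable_weight_mul x psimax_weight ikf).
rewrite -cintegralD //; last exact: cintegrableZ.
by congr cintegral; apply/funext => y; rewrite /residual; ring.
Qed.

Lemma max_weak_schatten :
  weak_schatten (2^-1 : R) (integral_operator (fun z => psimax z * k z)).
Proof.
pose T := integral_operator (fun z => psimax z * k z).
have [A' [b [kA' linA' b0 A'b]]] := max_operator.
split; first exact: represents_bounded kA' linA' b0 A'b.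
have L0 := L_gt0; have C0 := C_ge0.
pose C1 := 2 + 3 * C * L ^+ 2.
have CL0 : 0 <= 3 * C * L ^+ 2 by exact: mulr_ge0 (mulr_ge0 _ C0) (sqr_ge0 L).
have C10 : 0 <= C1 by exact: addr_ge0.
have BK : 0 <= B + K1.
  by rewrite addr_ge0 ?(ltW K1_gt0) // (le_trans (normc_ge0 _) (psi_B 0)).
(* rank [24 * N] from the truncation and [2 * N] from its nuclear part *)
have small N n : (0 < N)%N -> (26 * N <= n)%N ->
    (singular_number n T <=
     (C1 / N%:R ^+ 2)%:E)%E.
  move=> N0 Nn; have NR : 0 < N%:R :> R by rewrite ltr0n.
  pose d : R := (N%:R ^+ 2)^-1.
  have d0 : 0 < d by rewrite invr_gt0 exprn_gt0.
  have [M MP] := pow2_unbounded ((B + K1) * (3 * L ^+ 2) / d).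
  have tM : (B + K1) * tail M <= d.
    rewrite /tail mulrA ler_pdivrMr ?exprn_gt0 //.
    by rewrite -ler_pdivrMl // [leLHS]mulrC.
  have sp := splits_perturb (max_truncation M kA')
    (truncation_splits M NR d0).
  have nu0 : 0 <= 3 * C * L ^+ 2 / N%:R.
    by rewrite divr_ge0.
  have e0 : 0 <= (B + K1) * tail M + d.
    by rewrite addr_ge0 ?(ltW d0) // mulr_ge0 // tail_ge0.
  have := splits_singular (N := N) (n := n) kA' sp e0 nu0.
  move=> /(_ _)/le_trans; apply.
    rewrite -muln2 natrM (_ : 24 * N%:R + N%:R * 2 = 26 * N%:R); last by ring.
    by rewrite -natrM ler_nat.
  rewrite lee_fin -/d.
  have h1 : 3 * C * L ^+ 2 / N%:R / N.+1%:R <= 3 * C * L ^+ 2 * d.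
    rewrite -mulrA ler_wpM2l //.
    rewrite /d -invfM lef_pV2 ?posrE ?mulr_gt0 ?ltr0n // ?exprn_gt0 //.
    by rewrite expr2 ler_wpM2l // ler_nat.
  by rewrite [leRHS]mulrDl lerD // mulr_natl mulr2n lerD2r.
exists (52 ^+ 2 * (b + C1)) => n.
have -> : (1 + n%:R : R) `^ (- (2^-1)^-1) = (n.+1%:R ^+ 2)^-1.
  by rewrite invrK powRN powR_mulrn ?addr_ge0 // addrC natr1.
have n1 : 0 < n.+1%:R :> R by [].
have [n26|n26] := ltnP n 26.
  have sb : (singular_number n T <=
      b%:E)%E.
    apply: (singular_number_le (l := [::]) kA' b0) => // f.
    by rewrite finop_nil subr0.
  rewrite (le_trans sb) // lee_fin ler_pdivlMr ?exprn_gt0 //.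
  rewrite mulrC ler_pM ?sqr_ge0 //; last by rewrite lerDl.
  by rewrite ler_pXn2r ?nnegrE // ler_nat (leq_trans n26).
pose N := (n %/ 26)%N.
have N0 : (0 < N)%N by rewrite divn_gt0.
have Nn : (26 * N <= n)%N by rewrite mulnC leq_trunc_div.
(* [n.+1 <= 26 * (N + 1)], and [N] is positive *)
have nN : (n.+1 <= 52 * N)%N.
  have := divn_eq n 26; have := ltn_mod n 26; rewrite -/N; lia.
rewrite (le_trans (small N n N0 Nn)) // lee_fin.
have NR : 0 < N%:R :> R by rewrite ltr0n.
rewrite ler_pdivrMr ?exprn_gt0 // mulrAC ler_pdivlMr ?exprn_gt0 //.
have -> : 52 ^+ 2 * (b + C1) * N%:R ^+ 2 = (b + C1) * (52 * N%:R) ^+ 2 by ring.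
rewrite ler_pM ?sqr_ge0 //; first by rewrite lerDr.
by rewrite ler_pXn2r ?nnegrE ?mulr_ge0 // -natrM ler_nat.
Qed.

End MaxMultiplier.

Theorem theorem7p4 (R : realType) (psi : R -> R[i])
    (psi_bv : bounded_variation_line psi) :
  weak_schur_multiplier (2^-1 : R) (fun z : R * R => psi (Num.max z.1 z.2)).
Proof.
move=> k kk sk.
have [V [K [K0 VK var]]] := variation_function psi_bv.
have psi_meas := variation_measurable var.
have psi_B t : normc (psi t) <= normc (psi 0) + K.
  have -> : psi t = psi 0 + (psi t - psi 0) by ring.
  rewrite (le_trans (le_normcD _ _)) // lerD2l.
  have /andP[t0 tK] := VK t; have /andP[z0 zK] := VK 0.
  have [h|h] := leP 0 t; first by rewrite (le_trans (var _ _ h)) //; lra.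
  by rewrite -normcN opprB (le_trans (var _ _ (ltW h))) //; lra.
have [A [kA linA _]] := bounded_represents sk.1.
have [D [t [L [Ds t0 Dn tL Aa]]]] := atomic_decomposition sk kA linA.
split; first exact (max_kernel psi_meas psi_B kk).
exact: (max_weak_schatten VK var psi_meas psi_B Ds t0 Dn tL kk kA Aa).
Qed.
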